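(* Let $(X,T)$ be a subshift of finite type, let $g\in C(X)$, and let $d\ge 1$. Then: (1) For fixed $s>0$, any locally constant cocycle $A\in\mathcal{M}(X,d)$ is a continuity point of the pressure map $B\mapsto P_g(B,s)$ on $\mathcal{M}(X,d)$, in the $L^\infty(X,\mathbb{R}^{d\times d})$ topology. (2) Let $A\in\mathcal{M}(X,d)$ be locally constant and $s\ge 0$. If $s\notin\{0,1,\ldots,d-1\}$, or if $A$ takes values in $GL_d(\mathbb{R})$, then $(A,s)$ is a continuity point of the map $(B,t)\mapsto P_g(B,t)$ on $\mathcal{M}(X,d)\times[0,\infty)$, where $\mathcal{M}(X,d)$ carries the $L^\infty(X,\mathbb{R}^{d\times d})$ topology.
   Context: Subshifts of finite type are over a finite alphabet; $T$ is the left shift, points are written $x=(x_1,x_2,\ldots)$. $X^*_n$ is the set of words of length $n$ allowed in $X$, and for $\mathbf{i}\in X^*_n$, $[\mathbf{i}]$ is the cylinder of points of $X$ whose first $n$ symbols form $\mathbf{i}$. $C(X)$ is the set of real continuous functions on $X$; $S_ng(x)=\sum_{i=0}^{n-1}g(T^ix)$. $\mathcal{M}(X,d)$ is the collection of all $d\times d$ matrix cocycles on $X$, i.e. all maps $A:X\to\mathbb{R}^{d\times d}$ (not necessarily continuous), with $A(x,n)=A(T^{n-1}x)\cdots A(x)$. The $L^\infty$ topology is that of uniform closeness on $X$. $A$ is locally constant if $A(x)$ depends only on the first coordinate $x_1$ of $x$. For $M\in\mathbb{R}^{d\times d}$ with singular values $\alpha_1(M)\ge\cdots\ge\alpha_d(M)$: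 $\phi^s(M)=\alpha_1(M)\cdots\alpha_m(M)\alpha_{m+1}(M)^{s-m}$, $m=\lfloor s\rfloor$, for $0\le s\le d$ (so $\phi^d(M)=|\det M|$), with $0^0=1$, and $\phi^s(M)=|\det M|^{s/d}$ for $s>d$. The pressure is $$P_g(A,s)=\lim_{n\to\infty}\frac1n\log\Big(\sum_{\mathbf{i}\in X^*_n}\ \sup_{y\in[\mathbf{i}]}\exp(S_ng(y))\,\phi^s(A(y,n))\Big),$$ where the limit exists and equals the infimum over $n$ by sub-multiplicativity; it may equal $-\infty$. *)

(* Defs.v *)
From mathcomp Require Import all_boot all_order all_algebra.
From mathcomp Require Import polyrcf.
From mathcomp Require Import all_classical all_reals all_analysis.

Set Implicit Arguments.
Unset Strict Implicit.
Unset Printing Implicit Defensive.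

Import Order.TTheory GRing.Theory Num.Theory.
Import numFieldNormedType.Exports.

Local Open Scope classical_set_scope.
Local Open Scope ring_scope.

Section SubshiftOfFiniteType.
Context {S : finType}.

(* Points are indexed from 0: the coordinate x_(k+1) of a point x is x k. *)
Definition sft (F : seq (seq S)) : set {ptws nat -> discrete_topology S} :=
  [set x | forall (k : nat) (w : seq S), w \in F ->
     mkseq (fun i => x (k + i)%N : S) (size w) <> w].

Context {F : seq (seq S)}.

Lemma sft_shift (x : {ptws nat -> discrete_topology S}) :
  sft F x -> sft F (fun n => x n.+1).
Proof. by move=> Fx k w wF; exact: Fx k.+1 w wF. Qed.

(* The sigma type underlying [sft F] carries the subspace topology. *)
Definition shift (x : sft F) : sft F :=
  SigSub (mem_set (sft_shift (set_valP x))).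

Definition coord (x : sft F) : nat -> S := set_val x.

Definition cylinder n (w : n.-tuple S) : set (sft F) :=
  [set x | forall i : 'I_n, coord x i = tnth w i].

Definition allowed n : {set n.-tuple S} :=
  [set w : n.-tuple S | `[< cylinder w !=set0 >]]%SET.

Definition locally_constant (V : Type) (f : sft F -> V) : Prop :=
  forall x y : sft F, coord x 0%N = coord y 0%N -> f x = f y.

End SubshiftOfFiniteType.

Arguments allowed {S} F n.

Section SingularValueFunction.
Context {R : realType} {d : nat}.
Implicit Type M : 'M[R]_d.

(* Square roots of the eigenvalues of M^T M, with algebraic multiplicity, in
   decreasing order; (singular_values M)`_k is alpha_(k+1) M. *)
Definition singular_values M : seq R :=
  let p := char_poly (M^T *m M) in
  sort >=%R (flatten [seq nseq (mup a p) (Num.sqrt a) | a <- rootsR p]).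

(* [powR] satisfies 0 `^ 0 = 1 and 0 `^ a = 0 for a != 0. For s = d the last
   factor reads past the end of the sequence and is 0 `^ 0 = 1. *)
Definition phi (s : R) M : R :=
  if s <= d%:R then
    let m := Num.truncn s in
    (\prod_(k < m) (singular_values M)`_k)
      * (singular_values M)`_m `^ (s - m%:R)
  else `|\det M| `^ (s / d%:R).

End SingularValueFunction.

Section Pressure.
Context {R : realType} {S : finType} {F : seq (seq S)} {d : nat}.

Definition birkhoff_sum (g : sft F -> R) (n : nat) (x : sft F) : R :=
  \sum_(i < n) g (iter i shift x).

Fixpoint cocycle_prod (A : sft F -> 'M[R]_d) (x : sft F) (n : nat) : 'M[R]_d :=
  if n is n'.+1 then A (iter n' shift x) *m cocycle_prod A x n' else 1%:M.

Definition partition_sum (g : sft F -> R) (A : sft F -> 'M[R]_d) (s : R)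
    (n : nat) : \bar R :=
  (\sum_(w in allowed F n)
    ereal_sup [set (expR (birkhoff_sum g n y) * phi s (cocycle_prod A y n))%:E
              | y in cylinder w])%E.

(* Valued in \bar R: the limit can be -oo (with lne 0 = -oo), and the suprema
   can be +oo for an unbounded A. *)
Definition pressure (g : sft F -> R) (A : sft F -> 'M[R]_d) (s : R) : \bar R :=
  limn (fun n : nat => ((n%:R^-1)%:E * lne (partition_sum g A s n))%E).

End Pressure.

(* Main.v *)
Require Import Defs.
From mathcomp Require Import all_boot all_order all_algebra.
From mathcomp Require Import perm ring lra zify polyrcf spectral complex.
From mathcomp Require Import all_classical all_reals all_analysis.
Import Order.TTheory GRing.Theory Num.Theory.
Import numFieldNormedType.Exports.

(** Write [A(w)] for the product of the matrices of a locally constant cocycle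
    along a word [w], and [Om(w)] for the supremum of [exp(S_n g)] over the
    cylinder of [w]; the sum that defines the pressure is then the sum of
    [Om(w) phi^s(A(w))] over the words of length [n].

    Upper semicontinuity is soft.  The pressure is, up to a multiplicative
    constant that depends only on [d], an infimum over [n] of quantities that
    for fixed [n] are upper semicontinuous at a locally constant cocycle, since
    only finitely many products occur there, and left continuous in the exponent; raising the exponent from [s'] to [t] costs at
    most a factor [K^(n (t - s'))].  This is [pressure_usc].

    Lower semicontinuity needs products of matrices that survive a perturbation.
    Let [N_k(M)] be the sum of the absolute values of the [k] by [k] minors of
    [M].  It is submultiplicative by the Cauchy-Binet formula, comparable with
    the product of the first [k] singular values, and obeys the gap inequality
    ([minor_norm_gap])

      [N_k(X Y) N_k(Y Z) <= C (N_k(X Y Z) N_k(Y)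
                               + N_k(X) N_k(Z) N_(k-1)(Y) N_(k+1)(Y))],

    so that [N_k] is almost multiplicative across a block [Y] with a spectral
    gap, that is, with [N_(k-1)(Y) N_(k+1)(Y)] much smaller than [N_k(Y)^2].
    Up to constants, [phi^s] is bounded below by each interpolation
    [N_p^x N_q^y] between integers [p < s < q], by [N_s] if [s] is an integer, and
    by a power of [N_d] if [s > d], and it is comparable with one of these; the
    last two cases are written with [p = q].  Among the pairs [(p, q)] whose sums grow at the rate of the pressure, take
    one with [q - p] maximal ([dominant_pair]).  A word without a gap at [p] or
    [q] is controlled either by a longer pair, whose growth is strictly smaller,
    or by [phi^s] with an exponential gain ([control_exists]); hence the words of
    a large length [b] without a gap carry an exponentially small part of the
    sum ([nongap_mass]).

    Take the words of length [b] as letters.  An exponential Markov estimate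
    ([typical_mass]) shows that most of the sum is carried by words
    whose weight is not much smaller than the product of the weights of their
    letters and that have few letters without a gap.  In such a word the rising sun lemma and an
    avalanche argument over blocks of doubling length find two distant
    occurrences of one letter [k] such that the word [z] between them meets [k] with a
    loss bounded independently of its length ([word_selection]); a pigeonhole
    argument then fixes [k] and the length of [z] while keeping the growth rate
    ([loop_extraction]).

    The loops [k z] can be concatenated freely.  The conditions that make
    [N_p] and [N_q] almost multiplicative along [k z_1 k z_2 k ...] are finitely
    many strict inequalities between continuous functions of finitely many
    matrices, so they persist for every cocycle that is uniformly close
    ([stability]), and the avalanche principle ([avalanche_chain]) bounds the
    minor norms of its products below with a fixed loss per loop, which is
    negligible when the loops are long.  This gives [pressure_lsc], for
    exponents [x] and [y] that may move as well.

    Moving the exponents settles all [t] near [s] unless [p = q = s < d].  In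
    that case [t < s] is settled by the comparison with the exponent [s], and
    [t > s] by the bound from below on the last singular value that an
    invertible cocycle provides ([growth_exponent_down]). *)

Set Implicit Arguments.
Unset Strict Implicit.
Unset Printing Implicit Defensive.

Local Open Scope classical_set_scope.
Local Open Scope ring_scope.

(** * Minors and the Cauchy-Binet formula *)

Section Minors.
Context {K : numFieldType}.

(** Expand each row of [A *m B] by multilinearity of the determinant. *)
Lemma det_mulmx_rowsub (k d : nat) (A : 'M[K]_(k, d)) (B : 'M[K]_(d, k)) :
  \det (A *m B) =
  \sum_(h : {ffun 'I_k -> 'I_d}) (\prod_i A i (h i)) * \det (rowsub h B).
Proof.
rewrite /determinant.
under eq_bigr => s _ do under eq_bigr => i _ do rewrite mxE.
under eq_bigr => s _ do rewrite bigA_distr_bigA /=.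
under eq_bigr => s _ do rewrite big_distrr /=.
rewrite exchange_big /=; apply: eq_bigr => h _.
rewrite big_distrr /=; apply: eq_bigr => s _.
rewrite big_split /= mulrCA; congr (_ * (_ * _)).
by apply: eq_bigr => i _; rewrite !mxE.
Qed.

(** The sum runs over all maps [h] rather than over increasing ones, so each
    minor is counted [k`!] times; averaging [det_mulmx_rowsub] over the
    permutations of ['I_k] turns the product of entries into a determinant. *)
Lemma cauchy_binet (k d : nat) (A : 'M[K]_(k, d)) (B : 'M[K]_(d, k)) :
  k`!%:R * \det (A *m B) =
  \sum_(h : {ffun 'I_k -> 'I_d}) \det (colsub h A) * \det (rowsub h B).
Proof.
rewrite det_mulmx_rowsub.
pose act (s : 'S_k) (h : {ffun 'I_k -> 'I_d}) := [ffun i => h (s i)].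
have actK s : cancel (act s) (act s^-1%g).
  by move=> h; apply/ffunP => i; rewrite !ffunE permKV.
have actK' s : cancel (act s^-1%g) (act s).
  by move=> h; apply/ffunP => i; rewrite !ffunE permK.
transitivity (\sum_(h : {ffun 'I_k -> 'I_d}) \sum_(s : 'S_k)
   (-1) ^+ s * (\prod_i A i (h (s i))) * \det (rowsub h B)); last first.
  apply: eq_bigr => h _; rewrite /(\det (colsub h A)) big_distrl /=.
  by apply: eq_bigr => s _; congr (_ * _ * _); apply: eq_bigr => i _; rewrite !mxE.
rewrite exchange_big /=.
transitivity (\sum_(s : 'S_k) \sum_(h : {ffun 'I_k -> 'I_d})
   (\prod_i A i (h i)) * \det (rowsub h B)).
  by rewrite sumr_const card_Sn mulr_natl.
apply: eq_bigr => s _.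
rewrite [RHS](reindex (act s^-1%g)) /=; last first.
  by exists (act s) => h _; [apply: actK'|apply: actK].
apply: eq_bigr => h _.
have -> : rowsub (act s^-1%g h) B = row_perm s^-1%g (rowsub h B).
  by apply/matrixP => i j; rewrite !mxE /act ffunE.
rewrite row_permE det_mulmx det_perm odd_permV.
have -> : \prod_i A i (act s^-1%g h (s i)) = \prod_i A i (h i).
  by apply: eq_bigr => i _; rewrite ffunE permK.
by rewrite [RHS]mulrACA -signr_addb addbb expr0 mul1r.
Qed.

Section Size.
Context {k d : nat}.
Implicit Types (X Y Z : 'M[K]_d) (f g h : {ffun 'I_k -> 'I_d}).

Lemma minor_mul X Y f g :
  k`!%:R * \det (mxsub f g (X *m Y)) =
  \sum_(h : {ffun 'I_k -> 'I_d}) \det (mxsub f h X) * \det (mxsub h g Y).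
Proof.
have -> : mxsub f g (X *m Y) = rowsub f X *m colsub g Y.
  by apply/matrixP => i j; rewrite !mxE; apply: eq_bigr => l _; rewrite !mxE.
rewrite cauchy_binet; apply: eq_bigr => h _.
by congr (_ * _); congr (\det _); apply/matrixP => i j; rewrite !mxE.
Qed.

Lemma minor_ninj X f g : ~~ injectiveb f -> \det (mxsub f g X) = 0.
Proof.
move=> /injectivePn [i [j ij fij]].
by apply: (determinant_alternate ij) => l; rewrite !mxE fij.
Qed.

Lemma minor_ninjr X f g : ~~ injectiveb g -> \det (mxsub f g X) = 0.
Proof.
move=> gi; rewrite -det_tr.
have -> : (mxsub f g X)^T = mxsub g f X^T by apply/matrixP => i j; rewrite !mxE.
exact: minor_ninj.
Qed.

Lemma minor_diagr X (s : 'rV[K]_d) f h :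
  \det (mxsub f h (X *m diag_mx s)) = \det (mxsub f h X) * \prod_i s 0 (h i).
Proof.
have -> : mxsub f h (X *m diag_mx s) =
    mxsub f h X *m diag_mx (\row_i s 0 (h i)).
  apply/matrixP => i j; rewrite !mxE.
  rewrite (bigD1 (h j)) //= big1 ?addr0; last first.
    by move=> l /negPf lj; rewrite !mxE lj mulr0n mulr0.
  rewrite (bigD1 j) //= big1 ?addr0; last first.
    by move=> l /negPf lj; rewrite !mxE lj mulr0n mulr0.
  by rewrite !mxE !eqxx !mulr1n.
by rewrite det_mulmx det_diag; congr (_ * _); apply: eq_bigr => i _; rewrite mxE.
Qed.

End Size.

(** Up to constants this is the norm of the [k]-th exterior power of [X].  The
    sum over all maps, repeated and permuted indices included, avoids any
    choice of increasing multi-indices. *)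
Definition minor_norm (k : nat) {d : nat} (X : 'M[K]_d) : K :=
  \sum_(f : {ffun 'I_k -> 'I_d}) \sum_(g : {ffun 'I_k -> 'I_d})
     `|\det (mxsub f g X)|.

Lemma minor_norm_ge0 k d (X : 'M[K]_d) : 0 <= minor_norm k X.
Proof. by apply: sumr_ge0 => f _; apply: sumr_ge0. Qed.

Lemma minor_le_norm k d (X : 'M[K]_d) (f g : {ffun 'I_k -> 'I_d}) :
  `|\det (mxsub f g X)| <= minor_norm k X.
Proof.
rewrite /minor_norm (bigD1 f) //= (bigD1 g) //= -addrA lerDl.
by rewrite addr_ge0 ?sumr_ge0 // => f' _; apply: sumr_ge0.
Qed.

Lemma minor_norm0 d (X : 'M[K]_d) : minor_norm 0 X = 1.
Proof.
have f0 : {ffun 'I_0 -> 'I_d} by apply: finfun; case.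
have E (f : {ffun 'I_0 -> 'I_d}) : f = f0 by apply/ffunP; case.
rewrite /minor_norm (big_pred1 f0) => [|f]; last by rewrite (E f) !inE eqxx.
rewrite (big_pred1 f0) => [|f]; last by rewrite (E f) !inE eqxx.
by rewrite det_mx00 normr1.
Qed.

Lemma minor_norm_gt_dim k d (X : 'M[K]_d) : (d < k)%N -> minor_norm k X = 0.
Proof.
move=> dk; apply: big1 => f _; apply: big1 => g _; apply/normr0P/eqP.
apply: minor_ninj; apply/injectiveP => /leq_card.
by rewrite !card_ord leqNgt dk.
Qed.

(** The overcounting in [cauchy_binet] makes this hold with constant one. *)
Lemma minor_normM k d (X Y : 'M[K]_d) :
  minor_norm k (X *m Y) <= minor_norm k X * minor_norm k Y.
Proof.
have fgt : 0 < k`!%:R :> K by rewrite ltr0n fact_gt0.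
rewrite -(ler_pM2l fgt).
apply: (@le_trans _ _ (\sum_(f : {ffun 'I_k -> 'I_d})
   \sum_(g : {ffun 'I_k -> 'I_d}) \sum_(h : {ffun 'I_k -> 'I_d})
     `|\det (mxsub f h X)| * `|\det (mxsub h g Y)|)).
  rewrite /minor_norm big_distrr; apply: ler_sum => f _ /=.
  rewrite big_distrr; apply: ler_sum => g _ /=.
  rewrite -[X in X * _](gtr0_norm fgt) -normrM minor_mul.
  apply: le_trans (ler_norm_sum _ _ _) _.
  by apply: ler_sum => h _; rewrite normrM.
apply: (@le_trans _ _ (minor_norm k X * minor_norm k Y)); last first.
  rewrite ler_peMl ?mulr_ge0 ?minor_norm_ge0 //.
  by rewrite ler1n fact_gt0.
rewrite /minor_norm big_distrl; apply: ler_sum => f _ /=.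
rewrite exchange_big /= big_distrl; apply: ler_sum => h _ /=.
rewrite -big_distrr /=; apply: ler_wpM2l => //.
rewrite [leRHS](bigD1 h) //= lerDl.
by apply: sumr_ge0 => ? _; apply: sumr_ge0.
Qed.

Lemma minor_norm_bound k d (U : 'M[K]_d) : (forall i j, `|U i j| <= 1) ->
  minor_norm k U <= (k`! * ((d ^ k) * (d ^ k)))%:R.
Proof.
move=> U1.
have B (f g : {ffun 'I_k -> 'I_d}) : `|\det (mxsub f g U)| <= k`!%:R.
  apply: le_trans (ler_norm_sum _ _ _) _.
  rewrite -card_Sn -sumr_const; apply: ler_sum => s _.
  rewrite normrM normrX normrN1 expr1n mul1r normr_prod.
  by apply: prodr_ile1 => i _; rewrite mxE normr_ge0 U1.
apply: (@le_trans _ _ (\sum_(f : {ffun 'I_k -> 'I_d})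
   \sum_(g : {ffun 'I_k -> 'I_d}) k`!%:R)).
  by apply: ler_sum => f _; apply: ler_sum => g _.
by rewrite !sumr_const card_ffun !card_ord -!mulrnA mulnA.
Qed.

End Minors.

(** * Minors of products with a diagonal matrix *)

Section DiagMinors.
Context {K : numFieldType} {d : nat} (sg : nat -> K).
Hypothesis sg_ge0 : forall i, 0 <= sg i.
Hypothesis sg_dec : forall i j, (i <= j)%N -> sg j <= sg i.

Lemma set_max_elt (A : {set 'I_d}) : A != finset.set0 ->
  exists2 m : 'I_d, m \in A & (#|A| <= m.+1)%N /\ forall i, i \in A -> (i <= m)%N.
Proof.
case/set0Pn => i0 Ai0.
pose m := [arg max_(i > i0 in A) (i : nat)].
have [Am Hm] : m \in A /\ forall i, i \in A -> (i <= m)%N.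
  by rewrite /m; case: arg_maxnP.
exists m => //; split=> //.
rewrite cardE -(size_map (@nat_of_ord d)) -[m.+1](size_iota 0).
apply: uniq_leq_size; first by rewrite map_inj_uniq ?enum_uniq //; exact: val_inj.
by move=> _ /mapP [i + ->]; rewrite mem_enum mem_iota /= add0n ltnS; apply: Hm.
Qed.

(** Remove the largest element of [A]: it is at least [#|A|.-1]. *)
Lemma prod_set_le_top (A : {set 'I_d}) :
  \prod_(i in A) sg i <= \prod_(i < #|A|) sg i.
Proof.
move eqn : #|A| => n; elim: n A eqn => [|n IH] A An.
  by rewrite big_ord0 (cards0_eq An) big_set0.
have A0 : A != finset.set0 by rewrite -card_gt0 An.
have [m Am [Anm _]] := set_max_elt A0.
rewrite (big_setD1 m) //= big_ord_recr /= mulrC.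
apply: ler_pM => //; first by apply: prodr_ge0.
- by apply: IH; rewrite (cardsD1 m A) Am add1n in An; case: An.
- by apply: sg_dec; rewrite An in Anm.
Qed.

Lemma prod_inj_le_top k (f : 'I_k -> 'I_d) : injective f ->
  \prod_i sg (f i) <= \prod_(i < k) sg i.
Proof.
move=> fi; have := prod_set_le_top (f @: 'I_k).
by rewrite big_imset /= ?card_imset // ?card_ord // => ? ? ? ?; apply: fi.
Qed.

(** One index lies beyond the first [k.+1]; the others contribute at most the
    [k] largest values. *)
Lemma prod_inj_le_second k (f : 'I_k.+1 -> 'I_d) (i0 : 'I_k.+1) : injective f ->
  (k.+1 <= f i0)%N ->
  \prod_i sg (f i) <= (\prod_(i < k) sg i) * sg k.+1.
Proof.
move=> fi ki0; pose A := f @: 'I_k.+1.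
have cA : #|A| = k.+1 by rewrite card_imset // card_ord.
have -> : \prod_i sg (f i) = \prod_(j in A) sg j.
  by rewrite big_imset //= => ? ? ? ?; apply: fi.
have A0 : A != finset.set0 by rewrite -card_gt0 cA.
have [m Am [_ Hm]] := set_max_elt A0.
rewrite (big_setD1 m) //= mulrC.
apply: ler_pM => //; first by apply: prodr_ge0.
- have := prod_set_le_top (A :\ m)%SET.
  by move: cA; rewrite (cardsD1 m A) Am add1n => -[->].
- apply: sg_dec; apply: leq_trans ki0 (Hm _ _).
  by apply/imsetP; exists i0.
Qed.

Let D : 'M[K]_d := diag_mx (\row_i sg i).

Lemma minor_norm_tr k (X : 'M[K]_d) : minor_norm k X^T = minor_norm k X.
Proof.
rewrite /minor_norm exchange_big /=; apply: eq_bigr => f _; apply: eq_bigr => g _.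
by rewrite -trmx_mxsub det_tr.
Qed.

Lemma prod_top_le_minor_norm k : (k <= d)%N -> \prod_(i < k) sg i <= minor_norm k D.
Proof.
move=> kd; pose h := [ffun i : 'I_k => widen_ord kd i].
have := minor_le_norm D h h; rewrite /D -[X in mxsub _ _ X]mul1mx minor_diagr.
have -> : mxsub h h (1%:M : 'M[K]_d) = 1%:M.
  by apply/matrixP => i j; rewrite !mxE !ffunE -val_eqE /= val_eqE.
rewrite det1 mul1r => /(le_trans _); apply.
rewrite ger0_norm ?prodr_ge0 // => [|i _]; last by rewrite mxE.
by rewrite le_eqVlt; apply/orP; left; apply/eqP/eq_bigr => i _; rewrite mxE !ffunE.
Qed.

Lemma minor_norm_diag_le k :
  minor_norm k D <= (k`! * ((d ^ k) * (d ^ k)))%:R * \prod_(i < k) sg i.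
Proof.
have B (f g : {ffun 'I_k -> 'I_d}) : `|\det (mxsub f g D)| <= k`!%:R * \prod_(i < k) sg i.
  have P0 : 0 <= \prod_(i < k) sg i by apply: prodr_ge0.
  have [/injectiveP gi|gi] := boolP (injectiveb g); last first.
    by rewrite minor_ninjr // normr0 mulr_ge0.
  rewrite /D -[X in mxsub _ _ X]mul1mx minor_diagr normrM.
  apply: ler_pM => //.
    apply: le_trans (ler_norm_sum _ _ _) _.
    rewrite -card_Sn -sumr_const; apply: ler_sum => s _.
    rewrite normrM normrX normrN1 expr1n mul1r normr_prod.
    apply: prodr_ile1 => i _; rewrite !mxE normr_ge0 /=.
    by case: (_ == _); rewrite ?normr1 ?normr0.
  apply: le_trans (prod_inj_le_top gi).
  rewrite normr_prod le_eqVlt; apply/orP; left; apply/eqP/eq_bigr => i _.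
  by rewrite mxE ger0_norm.
apply: (@le_trans _ _ (\sum_(f : {ffun 'I_k -> 'I_d})
   \sum_(g : {ffun 'I_k -> 'I_d}) k`!%:R * \prod_(i < k) sg i)).
  by apply: ler_sum => f _; apply: ler_sum => g _.
by rewrite !sumr_const card_ffun !card_ord -mulrnA -[leLHS]mulr_natr [in leRHS]natrM mulrAC.
Qed.

Section Gap.
Variable k : nat.
Hypothesis kd : (k.+1 <= d)%N.

Let h0 : {ffun 'I_k.+1 -> 'I_d} := [ffun i => widen_ord kd i].
Let top := \prod_(i < k.+1) sg i.
Let snd := (\prod_(i < k) sg i) * sg k.+1.
Let nf := (d ^ k.+1)%N.
Let lead (X : 'M[K]_d) : K := \sum_(f : {ffun 'I_k.+1 -> 'I_d}) `|\det (mxsub f h0 X)|.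

Let top_ge0 : 0 <= top. Proof. exact: prodr_ge0. Qed.
Let snd_ge0 : 0 <= snd. Proof. by rewrite mulr_ge0 ?prodr_ge0. Qed.
Let snd_le_top : snd <= top.
Proof.
by rewrite /top big_ord_recr /=; apply: ler_wpM2l; rewrite ?prodr_ge0 ?sg_dec.
Qed.

(** The columns selected by [h] are those of [h0] multiplied by a matrix of
    zeros and ones. *)
Lemma minor_low_cols (X : 'M[K]_d) (f h : {ffun 'I_k.+1 -> 'I_d}) :
  (forall i, h i < k.+1)%N ->
  `|\det (mxsub f h X)| <= k.+1`!%:R * `|\det (mxsub f h0 X)|.
Proof.
move=> hk; pose P : 'M[K]_k.+1 := \matrix_(i, j) (i == h j :> nat)%:R.
have -> : mxsub f h X = mxsub f h0 X *m P.
  apply/matrixP => i j; rewrite !mxE (bigD1 (Ordinal (hk j))) //= big1 ?addr0.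
    rewrite !mxE eqxx mulr1 ffunE; congr (X _ _); exact: val_inj.
  move=> l lj; rewrite !mxE; case: eqP; rewrite ?mulr0 // => lh.
  by case/eqP: lj; apply: val_inj.
rewrite det_mulmx normrM mulrC; apply: ler_wpM2r => //.
apply: le_trans (ler_norm_sum _ _ _) _.
rewrite -card_Sn -sumr_const; apply: ler_sum => s _.
rewrite normrM normrX normrN1 expr1n mul1r normr_prod.
apply: prodr_ile1 => i _; rewrite !mxE normr_ge0 /=.
by case: (_ == _); rewrite ?normr1 ?normr0.
Qed.

(** A minor of [X *m D] is a minor of [X] times a product of diagonal values,
    and every product other than the leading one is at most [snd]. *)
Lemma minor_norm_mul_diag (X : 'M[K]_d) :
  minor_norm k.+1 (X *m D) <=
  (k.+1`! * nf)%:R * (top * lead X) + snd * minor_norm k.+1 X.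
Proof.
have -> : (k.+1`! * nf)%:R * (top * lead X) + snd * minor_norm k.+1 X =
   \sum_(f : {ffun 'I_k.+1 -> 'I_d}) \sum_(h : {ffun 'I_k.+1 -> 'I_d})
     (k.+1`!%:R * `|\det (mxsub f h0 X)| * top + `|\det (mxsub f h X)| * snd).
  rewrite /lead /minor_norm !mulr_sumr -big_split; apply: eq_bigr => f _ /=.
  rewrite big_split /= sumr_const card_ffun !card_ord -mulr_suml -[_ *+ _]mulr_natr natrM; congr (_ + _).
    by rewrite /nf; ring.
  by rewrite mulrC.
apply: ler_sum => f _; apply: ler_sum => h _.
rewrite /D minor_diagr normrM.
have -> : `|\prod_i (\row_i sg i) 0 (h i)| = \prod_i sg (h i).
  by rewrite normr_prod; apply: eq_bigr => i _; rewrite mxE ger0_norm.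
have [/injectiveP hi|hi] := boolP (injectiveb h); last first.
  by rewrite minor_ninjr // normr0 !mul0r addr0 ?mulr_ge0.
have [hk|] := boolP [forall i, h i < k.+1]%N.
  apply: (@le_trans _ _ (k.+1`!%:R * `|\det (mxsub f h0 X)| * top)).
    apply: ler_pM => //; first by apply: prodr_ge0.
    - by apply: minor_low_cols; apply/forallP.
    - exact: prod_inj_le_top.
  by rewrite lerDl mulr_ge0.
rewrite negb_forall => /existsP [i0]; rewrite -leqNgt => hi0.
apply: (@le_trans _ _ (`|\det (mxsub f h X)| * snd)).
  by apply: ler_wpM2l => //; apply: prod_inj_le_second hi0.
by rewrite lerDr !mulr_ge0.
Qed.

Lemma minor_norm_diag_mul (Z : 'M[K]_d) :
  minor_norm k.+1 (D *m Z) <=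
  (k.+1`! * nf)%:R * (top * lead Z^T) + snd * minor_norm k.+1 Z.
Proof.
rewrite -minor_norm_tr -[minor_norm _ Z]minor_norm_tr.
have -> : (D *m Z)^T = Z^T *m D by rewrite trmx_mul tr_diag_mx.
exact: minor_norm_mul_diag.
Qed.

(** Truncating [D] to its first [k.+1] values changes a minor of [X *m D *m Z] by
    products of size at most [snd], and the minors of the truncated product
    factor through the leading columns. *)
Lemma lead_mul_le (X Z : 'M[K]_d) :
  top * (lead X * lead Z^T) <=
  minor_norm k.+1 (X *m D *m Z) + snd * (minor_norm k.+1 X * minor_norm k.+1 Z).
Proof.
(* the truncation of [D] *)
pose sg0 := \row_(i < d) if (i < k.+1)%N then sg i else 0.
pose D0 : 'M[K]_d := diag_mx sg0.
have fgt : 0 < k.+1`!%:R :> K by rewrite ltr0n fact_gt0.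
have E (f g : {ffun 'I_k.+1 -> 'I_d}) :
    \det (mxsub f g (X *m D0 *m Z)) =
    \det (mxsub f h0 X) * top * \det (mxsub g h0 Z^T).
  have -> : mxsub f g (X *m D0 *m Z) =
     mxsub f h0 X *m diag_mx (\row_i sg i) *m mxsub h0 g Z.
    apply/matrixP => i j; rewrite !mxE.
    rewrite (bigID (fun l : 'I_d => (l < k.+1)%N)) /= addrC big1 ?add0r; last first.
      by move=> l /negPf lk; rewrite mul_mx_diag !mxE lk mulr0 mul0r.
    rewrite big_ord_narrow; apply: eq_bigr => l _.
    by rewrite !mul_mx_diag !mxE !ffunE /= ltn_ord.
  rewrite !det_mulmx det_diag -[\det (mxsub g h0 _)]det_tr trmx_mxsub trmxK.
  by congr (_ * _ * _); apply: eq_bigr => i _; rewrite mxE.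
have B (f g : {ffun 'I_k.+1 -> 'I_d}) :
    top * (`|\det (mxsub f h0 X)| * `|\det (mxsub g h0 Z^T)|) <=
    `|\det (mxsub f g (X *m D *m Z))| +
    snd * \sum_(h : {ffun 'I_k.+1 -> 'I_d})
      `|\det (mxsub f h X)| * `|\det (mxsub h g Z)|.
  have -> : top * (`|\det (mxsub f h0 X)| * `|\det (mxsub g h0 Z^T)|) =
     `|\det (mxsub f g (X *m D0 *m Z))|.
    by rewrite E !normrM (ger0_norm top_ge0); ring.
  set a := \det (mxsub f g (X *m D0 *m Z)); set b := \det _.
  have -> : a = b + (a - b) by ring.
  apply: le_trans (ler_normD _ _) _; rewrite lerD2l.
  apply: (@le_trans _ _ (k.+1`!%:R * `|a - b|)).
    by rewrite ler_peMl // ler1n fact_gt0.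
  rewrite -[X in X * _](gtr0_norm fgt) -normrM mulrBr /a /b !minor_mul -sumrB.
  apply: le_trans (ler_norm_sum _ _ _) _.
  rewrite mulr_sumr; apply: ler_sum => h _.
  rewrite /D /D0 !minor_diagr -![_ * _ * \det _]mulrA -mulrBr normrM [leRHS]mulrCA; apply: ler_wpM2l => //.
  rewrite -mulrBl normrM.
  have [/injectiveP hi|hi] := boolP (injectiveb h); last first.
    by rewrite (minor_ninj Z g hi) normr0 !mulr0.
  apply: ler_wpM2r => //.
  have [hk|] := boolP [forall i, h i < k.+1]%N.
    rewrite (eq_bigr (fun i => (\row_(i < d) sg i) 0 (h i))) ?subrr ?normr0 //.
    by move=> i _; rewrite !mxE (forallP hk).
  rewrite negb_forall => /existsP [i0]; rewrite -leqNgt => hi0.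
  rewrite (bigD1 i0) //= [X in X * _]mxE ltnNge hi0 /= mul0r sub0r normrN.
  rewrite normr_prod (eq_bigr (fun i => sg (h i))).
    exact: prod_inj_le_second hi0.
  by move=> j _; rewrite mxE ger0_norm.
rewrite /lead big_distrl /= mulr_sumr.
apply: (@le_trans _ _ (\sum_(f : {ffun 'I_k.+1 -> 'I_d})
  \sum_(g : {ffun 'I_k.+1 -> 'I_d}) (`|\det (mxsub f g (X *m D *m Z))| +
    snd * \sum_(h : {ffun 'I_k.+1 -> 'I_d})
      `|\det (mxsub f h X)| * `|\det (mxsub h g Z)|))).
  apply: ler_sum => f _; rewrite mulr_sumr mulr_sumr.
  by apply: ler_sum => g _; apply: B.
under eq_bigr do rewrite big_split /=.
rewrite big_split /= lerD2l.
under eq_bigr do rewrite -mulr_sumr.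
rewrite -mulr_sumr; apply: ler_wpM2l => //.
rewrite {1}/minor_norm big_distrl; apply: ler_sum => f _ /=.
rewrite exchange_big /= big_distrl; apply: ler_sum => h _ /=.
rewrite -big_distrr /=; apply: ler_wpM2l => //.
rewrite /minor_norm [leRHS](bigD1 h) //= lerDl.
by apply: sumr_ge0 => ? _; apply: sumr_ge0.
Qed.

End Gap.

Lemma lead_le_norm k (kd : (k.+1 <= d)%N) (X : 'M[K]_d) :
  \sum_(f : {ffun 'I_k.+1 -> 'I_d})
    `|\det (mxsub f [ffun i => widen_ord kd i] X)| <= minor_norm k.+1 X.
Proof.
apply: ler_sum => f _; rewrite (bigD1 [ffun i => widen_ord kd i]) //= lerDl.
exact: sumr_ge0.
Qed.

(** For a diagonal middle factor the minors of [X *m D], [D *m Z] and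
    [X *m D *m Z] are all governed by the leading [k.+1] columns, up to errors
    carrying the factor [snd]; and [top * snd] is the product of the leading
    products of sizes [k] and [k.+2]. *)
Lemma diag_gap k : (k.+1 <= d)%N -> (forall i, (d <= i)%N -> sg i = 0) ->
  forall X Z : 'M[K]_d,
  minor_norm k.+1 (X *m D) * minor_norm k.+1 (D *m Z) <=
  ((k.+1`! * (d ^ k.+1)%N + 1) ^ 2)%:R *
  (minor_norm k.+1 (X *m D *m Z) * minor_norm k.+1 D +
   minor_norm k.+1 X * minor_norm k.+1 Z * (minor_norm k D * minor_norm k.+2 D)).
Proof.
move=> kd sg_d X Z.
have := minor_norm_mul_diag kd X; have := minor_norm_diag_mul kd Z.
have := lead_mul_le kd X Z.
have := lead_le_norm kd X; have := lead_le_norm kd Z^T; rewrite minor_norm_tr.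
set b := \sum_f _; set a := \sum_f _; set top := \prod_(i < k.+1) _.
set snd := _ * sg k.+1; set NX := minor_norm _ X; set NZ := minor_norm _ Z.
set NXD := minor_norm _ (X *m D); set NDZ := minor_norm _ (D *m Z).
set NXDZ := minor_norm _ (X *m D *m Z).
set c := (k.+1`! * _)%N => bZ aX Hlead HDZ HXD.
have top0 : 0 <= top by apply: prodr_ge0.
have snd0 : 0 <= snd by rewrite mulr_ge0 ?prodr_ge0.
have st : snd <= top.
  by rewrite /top big_ord_recr /=; apply: ler_wpM2l; rewrite ?prodr_ge0 ?sg_dec.
have a0 : 0 <= a by apply: sumr_ge0.
have b0 : 0 <= b by apply: sumr_ge0.
have NX0 : 0 <= NX by apply: minor_norm_ge0.
have NZ0 : 0 <= NZ by apply: minor_norm_ge0.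
have NXDZ0 : 0 <= NXDZ by apply: minor_norm_ge0.
have c0 : 0 <= c%:R :> K by rewrite ler0n.
have topN : top <= minor_norm k.+1 D by apply: prod_top_le_minor_norm.
have tsN : top * snd <= minor_norm k D * minor_norm k.+2 D.
  have -> : top * snd = (\prod_(i < k) sg i) * \prod_(i < k.+2) sg i.
    by rewrite /snd [RHS]mulrC big_ord_recr /= -/top; ring.
  apply: ler_pM; rewrite ?prodr_ge0 //.
    by apply: prod_top_le_minor_norm; apply: ltnW.
  have [kd2|] := leqP k.+2 d; first exact: prod_top_le_minor_norm.
  rewrite ltnS => dk; rewrite big_ord_recr /= sg_d // mulr0; exact: minor_norm_ge0.
apply: (@le_trans _ _ ((c%:R * (top * a) + snd * NX) * (c%:R * (top * b) + snd * NZ))).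
  by apply: ler_pM => //; exact: minor_norm_ge0.
apply: (@le_trans _ _ (((c + 1) ^ 2)%:R * (NXDZ * top + NX * NZ * (top * snd)))); last first.
  apply: ler_wpM2l; rewrite ?ler0n //; apply: lerD; apply: ler_wpM2l => //.
  by rewrite mulr_ge0.
have e1 : top * (top * (a * b)) <= top * (NXDZ + snd * (NX * NZ)).
  by rewrite ler_wpM2l.
have e2 : top * snd * (a * NZ) <= top * snd * (NX * NZ).
  by apply: ler_wpM2l; [rewrite mulr_ge0|apply: ler_wpM2r].
have e3 : top * snd * (b * NX) <= top * snd * (NX * NZ).
  by apply: ler_wpM2l; [rewrite mulr_ge0|rewrite [NX * _]mulrC; apply: ler_wpM2r].
have e4 : snd * (snd * (NX * NZ)) <= top * (snd * (NX * NZ)).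
  apply: ler_wpM2r; last exact: st.
  by do 2?[apply: mulr_ge0 => //].
have e5 : 0 <= top * NXDZ by rewrite mulr_ge0.
have -> : (c%:R * (top * a) + snd * NX) * (c%:R * (top * b) + snd * NZ) =
  c%:R ^+ 2 * (top * (top * (a * b))) + c%:R * (top * snd * (a * NZ))
  + c%:R * (top * snd * (b * NX)) + snd * (snd * (NX * NZ)) by ring.
have -> : ((c + 1) ^ 2)%:R * (NXDZ * top + NX * NZ * (top * snd)) =
  c%:R ^+ 2 * (top * (NXDZ + snd * (NX * NZ))) + c%:R * (top * snd * (NX * NZ))
  + c%:R * (top * snd * (NX * NZ)) + (top * (snd * (NX * NZ))) +
  (c%:R * (top * NXDZ) *+ 2 + top * NXDZ) :> K.
  by rewrite natrX natrD; ring.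
apply: ler_wpDr; first by rewrite addr_ge0 // mulrn_wge0 // mulr_ge0.
by rewrite !lerD // ler_wpM2l // exprn_ge0.
Qed.

End DiagMinors.

(** * Singular values *)

Section RootMultiset.
Context {R : realType}.

Lemma mup_prod_factors (s : seq R) a :
  mup a (\prod_(l <- s) ('X - l%:P)) = count_mem a s.
Proof.
elim: s => [|l s IH]; first by rewrite big_nil mupNroot // rootE hornerC oner_eq0.
have P0 (t : seq R) : \prod_(l <- t) ('X - l%:P) != 0.
  by rewrite monic_neq0 // monic_prod_XsubC.
rewrite big_cons mupM ?P0 ?polyXsubC_eq0 // IH /=.
by rewrite -['X - _]expr1 mup_XsubCX; case: (l == a).
Qed.

(** [rootsR] lists each real root once, so repeating it according to its
    multiplicity restores the multiset of roots of a split polynomial. *)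
Lemma flatten_roots_perm (s : seq R) (h : R -> R) (p : {poly R}) :
  p = \prod_(l <- s) ('X - l%:P) ->
  perm_eq (flatten [seq nseq (mup a p) (h a) | a <- rootsR p]) (map h s).
Proof.
move=> pE.
have p0 : p != 0 by rewrite pE monic_neq0 // monic_prod_XsubC.
have -> : flatten [seq nseq (mup a p) (h a) | a <- rootsR p] =
          map h (flatten [seq nseq (mup a p) a | a <- rootsR p]).
  rewrite map_flatten -map_comp; congr flatten; apply: eq_map => a /=.
  by rewrite map_nseq.
apply: perm_map; apply/allP => /= b _; apply/eqP.
rewrite count_flatten -map_comp.
have -> : [seq (count_mem b \o (fun a => nseq (mup a p) a)) i | i <- rootsR p] =
          [seq (b == a) * mup b p | a <- rootsR p]%N.
  apply: eq_map => a /=; rewrite count_nseq /= eq_sym.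
  have [->|_] := eqVneq b a; first exact: erefl.
  exact: etrans (mul0n _) (esym (mul0n _)).
rewrite -mup_prod_factors -pE sumnE big_map -big_distrl /=.
have [bp|bp] := boolP (root p b); last by rewrite mupNroot ?muln0.
have us : uniq (rootsR p) by apply: uniq_roots.
have bin : b \in rootsR p.
  have := roots_on_rootsR p0 b; rewrite bp andbT.
  by rewrite in_itv.
have -> : (\sum_(a <- rootsR p) (b == a) = 1)%N; last by rewrite mul1n.
rewrite (bigD1_seq b) //= eqxx big1 // => a; by rewrite eq_sym => /negPf ->.
Qed.

End RootMultiset.

Section SVD.
Context {R : realType} {d : nat}.
Local Notation rc := (real_complex R).
Local Notation mc := (map_mx rc).
Local Open Scope sesquilinear_scope.

(** Spectral theorem for the Gram matrix; its eigenvalues are squared norms,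
    hence nonnegative.  The unitary matrix is taken complex because the
    spectral theorem is available over an algebraically closed field. *)
Lemma svd_gram (M : 'M[R]_d) : exists V : 'M[R[i]]_d, exists l : 'I_d -> R,
  [/\ V \is unitarymx, mc (M^T *m M) = V^t* *m diag_mx (\row_i rc (l i)) *m V
   & forall i, 0 <= l i].
Proof.
pose H := mc (M^T *m M).
have mct (N : 'M[R]_d) : (mc N)^t* = mc N^T.
  by apply/matrixP => i j; rewrite !mxE; exact: conjc_real.
have Hh : H \is hermsymmx.
  apply/is_hermitianmxP; rewrite expr0 scale1r /H mct.
  by rewrite trmx_mul trmxK.
have Hn := hermitian_normalmx Hh.
have /orthomx_spectralP HE := Hn.
pose V := spectralmx H; pose s := spectral_diag H.
have Vu : V \is unitarymx := spectral_unitarymx H.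
have sreal : s \is a realmx := hermitian_spectral_diag_real Hh.
have sE i : s 0 i = rc (complex.Re (s 0 i)).
  have /mxOverP /(_ 0 i) := sreal.
  move/CrealP => /eqP; case: (s 0 i) => a b /=.
  rewrite eq_complex /= eqxx /= => /eqP bb.
  by congr Complex; move: bb; lra.
exists V, (fun i => complex.Re (s 0 i)); split=> //.
  have <- : s = \row_i rc (complex.Re (s 0 i)) by apply/rowP => i; rewrite mxE -sE.
  rewrite -[LHS]/H HE -/V -/s (invmx_unitary Vu); exact: erefl.
move=> i.
have E : V *m H *m V^t* = diag_mx s.
  rewrite {1}HE -/V -/s invmx_unitary // !mulmxA (unitarymxP Vu) mul1mx.
  by rewrite -mulmxA (unitarymxP Vu) mulmx1.
have /matrixP /(_ i i) := E.
rewrite [in RHS]mxE eqxx mulr1n sE => E'.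
rewrite -lecR -E'.
have -> : V *m H *m V^t* = (mc M *m V^t*)^t* *m (mc M *m V^t*).
  rewrite /H map_mxM -mct.
  by rewrite trmx_mul map_mxM !trmxCK !mulmxA.
rewrite mxE; apply: sumr_ge0 => j _.
by rewrite !mxE mulrC mul_conjC_ge0.
Qed.

Lemma char_poly_gram (M : 'M[R]_d) (V : 'M[R[i]]_d) (l : 'I_d -> R) :
  V \is unitarymx -> mc (M^T *m M) = V^t* *m diag_mx (\row_i rc (l i)) *m V ->
  char_poly (M^T *m M) = \prod_(i <- [seq l i | i <- enum 'I_d]) ('X - i%:P).
Proof.
move=> Vu E.
apply: (map_inj_poly (f := rc)); [exact: complexI|by []|].
rewrite map_char_poly E rmorph_prod /= big_map big_enum /=.
have VV : V^t* *m V = 1%:M by rewrite -[X in _ *m X]trmxCK; apply/unitarymxP; rewrite trmxC_unitary.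
set D := diag_mx _.
have -> : char_poly (V^t* *m D *m V) = char_poly D.
  rewrite /char_poly.
  have -> : char_poly_mx (V^t* *m D *m V) =
     map_mx polyC (V^t*) *m char_poly_mx D *m map_mx polyC V.
    rewrite /char_poly_mx mulmxBr mulmxBl -!map_mxM; congr (_ - _).
    by rewrite mul_mx_scalar -scalemxAl -map_mxM VV map_mx1 scalemx1.
  by rewrite !det_mulmx mulrAC -det_mulmx -map_mxM VV map_mx1 det1 mul1r.
rewrite char_poly_trig; last by apply/is_trig_mxP => i j ij; rewrite mxE -val_eqE (ltn_eqF ij).
by apply: eq_bigr => i _; rewrite !mxE eqxx mulr1n rmorphB /= map_polyX map_polyC.
Qed.

Lemma singular_values_perm (M : 'M[R]_d) (V : 'M[R[i]]_d) (l : 'I_d -> R) :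
  V \is unitarymx -> mc (M^T *m M) = V^t* *m diag_mx (\row_i rc (l i)) *m V ->
  perm_eq (singular_values M) [seq Num.sqrt (l i) | i <- enum 'I_d].
Proof.
move=> Vu E; rewrite /singular_values perm_sort.
have -> : [seq Num.sqrt (l i) | i <- enum 'I_d] =
  map Num.sqrt [seq l i | i <- enum 'I_d]. by rewrite -[RHS]map_comp.
exact: flatten_roots_perm (char_poly_gram Vu E).
Qed.

Definition sv (M : 'M[R]_d) (i : nat) : R := (singular_values M)`_i.

Lemma size_singular_values (M : 'M[R]_d) : size (singular_values M) = d.
Proof.
have [V [l [Vu E _]]] := svd_gram M.
by rewrite (perm_size (singular_values_perm Vu E)) size_map size_enum_ord.
Qed.

Lemma sv_gt_dim (M : 'M[R]_d) i : (d <= i)%N -> sv M i = 0.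
Proof. by move=> di; rewrite /sv nth_default // size_singular_values. Qed.

Lemma sv_ge0 (M : 'M[R]_d) i : 0 <= sv M i.
Proof.
have [di|id] := leqP d i; first by rewrite sv_gt_dim.
have [V [l [Vu E _]]] := svd_gram M.
have /(mem_nth 0) : (i < size (singular_values M))%N by rewrite size_singular_values.
by rewrite (perm_mem (singular_values_perm Vu E)) => /mapP [j _]; rewrite /sv => ->; exact: sqrtr_ge0.
Qed.

Lemma sv_dec (M : 'M[R]_d) i j : (i <= j)%N -> sv M j <= sv M i.
Proof.
move=> ij; have [dj|jd] := leqP d j; first by rewrite (sv_gt_dim M dj) sv_ge0.
have S : sorted >=%R (singular_values M).
  by apply: sort_sorted => x y; rewrite orbC; exact: real_leVge (num_real _) (num_real _).
apply: (sorted_leq_nth _ _ 0 S) => //.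
- by move=> y x z xy yz; exact: le_trans yz xy.
- by move=> x; exact: lexx.
- by rewrite inE size_singular_values (leq_ltn_trans ij).
- by rewrite inE size_singular_values.
Qed.

(** Permuting the eigenvectors puts the eigenvalues in the order of
    [singular_values]. *)
Lemma svd_gram_sorted (M : 'M[R]_d) : exists2 V : 'M[R[i]]_d, V \is unitarymx &
  V *m mc (M^T *m M) *m V^t* = diag_mx (\row_i (rc (sv M i)) ^+ 2).
Proof.
have [V [l [Vu E l0]]] := svd_gram M.
have /tuple_permP [p Ep] : perm_eq (singular_values M) [tuple Num.sqrt (l i) | i < d].
  exact: singular_values_perm Vu E.
have svE i : sv M (nat_of_ord i) = Num.sqrt (l (p i)).
  rewrite /sv Ep -(tnth_nth 0 [tuple tnth [tuple Num.sqrt (l i) | i < d] (p i0) | i0 < d] i).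
  by rewrite !tnth_mktuple.
exists (row_perm p V).
  rewrite row_permE; apply: mul_unitarymx; last exact: Vu.
  apply/unitarymxP; rewrite tr_perm_mx map_perm_mx -perm_mxM mulgV.
  exact: perm_mx1.
rewrite E row_permE !trmx_mul map_mxM tr_perm_mx map_perm_mx !mulmxA.
rewrite -(mulmxA _ V) (unitarymxP Vu) mulmx1 -(mulmxA _ V) (unitarymxP Vu) mulmx1.
rewrite -mulmxA -[p in perm_mx p *m _]invgK -[_ *m perm_mx _]col_permE invgK -row_permE.
apply/matrixP => i j; rewrite !mxE (inj_eq perm_inj).
by case: eqP => // ->; rewrite !mulr1n svE -rmorphXn /= sqr_sqrtr.
Qed.

Lemma unitary_entry_le1 (V : 'M[R[i]]_d) i j : V \is unitarymx -> `|V i j| <= 1.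
Proof.
move=> /unitarymxP /matrixP /(_ i i); rewrite !mxE eqxx => E.
rewrite -(@ler_pXn2r _ 2) ?nnegrE // expr1n -[leRHS]/(true%:R : R[i]) -E.
rewrite (bigD1 j) //= !mxE -normCK lerDl; apply: sumr_ge0 => k _.
by rewrite !mxE mul_conjC_ge0.
Qed.

(** A singular value decomposition in both directions.  The factors need not be
    unitary: bounded entries suffice for estimates up to constants, and this
    avoids completing the left singular vectors when [M] is singular. *)
Lemma svd_factor (M : 'M[R]_d) : exists U V U' V' : 'M[R[i]]_d,
  [/\ (forall i j, `|U i j| <= 1) /\ (forall i j, `|V i j| <= 1),
      (forall i j, `|U' i j| <= 1) /\ (forall i j, `|V' i j| <= 1),
      mc M = U *m diag_mx (\row_i rc (sv M i)) *m V &
      diag_mx (\row_i rc (sv M i)) = U' *m mc M *m V'].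
Proof.
have [V Vu E] := svd_gram_sorted M.
pose W := mc M *m V^t*.
have VV : V^t* *m V = 1%:M.
  by rewrite -[X in _ *m X]trmxCK; apply/unitarymxP; rewrite trmxC_unitary.
have WW : W^t* *m W = diag_mx (\row_i (rc (sv M i)) ^+ 2).
  have hh : mc (M^T *m M) = (mc M)^t* *m mc M.
    rewrite map_mxM; congr (_ *m _).
    by apply/matrixP => i j; rewrite !mxE; exact/esym/conjc_real.
  by rewrite -E hh /W trmx_mul map_mxM trmxCK !mulmxA.
have Wsq i : \sum_j `|W j i| ^+ 2 = rc (sv M i) ^+ 2.
  have /matrixP /(_ i i) := WW; rewrite !mxE eqxx mulr1n => <-.
  by apply: eq_bigr => j _; rewrite !mxE normCK mulrC.
have svC0 i : 0 <= rc (sv M i) by rewrite -[0]/(rc 0) lecR sv_ge0.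
have Wle i j : `|W j i| <= rc (sv M i).
  rewrite -(@ler_pXn2r _ 2) ?nnegrE // -Wsq (bigD1 j) //= lerDl.
  by apply: sumr_ge0 => k _; rewrite exprn_ge0.
(* a column of a vanishing singular value is 0, as the inverse of 0 is 0 *)
pose U : 'M[R[i]]_d := \matrix_(j, i) (W j i / rc (sv M (nat_of_ord i))).
have U1 i j : `|U i j| <= 1.
  rewrite mxE normrM normfV (ger0_norm (svC0 _)).
  have [->|s0] := eqVneq (sv M j) 0; first by rewrite invr0 mulr0.
  rewrite ler_pdivrMr ?mul1r; first exact: (Wle j i).
  by rewrite lt_def svC0 andbT; apply: contra s0 => /eqP /complexI ->.
exists U, V, (U^t*), (V^t*); split.
- by split=> // i j; apply: unitary_entry_le1.
- split=> i j; first by rewrite mxE mxE norm_conjC; exact: U1.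
  by rewrite mxE mxE norm_conjC; apply: unitary_entry_le1.
- have -> : U *m diag_mx (\row_i rc (sv M i)) = W.
    rewrite mul_mx_diag; apply/matrixP => i j; rewrite !mxE.
    have [s0|s0] := eqVneq (sv M j) 0; last first.
      by rewrite mulfVK //; apply: contra s0 => /eqP /complexI ->.
    have := Wle j i; rewrite s0 mulr0 normr_le0 => /eqP; by rewrite mxE => ->.
  by rewrite /W -mulmxA VV mulmx1.
- rewrite -mulmxA -/W.
  have -> : U^t* = diag_mx (\row_i (rc (sv M i))^-1) *m W^t*.
    rewrite mul_diag_mx; apply/matrixP => i j; rewrite !mxE rmorphM fmorphV /=.
    rewrite mulrC; congr (_^-1 * _); exact: conjc_real.
  rewrite -mulmxA WW mulmx_diag; congr diag_mx; apply/rowP => i; rewrite !mxE.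
  have [->|s0] := eqVneq (sv M i) 0; first by rewrite expr0n /= mulr0.
  rewrite expr2 mulKf //; apply: contra s0 => /eqP /complexI ->; by [].
Qed.

Lemma minor_norm_real k (M : 'M[R]_d) : minor_norm k (mc M) = rc (minor_norm k M).
Proof.
rewrite /minor_norm rmorph_sum; apply: eq_bigr => f _.
rewrite rmorph_sum; apply: eq_bigr => g _.
rewrite -map_mxsub det_map_mx normc_def /= expr0n addr0 sqrtr_sqr //.
Qed.

End SVD.

(** * Minors against singular values, and the gap inequality *)

Lemma gap_scalar (K : numFieldType)
   (b c b1 b2 nXY nYZ nXUD nDVZ nXU nVZ nX nZ nXYZ nY nD n1D n2D n1Y n2Y : K) :
  1 <= b -> 1 <= b1 -> 1 <= b2 -> 1 <= c ->
  0 <= nXY -> 0 <= nYZ -> 0 <= nXU -> 0 <= nVZ -> 0 <= nD -> 0 <= n1D ->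
  0 <= n2D -> 0 <= nXYZ -> 0 <= nY ->
  nXY <= b * nXUD -> nYZ <= b * nDVZ -> nXU <= b * nX -> nVZ <= b * nZ ->
  nD <= b ^+ 2 * nY -> n1D <= b1 ^+ 2 * n1Y -> n2D <= b2 ^+ 2 * n2Y ->
  nXUD * nDVZ <= c * (nXYZ * nD + nXU * nVZ * (n1D * n2D)) ->
  nXY * nYZ <=
  b ^+ 2 * c * (b ^+ 2 * b1 ^+ 2 * b2 ^+ 2) * (nXYZ * nY + nX * nZ * (n1Y * n2Y)).
Proof.
move=> hb hb1 hb2 hc h1 h2 h3 h4 h5 h6 h7 h8 h9 e1 e2 e3 e4 e5 e6 e7 H.
have b0 : 0 <= b by apply: le_trans hb.
have c0 : 0 <= c by apply: le_trans hc.
apply: le_trans (ler_pM h1 h2 e1 e2) _.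
have -> : b * nXUD * (b * nDVZ) = b ^+ 2 * (nXUD * nDVZ) by ring.
have -> : b ^+ 2 * c * (b ^+ 2 * b1 ^+ 2 * b2 ^+ 2) * (nXYZ * nY + nX * nZ * (n1Y * n2Y)) =
  b ^+ 2 * (c * ((b1 ^+ 2 * b2 ^+ 2) * (nXYZ * (b ^+ 2 * nY)) +
  (b * nX) * (b * nZ) * ((b1 ^+ 2 * n1Y) * (b2 ^+ 2 * n2Y)))) by ring.
apply: ler_wpM2l; first exact: exprn_ge0.
apply: le_trans H _; apply: ler_wpM2l => //.
apply: lerD.
  apply: (@le_trans _ _ (nXYZ * (b ^+ 2 * nY))); first exact: ler_wpM2l.
  rewrite ler_peMl ?mulr_ge0 ?exprn_ge0 //.
  by rewrite mulr_ege1 // exprn_ege1.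
apply: ler_pM; rewrite ?mulr_ge0 //; exact: ler_pM.
Qed.

Section SingularValueEstimates.
Context {R : realType} {d : nat}.
Implicit Types M X Y Z : 'M[R]_d.
Local Notation rc := (real_complex R).
Local Notation mc := (map_mx rc).

Definition prod_sv M k : R := \prod_(i < k) sv M i.

Lemma prod_sv_ge0 M k : 0 <= prod_sv M k.
Proof. by apply: prodr_ge0 => i _; apply: sv_ge0. Qed.

(** Bounds [minor_norm k] of a matrix whose entries have modulus at most 1. *)
Definition minor_bound k : R := (k`! * (d ^ k * d ^ k))%:R.

Lemma rc_ge0 (x : R) : 0 <= x -> 0 <= rc x.
Proof. by rewrite -lecR. Qed.

Let svc M (i : nat) : R[i] := rc (sv M i).
Let svc_ge0 M i : 0 <= svc M i. Proof. by rewrite rc_ge0 // sv_ge0. Qed.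
Let svc_dec M i j : (i <= j)%N -> svc M j <= svc M i.
Proof. by move=> ij; rewrite lecR sv_dec. Qed.

Lemma minor_norm_three k (K : numFieldType) (U V : 'M[K]_d) (X : 'M[K]_d) :
  (forall i j, `|U i j| <= 1) -> (forall i j, `|V i j| <= 1) ->
  minor_norm k (U *m X *m V) <=
  ((k`! * (d ^ k * d ^ k)) ^ 2)%:R * minor_norm k X.
Proof.
move=> U1 V1; apply: le_trans (minor_normM _ _ _) _.
have Ub := minor_norm_bound k U1; have Vb := minor_norm_bound k V1.
rewrite natrX expr2 mulrAC; apply: ler_pM => //; rewrite ?minor_norm_ge0 //.
apply: le_trans (minor_normM _ _ _) _.
by apply: ler_wpM2r => //; apply: minor_norm_ge0.
Qed.

(** The bounded factors of the singular value decomposition cost a constant,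
    and the diagonal factor has its minors dominated by the leading one. *)
Lemma minor_norm_le_prod_sv k M :
  minor_norm k M <= minor_bound k ^+ 3 * prod_sv M k.
Proof.
have [U [V [U' [V' [[U1 V1] _ E _]]]]] := svd_factor M.
rewrite -lecR -minor_norm_real E.
apply: le_trans (minor_norm_three _ _ U1 V1) _.
have H := @minor_norm_diag_le _ d _ (svc_ge0 M) (@svc_dec M) k.
rewrite [leRHS](rmorphM rc) (rmorphXn rc) /= /minor_bound [rc _%:R](rmorph_nat rc).
rewrite natrX [_ ^+ 3]exprSr -mulrA; apply: ler_wpM2l; first by rewrite exprn_ge0 // ler0n.
by apply: le_trans H _; rewrite /prod_sv (rmorph_prod rc).
Qed.

Lemma prod_sv_le_minor_norm k M : (k <= d)%N ->
  prod_sv M k <= minor_bound k ^+ 2 * minor_norm k M.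
Proof.
move=> kd; have [U [V [U' [V' [_ [U1 V1] _ E]]]]] := svd_factor M.
rewrite -lecR (rmorphM rc) (rmorphXn rc) /= /minor_bound [rc _%:R](rmorph_nat rc) -minor_norm_real -natrX.
apply: le_trans (minor_norm_three _ _ U1 V1); rewrite -E.
have := prod_top_le_minor_norm (svc_ge0 M) kd.
by rewrite /prod_sv (rmorph_prod rc).
Qed.

Lemma minor_bound_spec : exists be : nat -> R,
  forall j, [/\ (0 < d)%N -> 1 <= be j,
   (forall U : 'M[R[i]]_d, (forall i j, `|U i j| <= 1) -> minor_norm j U <= rc (be j)) &
   (forall (U V X : 'M[R[i]]_d),
     (forall i j, `|U i j| <= 1) -> (forall i j, `|V i j| <= 1) ->
     minor_norm j (U *m X *m V) <= rc (be j) ^+ 2 * minor_norm j X)].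
Proof.
exists minor_bound => j; split.
- by move=> d0; rewrite ler1n !muln_gt0 fact_gt0 !expn_gt0 d0.
- by move=> U U1; rewrite /minor_bound [rc _](rmorph_nat rc); apply: minor_norm_bound.
- move=> U V X U1 V1; rewrite /minor_bound [rc _](rmorph_nat rc) -natrX.
  exact: minor_norm_three.
Qed.

(** Write the middle matrix as [U *m D *m V] with [D] diagonal and apply
    [diag_gap] to [X *m U] and [V *m Z].  When the [k.+2]-nd singular value of [Y]
    is much smaller than the [k.+1]-st the second term is negligible, and the
    norm of size [k.+1] is almost multiplicative across [Y]. *)
Lemma minor_norm_gap k : (k < d)%N -> exists2 C : R, 1 <= C &
  forall X Y Z : 'M[R]_d,
  minor_norm k.+1 (X *m Y) * minor_norm k.+1 (Y *m Z) <=
  C * (minor_norm k.+1 (X *m Y *m Z) * minor_norm k.+1 Y +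
       minor_norm k.+1 X * minor_norm k.+1 Z *
       (minor_norm k Y * minor_norm k.+2 Y)).
Proof.
move=> kd; have d0 : (0 < d)%N by apply: leq_ltn_trans kd.
pose Dg Y : 'M[R[i]]_d := diag_mx (\row_i rc (sv Y i)).
have [be Hbe] := minor_bound_spec.
have be1 j : 1 <= be j by have [/(_ d0)] := Hbe j.
have be0 j : 0 <= be j by apply: le_trans (be1 j).
have [ga ga1 Hga] : exists2 ga : R, 1 <= ga & forall Y U V X Z,
  minor_norm k.+1 (mc X *m U *m Dg Y) * minor_norm k.+1 (Dg Y *m (V *m mc Z)) <=
  rc ga * (minor_norm k.+1 (mc X *m U *m Dg Y *m (V *m mc Z)) * minor_norm k.+1 (Dg Y) +
     minor_norm k.+1 (mc X *m U) * minor_norm k.+1 (V *m mc Z) *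
     (minor_norm k (Dg Y) * minor_norm k.+2 (Dg Y))).
  exists (((k.+1`! * d ^ k.+1 + 1) ^ 2)%:R) => [|Y U V X Z].
    by rewrite ler1n expn_gt0 addn1.
  have svd0 i : (d <= i)%N -> svc Y i = 0 by move=> di; rewrite /svc sv_gt_dim.
  rewrite [rc _%:R](rmorph_nat rc).
  have HH := diag_gap (svc_ge0 Y) (@svc_dec Y) kd svd0 (mc X *m U) (V *m mc Z).
  exact: HH.
exists (be k.+1 ^+ 2 * ga * (be k.+1 ^+ 2 * be k ^+ 2 * be k.+2 ^+ 2)) => [|X Y Z].
  have sq j : 1 <= be j ^+ 2 by apply: exprn_ege1.
  by rewrite !mulr_ege1 ?sq.
have [U [V [U' [V' [[U1 V1] [U1' V1'] E E']]]]] := svd_factor Y.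
rewrite -/(Dg Y) in E E'.
have b0 j : 0 <= rc (be j) by apply: rc_ge0.
have b1 j : 1 <= rc (be j) by rewrite -[1]/(rc 1) lecR.
have N0 j (T : 'M[R[i]]_d) : 0 <= minor_norm j T by apply: minor_norm_ge0.
have Ub j (T : 'M[R[i]]_d) : (forall i l, `|T i l| <= 1) -> minor_norm j T <= rc (be j).
  by move=> T1; have [_ HU _] := Hbe j; exact: HU.
have e5 j : minor_norm j (Dg Y) <= rc (be j) ^+ 2 * minor_norm j (mc Y).
  by rewrite E'; have [_ _ HU] := Hbe j; exact: HU.
have RM b c e1 e2 u v x y z w :
  rc (b ^+ 2 * c * (b ^+ 2 * e1 ^+ 2 * e2 ^+ 2) * (u * v + x * y * (z * w))) =
  rc b ^+ 2 * rc c * (rc b ^+ 2 * rc e1 ^+ 2 * rc e2 ^+ 2) *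
    (rc u * rc v + rc x * rc y * (rc z * rc w)).
  by rewrite -!(rmorphXn rc) -!(rmorphM rc) -(rmorphD rc) -(rmorphM rc).
have RM2 x y : rc (x * y) = rc x * rc y by apply: (rmorphM rc).
have mcM (S T : 'M[R]_d) : mc (S *m T) = mc S *m mc T by apply: (map_mxM rc).
rewrite -lecR RM RM2 -!minor_norm_real !mcM.
refine (@gap_scalar _ (rc (be k.+1)) (rc ga) (rc (be k)) (rc (be k.+2)) _ _
  (minor_norm k.+1 (mc X *m U *m Dg Y)) (minor_norm k.+1 (Dg Y *m (V *m mc Z)))
  (minor_norm k.+1 (mc X *m U)) (minor_norm k.+1 (V *m mc Z))
  _ _ _ _ (minor_norm k.+1 (Dg Y)) (minor_norm k (Dg Y)) (minor_norm k.+2 (Dg Y)) _ _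
  (b1 _) (b1 _) (b1 _) _ (N0 _ _) (N0 _ _) (N0 _ _) (N0 _ _) (N0 _ _) (N0 _ _)
  (N0 _ _) (N0 _ _) (N0 _ _) _ _ _ _ (e5 _) (e5 _) (e5 _) _).
- by rewrite -[1]/(rc 1) lecR.
- rewrite E !mulmxA; apply: le_trans (minor_normM _ _ _) _.
  by rewrite mulrC; apply: ler_wpM2r; [exact: N0|exact: Ub].
- rewrite E -!mulmxA; apply: le_trans (minor_normM _ _ _) _.
  by apply: ler_wpM2r; [exact: N0|exact: Ub].
- apply: le_trans (minor_normM _ _ _) _.
  by rewrite mulrC; apply: ler_wpM2r; [exact: N0|exact: Ub].
- apply: le_trans (minor_normM _ _ _) _.
  by apply: ler_wpM2r; [exact: N0|exact: Ub].
- have -> : mc X *m mc Y *m mc Z = mc X *m U *m Dg Y *m (V *m mc Z).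
    by rewrite E !mulmxA.
  exact: Hga.
Qed.

End SingularValueEstimates.

(** * The singular value function *)

Section PowR.
Context {R : realType}.
Implicit Types x y a b : R.

Lemma powRDge0 x a b : 0 <= a -> 0 <= b -> x `^ (a + b) = x `^ a * x `^ b.
Proof.
move=> a0 b0; have [ab|ab] := eqVneq (a + b) 0; last first.
  by rewrite powRD // (negPf ab).
have -> : a = 0 by lra.
by have -> : b = 0; [lra|rewrite addr0 !powRr0 mulr1].
Qed.

Lemma ler_powRl a x y : 0 <= a -> 0 <= x -> x <= y -> x `^ a <= y `^ a.
Proof. by move=> a0 x0 xy; apply: ge0_ler_powR; rewrite ?nnegrE // (le_trans x0). Qed.

End PowR.

Section PhiEstimates.
Context {R : realType} {d : nat}.
Hypothesis d0 : (0 < d)%N.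
Implicit Types (M X Y Z : 'M[R]_d) (s t : R).

Lemma minor_bound_ge1 k : 1 <= @minor_bound R d k.
Proof. by rewrite ler1n !muln_gt0 fact_gt0 !expn_gt0 d0. Qed.

(** One constant for the comparisons in all sizes [k <= d] at once. *)
Definition sv_const : R :=
  1 + \sum_(k < d.+1) (@minor_bound R d k ^+ 3 + @minor_bound R d k ^+ 2).

Lemma sv_const_ge1 : 1 <= sv_const.
Proof.
rewrite lerDl; apply: sumr_ge0 => k _.
have := minor_bound_ge1 k => b1.
by rewrite addr_ge0 // exprn_ge0 // (le_trans _ b1).
Qed.

Let bound_le_const k : (k <= d)%N ->
  @minor_bound R d k ^+ 3 <= sv_const /\ @minor_bound R d k ^+ 2 <= sv_const.
Proof.
move=> kd; have b0 j : 0 <= @minor_bound R d j by rewrite ler0n.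
rewrite /sv_const (bigD1 (Ordinal (kd : (k < d.+1)%N))) //=.
set s := \sum_(i < _ | _) _.
have s0 : 0 <= s by apply: sumr_ge0 => j _; rewrite addr_ge0 // exprn_ge0.
have := exprn_ge0 3 (b0 k); have := exprn_ge0 2 (b0 k).
by split; lra.
Qed.

Lemma minor_norm_le_sv k M : minor_norm k M <= sv_const * prod_sv M k.
Proof.
have [kd|dk] := leqP k d.
  apply: le_trans (minor_norm_le_prod_sv _ _) _.
  by apply: ler_wpM2r; [exact: prod_sv_ge0|exact: (bound_le_const kd).1].
rewrite minor_norm_gt_dim // mulr_ge0 ?prod_sv_ge0 //.
exact: le_trans sv_const_ge1.
Qed.

Lemma sv_le_minor_norm k M : prod_sv M k <= sv_const * minor_norm k M.
Proof.
have [kd|dk] := leqP k d.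
  apply: le_trans (prod_sv_le_minor_norm _ kd) _.
  by apply: ler_wpM2r; [exact: minor_norm_ge0|exact: (bound_le_const kd).2].
have -> : prod_sv M k = 0.
  by rewrite /prod_sv (bigD1 (Ordinal dk)) //= sv_gt_dim // mul0r.
by rewrite mulr_ge0 ?minor_norm_ge0 // (le_trans _ sv_const_ge1).
Qed.

Lemma prod_svS M k : prod_sv M k.+1 = prod_sv M k * sv M k.
Proof. by rewrite /prod_sv big_ord_recr. Qed.

Lemma prod_sv0 M : prod_sv M 0 = 1.
Proof. by rewrite /prod_sv big_ord0. Qed.

Lemma prod_sv_le k M : prod_sv M k <= sv M 0 ^+ k.
Proof.
elim: k => [|k IH]; first by rewrite prod_sv0.
rewrite prod_svS exprSr; apply: ler_pM; rewrite ?prod_sv_ge0 ?sv_ge0 //.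
exact: sv_dec.
Qed.

Lemma sv0_le_norm M : sv M 0 <= sv_const * minor_norm 1 M.
Proof. by have := sv_le_minor_norm 1 M; rewrite prod_svS prod_sv0 mul1r. Qed.

Lemma det_le_minor_norm M : `|\det M| <= minor_norm d M.
Proof.
have := @minor_le_norm R d d M [ffun i => i] [ffun i => i].
by have -> : mxsub [ffun i => i] [ffun i => i] M = M
  by apply/matrixP => i j; rewrite !mxE !ffunE.
Qed.

Lemma minor_norm_le_det M :
  minor_norm d M <= (d`! * (d ^ d * (d ^ d)) * d`!)%:R * `|\det M|.
Proof.
have B (f : {ffun 'I_d -> 'I_d}) (N := rowsub f (1%:M : 'M[R]_d)) : `|\det N| <= d`!%:R.
  apply: le_trans (ler_norm_sum _ _ _) _.
  rewrite -card_Sn -sumr_const; apply: ler_sum => s _.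
  rewrite normrM normrX normrN1 expr1n mul1r normr_prod.
  apply: prodr_ile1 => i _; rewrite !mxE normr_ge0 /=.
  by case: (_ == _); rewrite ?normr1 ?normr0.
have E (f g : {ffun 'I_d -> 'I_d}) :
   `|\det (mxsub f g M)| <= d`!%:R * `|\det M| * d`!%:R.
  have -> : mxsub f g M = rowsub f 1%:M *m M *m (rowsub g 1%:M)^T.
    have -> : rowsub f 1%:M *m M = rowsub f M by rewrite mul_rowsub_mx mul1mx.
    apply: trmx_inj; rewrite trmx_mul trmxK mul_rowsub_mx mul1mx.
    by apply/matrixP => i j; rewrite !mxE.
  rewrite !det_mulmx det_tr !normrM; apply: ler_pM; rewrite ?mulr_ge0 //.
  by apply: ler_wpM2r.
apply: (@le_trans _ _ (\sum_(f : {ffun 'I_d -> 'I_d})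
   \sum_(g : {ffun 'I_d -> 'I_d}) (d`!%:R * `|\det M| * d`!%:R))).
  by apply: ler_sum => f _; apply: ler_sum => g _.
rewrite !sumr_const card_ffun !card_ord -mulrnA -[leLHS]mulr_natr.
rewrite natrM [X in _ <= X * _]natrM le_eqVlt; apply/orP; left; apply/eqP; ring.
Qed.

Lemma phi_ge0 s M : 0 <= phi s M.
Proof.
rewrite /phi; case: ifP => _; last exact: powR_ge0.
rewrite mulr_ge0 ?powR_ge0 //; apply: prodr_ge0 => i _; exact: sv_ge0.
Qed.

(** The definition of [phi] uses [Num.truncn], which jumps at integers; the
    formula of a unit segment also holds at its right end point. *)
Lemma phi_segment m s M : (m < d)%N -> m%:R <= s -> s <= m.+1%:R ->
  phi s M = prod_sv M m * sv M m `^ (s - m%:R).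
Proof.
move=> md ms sm; rewrite /phi.
have -> : s <= d%:R by apply: le_trans sm _; rewrite ler_nat.
have [sE|sne] := eqVneq s m.+1%:R; last first.
  have -> // : Num.truncn s = m.
  by apply: truncn_def; rewrite ms lt_neqAle sne.
rewrite sE natrK subrr powRr0 mulr1.
by rewrite -natrB // subSnn powRr1 ?sv_ge0 // -prod_svS.
Qed.

Lemma segment_exists s : 0 <= s -> s <= d%:R ->
  exists m, [/\ (m < d)%N, m%:R <= s & s <= m.+1%:R].
Proof.
move=> s0 sd; have /andP [ts st] := truncn_itv s0.
have [td|dt] := ltnP (Num.truncn s) d.
  by exists (Num.truncn s); split => //; apply: ltW.
exists d.-1; rewrite prednK // leqnn; split => //.
apply: le_trans ts; rewrite ler_nat; exact: leq_trans (leq_pred _) dt.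
Qed.

Lemma phi_nat k M : (k <= d)%N -> phi k%:R M = prod_sv M k.
Proof.
case: k => [|k] kd; first by rewrite (phi_segment (m := 0)) // subrr powRr0 mulr1.
rewrite (phi_segment (m := k)) ?ler_nat // -natrB // subSnn powRr1 ?sv_ge0 //.
by rewrite prod_svS.
Qed.

Lemma phi_interp m s M : (m < d)%N -> m%:R <= s -> s <= m.+1%:R ->
  phi s M = prod_sv M m `^ (m.+1%:R - s) * prod_sv M m.+1 `^ (s - m%:R).
Proof.
move=> md ms sm; rewrite (phi_segment _ md) // prod_svS powRM ?prod_sv_ge0 ?sv_ge0 //.
rewrite mulrA -powRDge0 ?subr_ge0 //.
have -> : m.+1%:R - s + (s - m%:R) = 1 by rewrite -natr1; ring.
by rewrite powRr1 // prod_sv_ge0.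
Qed.

Lemma phi_gt_dim s M : d%:R < s -> phi s M = `|\det M| `^ (s / d%:R).
Proof. by move=> ds; rewrite /phi leNgt ds. Qed.

(** Reduces an estimate between two exponents to pairs of exponents in one unit
    segment, where [phi_segment] gives a single formula. *)
Lemma segment_chain (Q : R -> R -> Prop) :
  (forall s t u, 0 <= s -> s <= t -> t <= u -> Q s t -> Q t u -> Q s u) ->
  (forall m s t, (m < d)%N -> m%:R <= s -> s <= t -> t <= m.+1%:R -> Q s t) ->
  forall s t, 0 <= s -> s <= t -> t <= d%:R -> Q s t.
Proof.
move=> Qtr Qseg s t s0 st td.
have H n : (n <= d)%N -> forall s t, 0 <= s -> s <= t -> t <= n%:R -> (0 < n)%N -> Q s t.
  elim: n => // n IH nd {s0 st td}s {}t s0 st tn _.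
  case: n => [|n] in IH nd tn *; first exact: (Qseg 0).
  have [tn'|tn'] := leP t n.+1%:R; first by apply: IH => //; apply: ltnW.
  have [sn|sn] := leP n.+1%:R s; first exact: (Qseg n.+1).
  apply: (Qtr s n.+1%:R t) => //; try exact: ltW.
    by apply: IH => //; [apply: ltnW|apply: ltW].
  by apply: (Qseg n.+1) => //; apply: ltW.
exact: (H d).
Qed.

Lemma phi_mono_sv s t M : 0 <= s -> s <= t -> t <= d%:R ->
  phi t M <= phi s M * sv M 0 `^ (t - s).
Proof.
move: s t; apply: (segment_chain (Q := fun s t => phi t M <= phi s M * sv M 0 `^ (t - s))).
  move=> s t u s0 st tu st' tu'; apply: le_trans tu' _.
  have -> : u - s = (t - s) + (u - t) by ring.
  rewrite (@powRDge0 _ _ (t - s) (u - t)) ?subr_ge0 // mulrA; apply: ler_wpM2r => //; exact: powR_ge0.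
move=> m s t md ms st tm; rewrite !(phi_segment _ md) //; [|exact: le_trans tm|exact: le_trans st].
have -> : t - m%:R = (s - m%:R) + (t - s) by ring.
rewrite (@powRDge0 _ _ (s - m%:R) (t - s)) ?subr_ge0 // mulrA; apply: ler_wpM2l.
  by rewrite mulr_ge0 ?prod_sv_ge0 ?powR_ge0.
by apply: ler_powRl; rewrite ?subr_ge0 ?sv_ge0 ?sv_dec.
Qed.

Lemma phi_lower_sv s t M : 0 <= s -> s <= t -> t <= d%:R ->
  phi s M * sv M d.-1 `^ (t - s) <= phi t M.
Proof.
move: s t; apply: (segment_chain (Q := fun s t => phi s M * sv M d.-1 `^ (t - s) <= phi t M)).
  move=> s t u s0 st tu st' tu'; apply: le_trans tu'.
  have -> : u - s = (t - s) + (u - t) by ring.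
  rewrite (@powRDge0 _ _ (t - s) (u - t)) ?subr_ge0 // mulrA; apply: ler_wpM2r => //; exact: powR_ge0.
move=> m s t md ms st tm; rewrite !(phi_segment _ md) //; [|exact: le_trans st|exact: le_trans tm].
have -> : t - m%:R = (s - m%:R) + (t - s) by ring.
rewrite (@powRDge0 _ _ (s - m%:R) (t - s)) ?subr_ge0 // mulrA; apply: ler_wpM2l.
  by rewrite mulr_ge0 ?prod_sv_ge0 ?powR_ge0.
by apply: ler_powRl; rewrite ?subr_ge0 ?sv_ge0 // sv_dec // -ltnS prednK.
Qed.

End PhiEstimates.

(** * Continuity and interpolation of the singular value function *)

Section PowRMore.
Context {R : realType}.
Implicit Types x y a b e : R.

Lemma powR_usc x a e : 0 <= x -> 0 <= a -> 0 < e ->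
  exists2 h, 0 < h & (x + h) `^ a <= x `^ a + e.
Proof.
move=> x0 a0 e0.
have [->|an0] := eqVneq a 0; first by exists 1 => //; rewrite !powRr0 lerDl ltW.
have agt : 0 < a by rewrite lt_def an0.
have [->|xn0] := eqVneq x 0.
  exists (e `^ a^-1); first exact: powR_gt0.
  by rewrite add0r powR0 // add0r -powRrM mulVf // powRr1 // ltW.
have xgt : 0 < x by rewrite lt_def xn0.
have cx : {for x, continuous (fun z => z `^ a)}.
  by apply/differentiable_continuous/derivable1_diffP/derivable_powR; rewrite in_itv /= xgt.
have /cvgrPdist_lt /(_ e e0) [h /= h0 H] := cx.
exists (h / 2); first by rewrite divr_gt0.
have := H (x + h / 2); rewrite /ball_ /= opprD addrA subrr add0r normrN gtr0_norm ?divr_gt0 //.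
rewrite ltr_pdivrMr // ltr_pMr // ltr1n => /(_ isT).
by rewrite ltr_distl => /andP [h1 h2]; lra.
Qed.

(** Positivity of [a] excludes the jump of the power of base 0 at exponent 0. *)
Lemma powR_cont_exponent x a e : 0 <= x -> 0 < a -> 0 < e ->
  exists2 h, 0 < h & forall b, `|a - b| < h -> `|x `^ a - x `^ b| < e.
Proof.
move=> x0 a0 e0; have [->|xn0] := eqVneq x 0.
  exists a => // b ab; have b0 : 0 < b.
    by move: ab; rewrite ltr_distl => /andP [h1 h2]; lra.
  by rewrite !powR0 ?gt_eqF // subrr normr0.
have E : (fun b => x `^ b) = (fun b => expR (b * ln x)).
  by apply/funext => b; rewrite /powR (negPf xn0).
have cx : {for a, continuous (fun b => x `^ b)}.
  rewrite E; apply: (@continuous_comp _ _ _ (fun b => b * ln x) expR); last exact: continuous_expR.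
  by apply: cvgMl; exact: cvg_id.
have /cvgrPdist_lt /(_ e e0) [h /= h0 H] := cx.
by exists h => // b ab; exact: H.
Qed.

End PowRMore.

#[local] Opaque sv_const.

Section PhiFacts.
Context {R : realType} {d : nat}.
Hypothesis d0 : (0 < d)%N.
Implicit Types (M X Y Z : 'M[R]_d) (s t : R).
Let c : R := @sv_const R d.
Let c1 : 1 <= c. Proof. exact: sv_const_ge1. Qed.
Let c0 : 0 <= c. Proof. exact: le_trans c1. Qed.

Lemma prod_svM k X Y :
  prod_sv (X *m Y) k <= c ^+ 3 * (prod_sv X k * prod_sv Y k).
Proof.
apply: le_trans (sv_le_minor_norm d0 _ _) _; rewrite -/c.
have -> : c ^+ 3 * (prod_sv X k * prod_sv Y k) =
  c * ((c * prod_sv X k) * (c * prod_sv Y k)) by ring.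
apply: ler_wpM2l => //; apply: le_trans (minor_normM _ _ _) _.
by apply: ler_pM; rewrite ?minor_norm_ge0 ?minor_norm_le_sv.
Qed.

(** Interpolate the submultiplicativity of the products of singular values; the
    constant is uniform in the exponent. *)
Lemma phi_submul : exists2 C : R, 1 <= C &
  forall s X Y, 0 <= s -> phi s (X *m Y) <= C * (phi s X * phi s Y).
Proof.
exists (c ^+ 3) => [|s X Y s0]; first exact: exprn_ege1.
have [ds|sd] := ltP d%:R s.
  rewrite !phi_gt_dim // det_mulmx normrM powRM // ler_peMl ?exprn_ege1 //.
have [m [md ms sm]] := segment_exists d0 s0 sd.
rewrite !(phi_interp _ md) //.
set a := _ - s; set b := s - _.
have a0 : 0 <= a by rewrite subr_ge0.
have b0 : 0 <= b by rewrite subr_ge0.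
have ab : a + b = 1 by rewrite /a /b -natr1; ring.
have H e k : 0 <= e -> prod_sv (X *m Y) k `^ e <=
   (c ^+ 3) `^ e * (prod_sv X k `^ e * prod_sv Y k `^ e).
  move=> e0; rewrite -!powRM ?mulr_ge0 ?prod_sv_ge0 ?exprn_ge0 //.
  by apply: ler_powRl => //; [exact: prod_sv_ge0|exact: prod_svM].
have := ler_pM (powR_ge0 _ _) (powR_ge0 _ _) (H a m a0) (H b m.+1 b0).
move=> /le_trans; apply.
have cE : c ^+ 3 = (c ^+ 3) `^ a * (c ^+ 3) `^ b.
  by rewrite -powRDge0 // ab powRr1 // exprn_ge0.
by rewrite [X in _ <= X * _]cE mulrACA [X in _ * X <= _]mulrACA.
Qed.

Lemma phi_dim_det : exists2 C : R, 1 <= C & forall M,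
  phi d%:R M <= C * `|\det M| /\ `|\det M| <= C * phi d%:R M.
Proof.
pose e : R := (d`! * (d ^ d * (d ^ d)) * d`!)%:R.
have e1 : 1 <= e by rewrite ler1n !muln_gt0 fact_gt0 !expn_gt0 d0.
exists (c * e) => [|M]; first by rewrite mulr_ege1.
rewrite phi_nat //; split.
  apply: le_trans (sv_le_minor_norm d0 _ _) _; rewrite -/c -mulrA.
  by apply: ler_wpM2l => //; exact: minor_norm_le_det.
apply: le_trans (det_le_minor_norm _) _.
apply: le_trans (minor_norm_le_sv d0 _ _) _; rewrite -/c.
apply: ler_wpM2r; first exact: prod_sv_ge0.
by rewrite ler_peMr.
Qed.

Lemma det_le_norm1 M : `|\det M| <= (c ^+ 2 * minor_norm 1 M) ^+ d.
Proof.
apply: le_trans (det_le_minor_norm _) _.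
apply: le_trans (minor_norm_le_sv d0 _ _) _; rewrite -/c.
apply: (@le_trans _ _ (c ^+ d * (c * minor_norm 1 M) ^+ d)).
  apply: ler_pM; rewrite ?prod_sv_ge0 //; first by apply: ler_eXnr.
  apply: le_trans (prod_sv_le _ _) _; rewrite lerXn2r ?nnegrE ?sv_ge0 ?mulr_ge0 ?minor_norm_ge0 //.
  exact: sv0_le_norm.
by rewrite -exprMn mulrA expr2.
Qed.

(** Each additional unit of exponent costs at most the norm of [M]; beyond [d]
    the function is a power of the determinant, which is also bounded by the
    norm. *)
Lemma phi_mono : exists2 C : R, 1 <= C & forall s t M, 0 <= s -> s <= t ->
  phi t M <= C * (phi s M * (C * minor_norm 1 M) `^ (t - s)).
Proof.
have [e e1 He] := phi_dim_det.
have e0 : 0 <= e by apply: le_trans e1.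
pose C := c ^+ 2 * e; exists C => [|s t M s0 st]; first by rewrite mulr_ege1 // exprn_ege1.
have C1 : 1 <= C by rewrite mulr_ege1 // exprn_ege1.
have C0 : 0 <= C by apply: le_trans C1.
have N0 : 0 <= minor_norm 1 M by exact: minor_norm_ge0.
have CN0 : 0 <= C * minor_norm 1 M by rewrite mulr_ge0.
have svC : sv M 0 <= C * minor_norm 1 M.
  apply: le_trans (sv0_le_norm d0 _) _; apply: ler_wpM2r => //; rewrite -/c /C.
  by rewrite expr2 -mulrA ler_peMr // mulr_ege1.
have low s' t' : 0 <= s' -> s' <= t' -> t' <= d%:R ->
    phi t' M <= phi s' M * (C * minor_norm 1 M) `^ (t' - s').
  move=> s0' st' td'; apply: le_trans (phi_mono_sv d0 _ s0' st' td') _.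
  apply: ler_wpM2l; first exact: phi_ge0.
  by apply: ler_powRl; rewrite ?subr_ge0 ?sv_ge0.
have dR : 0 < d%:R :> R by rewrite ltr0n.
have detp a : 0 <= a -> `|\det M| `^ (a / d%:R) <= (C * minor_norm 1 M) `^ a.
  move=> a0; apply: (@le_trans _ _ (((C * minor_norm 1 M) ^+ d) `^ (a / d%:R))).
    apply: ler_powRl; rewrite ?divr_ge0 //; apply: le_trans (det_le_norm1 _) _.
    rewrite lerXn2r ?nnegrE ?mulr_ge0 ?exprn_ge0 //; apply: ler_wpM2r => //.
    by rewrite /C ler_peMr ?exprn_ge0.
  by rewrite -powR_mulrn // -powRrM [d%:R * _]mulrC divfK ?gt_eqF.
have [dt|td] := ltP d%:R t; last first.
  apply: le_trans (low _ _ s0 st td) _.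
  by rewrite ler_peMl ?mulr_ge0 ?phi_ge0 ?powR_ge0.
rewrite (phi_gt_dim _ dt).
have [ds|sd] := ltP d%:R s.
  rewrite (phi_gt_dim _ ds).
  have -> : t / d%:R = s / d%:R + (t - s) / d%:R by rewrite -mulrDl; congr (_ / _); ring.
  rewrite (@powRDge0 _ _ (s / d%:R) ((t - s) / d%:R)) ?divr_ge0 ?subr_ge0 //.
  apply: (@le_trans _ _ (`|\det M| `^ (s / d%:R) * (C * minor_norm 1 M) `^ (t - s))).
    by apply: ler_wpM2l; [exact: powR_ge0|apply: detp; rewrite subr_ge0].
  by rewrite ler_peMl // mulr_ge0 ?powR_ge0.
have -> : t / d%:R = 1 + (t - d%:R) / d%:R by rewrite mulrBl divff ?gt_eqF //; ring.
have td0 : 0 <= t - d%:R by rewrite subr_ge0 ltW.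
rewrite (@powRDge0 _ _ 1 ((t - d%:R) / d%:R)) ?divr_ge0 // powRr1 //.
apply: (@le_trans _ _ ((C * (phi s M * (C * minor_norm 1 M) `^ (d%:R - s))) *
   (C * minor_norm 1 M) `^ (t - d%:R))).
  apply: ler_pM; rewrite ?powR_ge0 //; last exact: detp.
  apply: (@le_trans _ _ (C * phi d%:R M)).
    apply: le_trans (He M).2 _; apply: ler_wpM2r; first exact: phi_ge0.
    by rewrite /C ler_peMl // exprn_ege1.
  by apply: ler_wpM2l => //; apply: low.
have -> : t - s = (d%:R - s) + (t - d%:R) by ring.
rewrite (@powRDge0 _ _ (d%:R - s) (t - d%:R)) ?subr_ge0 //; last exact: ltW.
by rewrite !mulrA.
Qed.

Lemma det_le_sv_last : exists2 C : R, 1 <= C & forall M,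
  `|\det M| <= C * (C * minor_norm 1 M) ^+ d.-1 * sv M d.-1.
Proof.
exists c => // M; apply: le_trans (det_le_minor_norm _) _.
apply: le_trans (minor_norm_le_sv d0 _ _) _; rewrite -/c -mulrA.
apply: ler_wpM2l => //; rewrite -[d in prod_sv M d](prednK d0) prod_svS.
apply: ler_wpM2r; first exact: sv_ge0.
apply: le_trans (prod_sv_le _ _) _; rewrite lerXn2r ?nnegrE ?sv_ge0 ?mulr_ge0 ?minor_norm_ge0 //.
exact: sv0_le_norm.
Qed.

(** One-sided because a singular matrix makes [phi] jump down to the right of
    an integer exponent. *)
Lemma phi_left_cont s M e : 0 < s -> 0 < e ->
  exists2 h, 0 < h & forall t, 0 <= t -> t <= s -> s - t < h -> phi t M <= phi s M + e.
Proof.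
move=> s0 e0.
have dR : 0 < d%:R :> R by rewrite ltr0n.
have [ds|sd] := ltP d%:R s.
  have sd0 : 0 < s / d%:R by rewrite divr_gt0.
  have [h h0 H] := powR_cont_exponent (normr_ge0 (\det M)) sd0 e0.
  exists (Num.min (s - d%:R) (h * d%:R)) => [|t t0 ts].
    by rewrite lt_min subr_gt0 ds mulr_gt0.
  rewrite lt_min => /andP [h1 h2].
  rewrite !phi_gt_dim //; last by move: h1; lra.
  have := H (t / d%:R); rewrite -mulrBl normrM normfV (gtr0_norm dR) ltr_pdivrMr //.
  rewrite ger0_norm ?subr_ge0 // => /(_ h2).
  by rewrite ltr_distl => /andP []; lra.
have [m [md ms sm]] : exists m, [/\ (m < d)%N, m%:R < s & s <= m.+1%:R].
  have [m [md ms sm]] := segment_exists d0 (ltW s0) sd.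
  have [E|ne] := eqVneq s m%:R; last first.
    by exists m; split => //; rewrite lt_neqAle eq_sym ne.
  case: m E {ms sm} md => [E|m E md]; first by move: s0; rewrite E ltxx.
  by exists m; split; rewrite ?E ?ltr_nat //; apply: ltnW.
have sm0 : 0 < s - m%:R by rewrite subr_gt0.
have P0 := prod_sv_ge0 M m.
have ep : 0 < e / (prod_sv M m + 1) by rewrite divr_gt0 // ltr_wpDl.
have [h h0 H] := powR_cont_exponent (sv_ge0 M m) sm0 ep.
exists (Num.min (s - m%:R) h) => [|t t0 ts]; first by rewrite lt_min sm0.
rewrite lt_min => /andP [h1 h2].
have mt : m%:R <= t by move: h1; rewrite ltrD2l ltrN2 => /ltW.
rewrite (@phi_segment _ _ m s M md (ltW ms) sm) (@phi_segment _ _ m t M md mt (le_trans ts sm)).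
have := H (t - m%:R).
have -> : s - m%:R - (t - m%:R) = s - t by ring.
rewrite ger0_norm ?subr_ge0 // => /(_ h2); rewrite ltr_distl => /andP [].
move=> + _; set v := sv M m `^ _; set u := sv M m `^ _ => H1.
apply: (@le_trans _ _ (prod_sv M m * (u + e / (prod_sv M m + 1)))).
  by apply: ler_wpM2l => //; move: H1; lra.
rewrite mulrDr lerD2l mulrA ler_pdivrMr ?ltr_wpDl // mulrC ler_wpM2l ?ltW //.
by rewrite ltrDl.
Qed.

Lemma sum_continuous_at (I : finType) (F : I -> 'M[R]_d -> R) M :
  (forall i, {for M, continuous (F i)}) -> {for M, continuous (fun X => \sum_i F i X)}.
Proof.
move=> H; apply: (cvg_big (@add_continuous R)) => [|i _]; last exact: H.
exact: nbhs_filter.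
Qed.

Lemma minor_continuous k M (f g : 'I_k -> 'I_d) :
  {for M, continuous (fun X => \det (mxsub f g X))}.
Proof.
rewrite /determinant; apply: sum_continuous_at => s.
apply: (@cvgM R _ (nbhs M) _ (fun=> (-1) ^+ s) (fun X => \prod_i mxsub f g X i (s i))); first exact: cvg_cst.
apply: (cvg_big (@mul_continuous R)) => i _.
have -> : (fun X : 'M[R]_d => mxsub f g X i (s i)) = (fun X => X (f i) (g (s i))).
  by apply/funext => X; rewrite mxE.
rewrite mxE; exact: coord_continuous.
Qed.

Lemma minor_norm_continuous k M : {for M, continuous (@minor_norm R k d)}.
Proof.
apply: sum_continuous_at => f; apply: sum_continuous_at => g.
by apply: continuous_comp; [exact: minor_continuous|exact: norm_continuous].
Qed.

Lemma near_le_add (f : 'M[R]_d -> R) M h : {for M, continuous f} -> 0 < h ->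
  \forall M' \near M, f M' <= f M + h.
Proof.
move=> fc h0; have /cvgrPdist_lt /(_ h h0) := fc.
by apply: filterS => M'; rewrite ltr_distl => /andP [h1 h2]; lra.
Qed.

Lemma powR_near_le (f : 'M[R]_d -> R) M a e : {for M, continuous f} ->
  (forall X, 0 <= f X) -> 0 <= a -> 0 < e ->
  \forall M' \near M, f M' `^ a <= f M `^ a + e.
Proof.
move=> fc f0 a0 e0; have [h h0 H] := powR_usc (f0 M) a0 e0.
apply: filterS (near_le_add fc h0) => M' HM'.
by apply: le_trans H; apply: ler_powRl.
Qed.

(** Up to a constant [phi] is a product of powers of minor norms, which are
    continuous in the matrix; the power functions are upper semicontinuous
    even when an exponent vanishes. *)
Lemma phi_usc : exists2 C : R, 1 <= C & forall s M e, 0 <= s -> 0 < e ->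
  \forall M' \near M, phi s M' <= C * phi s M + e.
Proof.
exists (c ^+ 2) => [|s M e s0 e0]; first by apply: exprn_ege1.
have c2 : 1 <= c ^+ 2 by apply: exprn_ege1.
have [ds|sd] := ltP d%:R s.
  have sd0 : 0 <= s / d%:R by rewrite divr_ge0.
  have detc : {for M, continuous (fun X : 'M[R]_d => `|\det X|)}.
    apply: (@continuous_comp _ _ _ (fun X : 'M[R]_d => \det X)); last exact: norm_continuous.
    have := @minor_continuous d M id id; congr (continuous_at _ _).
    by apply/funext => X; congr (\det _); apply/matrixP => i j; rewrite mxE.
  apply: filterS (powR_near_le detc (fun X => normr_ge0 _) sd0 e0) => M'.
  rewrite !(phi_gt_dim _ ds) => /le_trans; apply; rewrite lerD2r ler_peMl //.
have [m [md ms sm]] := segment_exists d0 s0 sd.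
set a := m.+1%:R - s; set b := s - m%:R.
have a0 : 0 <= a by rewrite subr_ge0.
have b0 : 0 <= b by rewrite subr_ge0.
have ab : a + b = 1 by rewrite /a /b -natr1; ring.
set u := minor_norm m M `^ a; set v := minor_norm m.+1 M `^ b.
have u0 : 0 <= u by exact: powR_ge0.
have v0 : 0 <= v by exact: powR_ge0.
have cgt : 0 < c by apply: lt_le_trans c1.
pose h := Num.min 1 (e / (c * (u + v + 1))).
have uv1 : 0 < u + v + 1 by rewrite ltr_wpDl // addr_ge0.
have h0 : 0 < h by rewrite lt_min ltr01 divr_gt0 // mulr_gt0.
have h1 : h <= 1 by rewrite ge_min lexx.
have h2 : c * (h * (u + v + 1)) <= e.
  have : h <= e / (c * (u + v + 1)) by rewrite ge_min lexx orbT.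
  by rewrite ler_pdivlMr ?mulr_gt0 // mulrCA.
have N0 k X : 0 <= minor_norm k X :> R by exact: minor_norm_ge0.
have cab : c = c `^ a * c `^ b by rewrite -powRDge0 // ab powRr1.
have up := powR_near_le (@minor_norm_continuous m M) (N0 m) a0 h0.
have vp := powR_near_le (@minor_norm_continuous m.+1 M) (N0 m.+1) b0 h0.
apply: filterS2 up vp => M' up vp.
rewrite !(phi_interp _ md) // -/a -/b.
apply: (@le_trans _ _ (c * ((u + h) * (v + h)))).
  apply: (@le_trans _ _ (c * (minor_norm m M' `^ a * minor_norm m.+1 M' `^ b))).
    rewrite [X in _ <= X * _]cab mulrACA -!powRM //.
    by apply: ler_pM; rewrite ?powR_ge0 //; apply: ler_powRl; rewrite ?prod_sv_ge0 ?sv_le_minor_norm.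
  by apply: ler_wpM2l => //; apply: ler_pM; rewrite ?powR_ge0.
have uvp : u * v <= c * (prod_sv M m `^ a * prod_sv M m.+1 `^ b).
  rewrite [X in _ <= X * _]cab mulrACA -!powRM ?prod_sv_ge0 //.
  by apply: ler_pM => //; apply: ler_powRl; rewrite ?minor_norm_le_sv.
set w := prod_sv M m `^ a * _ in uvp *.
have e1 : (u + h) * (v + h) <= u * v + h * (u + v + 1).
  have -> : (u + h) * (v + h) = u * v + h * (u + v + h) by ring.
  by rewrite lerD2l ler_pM2l // lerD2l.
apply: le_trans (ler_wpM2l c0 e1) _; rewrite mulrDr; apply: lerD => //.
by rewrite expr2 -mulrA; apply: ler_wpM2l.
Qed.

Lemma sv_pow_le m k M : (m <= k)%N -> prod_sv M k <= prod_sv M m * sv M m ^+ (k - m).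
Proof.
move=> mk; rewrite -(subnK mk) addnK; elim: (k - m)%N => [|j IH].
  by rewrite add0n expr0 mulr1.
rewrite addSn prod_svS exprSr mulrA; apply: ler_pM; rewrite ?prod_sv_ge0 ?sv_ge0 //.
by apply: sv_dec; apply: leq_addl.
Qed.

Lemma sv_pow_ge p m M : (p <= m)%N -> prod_sv M p * sv M m ^+ (m - p) <= prod_sv M m.
Proof.
move=> pm; have H j : (p + j <= m)%N -> prod_sv M p * sv M m ^+ j <= prod_sv M (p + j).
  elim: j => [|j IH] pj; first by rewrite addn0 expr0 mulr1.
  rewrite addnS in pj; rewrite addnS prod_svS exprSr mulrA.
  apply: ler_pM; rewrite ?mulr_ge0 ?prod_sv_ge0 ?exprn_ge0 ?sv_ge0 ?IH // 1?ltnW //.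
  by apply: sv_dec; apply: ltnW.
by have := H (m - p)%N; rewrite subnKC // leqnn; apply.
Qed.

Lemma sv_gt0 M i k : (i < k)%N -> 0 < prod_sv M k -> 0 < sv M i.
Proof.
move=> ik P0; rewrite lt_def sv_ge0 andbT; apply: contraTneq P0 => E.
by rewrite /prod_sv (bigD1 (Ordinal ik)) //= E mul0r ltxx.
Qed.

Lemma prod_sv_gt0 M i k : (i <= k)%N -> 0 < prod_sv M k -> 0 < prod_sv M i.
Proof.
by move=> ik P0; apply: prodr_gt0 => j _; apply: sv_gt0 P0; apply: leq_trans ik.
Qed.

(** The sequence of products of decreasing numbers is log-concave. *)
Lemma minor_norm_logconcave k M :
  minor_norm k M * minor_norm k.+2 M <= c ^+ 4 * minor_norm k.+1 M ^+ 2.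
Proof.
have N0 j : 0 <= minor_norm j M by exact: minor_norm_ge0.
apply: le_trans (ler_pM (N0 _) (N0 _) (minor_norm_le_sv d0 _ _) (minor_norm_le_sv d0 _ _)) _.
rewrite -/c mulrACA -expr2.
apply: (@le_trans _ _ (c ^+ 2 * prod_sv M k.+1 ^+ 2)).
  apply: ler_wpM2l; first exact: exprn_ge0.
  have H := ler_wpM2l (mulr_ge0 (prod_sv_ge0 M k) (prod_sv_ge0 M k.+1)) (sv_dec M (leqnSn k)).
  rewrite (prod_svS M k.+1) mulrA; apply: le_trans H _.
  by rewrite expr2 mulrAC -prod_svS.
have -> : c ^+ 4 * minor_norm k.+1 M ^+ 2 = c ^+ 2 * (c * minor_norm k.+1 M) ^+ 2 by ring.
apply: ler_wpM2l; first exact: exprn_ge0.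
by rewrite lerXn2r ?nnegrE ?prod_sv_ge0 ?mulr_ge0 ?sv_le_minor_norm.
Qed.

(** The logarithm of [phi t M] is a concave function of [t], so it lies above its
    chords. *)
Lemma chord_le_phi p q t M : (p < q)%N -> (q <= d)%N -> p%:R < t -> t < q%:R ->
  prod_sv M p `^ ((q%:R - t) / (q%:R - p%:R)) *
  prod_sv M q `^ ((t - p%:R) / (q%:R - p%:R)) <= phi t M.
Proof.
move=> pq qd pt tq.
have qp0 : 0 < q%:R - p%:R :> R by rewrite subr_gt0 ltr_nat.
have [Pq0|Pq0] := eqVneq (prod_sv M q) 0.
  by rewrite Pq0 powR0 ?mulr0 ?phi_ge0 // gt_eqF // divr_gt0 // subr_gt0.
have Pq : 0 < prod_sv M q by rewrite lt_def Pq0 prod_sv_ge0.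
have t0 : 0 <= t by apply: le_trans (ltW pt).
set m := Num.truncn t; have /andP [mt tm] := truncn_itv t0.
have pm : (p <= m)%N by rewrite truncn_ge_nat // ltW.
have mq : (m < q)%N by rewrite truncn_lt_nat.
have md : (m < d)%N by apply: leq_trans qd.
rewrite (phi_segment _ md mt (ltW tm)).
have Pm : 0 < prod_sv M m by apply: prod_sv_gt0 Pq; apply: ltnW.
have Pp : 0 < prod_sv M p by apply: prod_sv_gt0 Pq; apply: ltnW.
have sm : 0 < sv M m by apply: sv_gt0 Pq.
have A : ln (prod_sv M q) <= ln (prod_sv M m) + (q%:R - m%:R) * ln (sv M m).
  rewrite -natrB ?(ltnW mq) // mulr_natl -lnXn // -lnM ?posrE ?exprn_gt0 //.
  by rewrite ler_ln ?posrE ?mulr_gt0 ?exprn_gt0 // sv_pow_le // ltnW.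
have B : ln (prod_sv M p) + (m%:R - p%:R) * ln (sv M m) <= ln (prod_sv M m).
  rewrite -natrB // mulr_natl -lnXn // -lnM ?posrE ?exprn_gt0 //.
  by rewrite ler_ln ?posrE ?mulr_gt0 ?exprn_gt0 // sv_pow_ge.
rewrite /powR !gt_eqF // -[X in _ <= X * _](lnK Pm) -!expRD ler_expR.
rewrite -(@ler_pM2l _ (q%:R - p%:R)) //.
have -> : (q%:R - p%:R) * ((q%:R - t) / (q%:R - p%:R) * ln (prod_sv M p) +
   (t - p%:R) / (q%:R - p%:R) * ln (prod_sv M q)) =
   (q%:R - t) * ln (prod_sv M p) + (t - p%:R) * ln (prod_sv M q).
  by field; rewrite gt_eqF.
have A' := ler_wpM2l (ltW (_ : 0 < t - p%:R)) A.
have B' := ler_wpM2l (ltW (_ : 0 < q%:R - t)) B.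
rewrite !subr_gt0 in A' B'; have {}A' := A' pt; have {}B' := B' tq.
rewrite -/m; set L := ln (sv M m) in A' B' *; set a := ln _ in A' B' *.
set b := ln _ in A' B' *; set e := ln _ in A' B' *.
move: A' B'; nra.
Qed.

End PhiFacts.

(** * Sums over words *)

Section WordSums.
Context {R : realType}.

(** Recursion on the length, rather than a sum over tuples, makes splitting a
    word into factors hold by computation. *)
Fixpoint wsum {T : finType} (n : nat) (F : seq T -> R) : R :=
  if n is m.+1 then \sum_(a : T) wsum m (fun w => F (a :: w)) else F [::].

Context {T : finType}.
Implicit Types (F G : seq T -> R) (f : T -> R).

Lemma ler_wsum n F G : (forall w, size w = n -> F w <= G w) ->
  wsum n F <= wsum n G.
Proof.
elim: n F G => [|n IH] F G FG /=; first exact: FG.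
by apply: ler_sum => a _; apply: IH => w wn; apply: FG; rewrite /= wn.
Qed.

Lemma eq_wsum n F G : (forall w, size w = n -> F w = G w) -> wsum n F = wsum n G.
Proof.
by move=> FG; apply/le_anti; rewrite !ler_wsum // => w wn; rewrite FG.
Qed.

Lemma wsum_ge0 n F : (forall w, size w = n -> 0 <= F w) -> 0 <= wsum n F.
Proof.
elim: n F => [|n IH] F F0 /=; first exact: F0.
by apply: sumr_ge0 => a _; apply: IH => w wn; apply: F0; rewrite /= wn.
Qed.

Lemma wsumZ n c F : wsum n (fun w => c * F w) = c * wsum n F.
Proof.
elim: n F => //= n IH F; rewrite mulr_sumr; apply: eq_bigr => a _.
by rewrite -IH.
Qed.

Lemma wsumZr n c F : wsum n (fun w => F w * c) = wsum n F * c.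
Proof. by rewrite mulrC -wsumZ; apply: eq_wsum => w _; rewrite mulrC. Qed.

Lemma wsumD n F G : wsum n (fun w => F w + G w) = wsum n F + wsum n G.
Proof.
elim: n F G => //= n IH F G; rewrite -big_split; apply: eq_bigr => a _.
exact: IH.
Qed.

Lemma wsum_cat n m F :
  wsum (n + m) F = wsum n (fun u => wsum m (fun v => F (u ++ v))).
Proof. by elim: n F => //= n IH F; apply: eq_bigr => a _; rewrite IH. Qed.

Lemma wsum_prod n f :
  wsum n (fun w => \prod_(a <- w) f a) = (\sum_a f a) ^+ n.
Proof.
elim: n => [|n IH] /=; first by rewrite big_nil.
rewrite exprS big_distrl; apply: eq_bigr => a _ /=.
by rewrite -IH -wsumZ; apply: eq_wsum => w _; rewrite big_cons.
Qed.

Lemma wsum_exchange (I : finType) n (F : I -> seq T -> R) :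
  wsum n (fun w => \sum_i F i w) = \sum_i wsum n (F i).
Proof.
elim: n F => //= n IH F; rewrite exchange_big /=; apply: eq_bigr => a _.
exact: IH.
Qed.

Lemma ler_wsum_term n F w : (forall v, size v = n -> 0 <= F v) -> size w = n ->
  F w <= wsum n F.
Proof.
elim: n F w => [|n IH] F [|a w] //= F0 [wn].
rewrite (bigD1 a) //=.
have /IH -/(_ w wn) : forall v, size v = n -> 0 <= F (a :: v).
  by move=> v vn; apply: F0; rewrite /= vn.
move=> /le_trans; apply; rewrite lerDl; apply: sumr_ge0 => b _.
by apply: wsum_ge0 => v vn; apply: F0; rewrite /= vn.
Qed.

Lemma wsum_tuple n F : wsum n F = \sum_(w : n.-tuple T) F w.
Proof.
elim: n F => [|n IH] F /=.
  by rewrite (big_pred1 [tuple]) // => w; rewrite !inE; apply/esym/eqP/val_inj; rewrite tuple0.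
rewrite (reindex (fun p : T * n.-tuple T => [tuple of p.1 :: p.2])) /=; last first.
  apply: onW_bij; exists (fun w : n.+1.-tuple T => (thead w, [tuple of behead w])).
    by move=> [a w] /=; congr pair; apply: val_inj.
  by move=> w; rewrite [RHS]tuple_eta; apply: val_inj.
rewrite -(pair_big predT predT (fun a (w : n.-tuple T) => F (a :: w))) /=.
by apply: eq_bigr => a _; apply: IH.
Qed.

Lemma wsum_submul (f : seq T -> R) n m : (forall w, 0 <= f w) ->
  (forall u v, f (u ++ v) <= f u * f v) ->
  wsum (n + m) f <= wsum n f * wsum m f.
Proof.
move=> f0 fM; rewrite wsum_cat -wsumZr; apply: ler_wsum => u _.
by rewrite -wsumZ; apply: ler_wsum => v _.
Qed.

End WordSums.

Section Blocks.
Context {R : realType} {S : finType} {b : nat}.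
Local Notation T := (b.-tuple S).

Definition unblock (W : seq T) : seq S := flatten (map val W).

Lemma unblock_cat U V : unblock (U ++ V) = unblock U ++ unblock V.
Proof. by rewrite /unblock map_cat flatten_cat. Qed.

Lemma wsum_unblock L (F : seq S -> R) :
  wsum L (fun W : seq T => F (unblock W)) = wsum (L * b) F.
Proof.
elim: L F => //= L IH F; rewrite mulSn wsum_cat wsum_tuple; apply: eq_bigr => a _.
by rewrite -IH; apply: eq_wsum => W _; rewrite /unblock.
Qed.

End Blocks.

(** * Avalanche principle and rising sun lemma *)

Lemma doubling_bounds n a e : (e <= n.+1 + a)%N -> (1 <= a)%N -> (8 * a < e)%N ->
  [/\ (a < 2 * a)%N, (2 * a < 4 * a)%N, (4 * a < e)%N, (2 * a < e)%N & (a < e)%N] /\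
  [/\ (e <= n + 2 * a)%N, (1 <= 2 * a)%N & (2 * (2 * a) < e)%N].
Proof. by move=> *; split; split; lia. Qed.

Section Avalanche.
Context {R : realType}.

(** One step of the avalanche principle.  Here [x], [y], [z] are the norms of three
    consecutive blocks, [xy], [yz], [xyz] those of their products, and [g] is the
    gap term of the middle block.  The gap inequality bounds [xy * yz] by the
    sum of [xyz * y] and [x * z * g]; the small gap [D] makes the second term at most half of the
    left-hand side. *)
Lemma three_block_step (x y z xy yz xyz g A B C D : R) :
  0 < x -> 0 < y -> 0 < z -> 0 < yz -> 0 <= g -> 0 <= A -> 0 <= B -> 1 <= C -> 0 <= D ->
  x * y <= A * xy -> xy * yz <= C * (xyz * y + x * z * g) ->
  y * z <= B * yz -> g <= D * y ^+ 2 -> A * C * B * D <= 2^-1 ->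
  x * yz <= 2 * A * C * xyz.
Proof.
move=> x0 y0 z0 yz0 g0 A0 B0 C1 D0 h1 h2 h3 h4 h5.
have C0 : 0 <= C by apply: le_trans C1.
have s1 : x * y * yz <= A * (C * (xyz * y + x * z * g)).
  apply: (@le_trans _ _ (A * (xy * yz))); last exact: ler_wpM2l.
  by rewrite mulrA ler_pM2r.
have s2 : x * z * g <= D * B * (x * y * yz).
  apply: (@le_trans _ _ (x * z * (D * y ^+ 2))).
    by apply: ler_wpM2l => //; rewrite mulr_ge0 ?ltW.
  have -> : x * z * (D * y ^+ 2) = (D * (x * y)) * (y * z) by ring.
  have -> : D * B * (x * y * yz) = (D * (x * y)) * (B * yz) by ring.
  by apply: ler_wpM2l => //; rewrite !mulr_ge0 // ltW.
have s3 : A * C * (x * z * g) <= 2^-1 * (x * y * yz).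
  apply: (@le_trans _ _ (A * C * (D * B * (x * y * yz)))).
    by apply: ler_wpM2l => //; rewrite mulr_ge0.
  have -> : A * C * (D * B * (x * y * yz)) = A * C * B * D * (x * y * yz) by ring.
  by apply: ler_wpM2r => //; rewrite !mulr_ge0 // ltW.
have s4 : x * y * yz <= 2 * (A * C * (xyz * y)) by lra.
rewrite -(ler_pM2r y0).
have -> : x * yz * y = x * y * yz by ring.
by have -> : 2 * A * C * xyz * y = 2 * (A * C * (xyz * y)) by ring.
Qed.

(** Multi-scale avalanche: the junction after the first block is controlled by
    middle blocks of doubling length, so that the total loss does not depend on
    the length [E] of the product, although the only available bound on a
    junction is exponential in the length. *)
Section Chain.
Variables (N G : nat -> nat -> R) (C h : R) (E : nat).
Hypothesis C1 : 1 <= C.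
Hypothesis h0 : 0 <= h.
Hypothesis Ch : 4 * C ^+ 2 <= expR h.
Hypothesis N_gt0 : forall i j, (i < j)%N -> (j <= E)%N -> 0 < N i j.
Hypothesis G_ge0 : forall i j, (i < j)%N -> (j <= E)%N -> 0 <= G i j.
Hypothesis gapE : forall i j k l, (i < j)%N -> (j < k)%N -> (k < l)%N -> (l <= E)%N ->
  N i k * N j l <= C * (N i l * N j k + N i j * N k l * G j k).
Hypothesis junction : forall i j k, (i < j)%N -> (j < k)%N -> (k <= E)%N ->
  N i j * N j k <= expR (h * k%:R) * N i k.
Hypothesis gapY : forall i j, (i < j)%N -> (j <= E)%N ->
  G i j <= expR (h * j%:R - 32 * h * (j - i)%:R) * N i j ^+ 2.

Let C0 : 0 <= C. Proof. exact: le_trans C1. Qed.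

(** The middle block of the gap inequality is [[2 a, 4 a)], twice as long as the
    first one, and the junction at its right end is the claim with [a] doubled.
    The gap of that block gains [64 h a], more than its two junctions and the
    slack in the gap bound lose. *)
Lemma chain_claim n a e : (e <= n + a)%N -> (1 <= a)%N -> (2 * a < e)%N -> (e <= E)%N ->
  N a (2 * a) * N (2 * a) e <= 2 * C * expR (8 * h * a%:R) * N a e.
Proof.
elim: n a e => [|n IH] a e.
  rewrite add0n => ea _ ae; have := leq_trans ae ea.
  by rewrite mul2n -addnn -addnS -{3}[a]addn0 leq_add2l.
move=> en a1 ae eE.
have a2 : (a < 2 * a)%N by rewrite mul2n -addnn -{1}[a]addn0 ltn_add2l.
have Nae : 0 < N a e by apply: N_gt0 => //; apply: ltn_trans ae.
have [small|large] := leqP e (8 * a).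
  apply: le_trans (junction a2 ae eE) _.
  apply: ler_wpM2r; first exact: ltW.
  apply: (@le_trans _ _ (expR (8 * h * a%:R))).
    rewrite ler_expR mulrC -mulrA [h * _]mulrC mulrA ler_wpM2r //.
    by rewrite -natrM ler_nat.
  apply: ler_peMl; first exact: expR_ge0.
  by rewrite mulr_ege1 // ler1n.
have [[_ a24 a4e a2e a_e] [k1 k2 k3]] := doubling_bounds en a1 large.
have a4E := leq_trans (ltnW a4e) eE.
have IH' : N (2 * a) (4 * a) * N (4 * a) e <= 2 * C * expR (16 * h * a%:R) * N (2 * a) e.
  have := IH (2 * a)%N e k1 k2 k3 eE; rewrite mulnA -[(2 * 2)%N]/4%N.
  by have -> : 16 * h * a%:R = 8 * h * (2 * a)%:R by rewrite natrM; ring.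
have p1 : 0 < N a (2 * a) by apply: N_gt0 => //; apply: leq_trans (ltnW a24) a4E.
have p2 : 0 < N (2 * a) (4 * a) by apply: N_gt0.
have p3 : 0 < N (4 * a) e by apply: N_gt0.
have p4 : 0 < N (2 * a) e by apply: N_gt0.
have g0 : 0 <= G (2 * a) (4 * a) by apply: G_ge0.
have gp := gapE a2 a24 a4e eE; have jn := junction a2 a24 a4E.
have gy := gapY a24 a4E.
set u := expR (4 * h * a%:R).
have ha0 : 0 <= h * a%:R by rewrite mulr_ge0.
have e4 : expR (h * (4 * a)%:R) = u by rewrite /u natrM; congr expR; ring.
have eY : expR (h * (4 * a)%:R - 32 * h * (4 * a - 2 * a)%:R) = expR (- (60 * h * a%:R)).
  by have -> : (4 * a - 2 * a = 2 * a)%N; [rewrite -mulnBl|rewrite !natrM; congr expR; ring].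
rewrite e4 in jn; rewrite eY in gy.
have := three_block_step p1 p2 p3 p4 g0 (ltW (expR_gt0 _)) _ C1 (ltW (expR_gt0 _)) jn gp IH' gy.
move=> /(_ _ _)/le_trans; apply.
- by rewrite !mulr_ge0 // expR_ge0.
- have -> : u * C * (2 * C * expR (16 * h * a%:R)) * expR (- (60 * h * a%:R)) =
     (2 * C ^+ 2) * (u * expR (16 * h * a%:R) * expR (- (60 * h * a%:R))) by ring.
  rewrite -!expRD.
  have -> : 4 * h * a%:R + 16 * h * a%:R + - (60 * h * a%:R) = - (40 * (h * a%:R)) by ring.
  rewrite expRN ler_pdivrMr ?expR_gt0 //.
  apply: (@le_trans _ _ (2^-1 * expR h)); first by move: Ch; set w := expR h; lra.
  rewrite ler_pM2l ?invr_gt0 // ler_expR.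
  apply: (@le_trans _ _ (h * a%:R)); first by rewrite ler_peMr // ler1n.
  by rewrite ler_peMl // ler1n.
- rewrite -[X in X * _]mulrA [u * C]mulrC mulrA -!mulrA; apply: ler_wpM2l => //.
  apply: ler_wpM2l => //; apply: ler_wpM2r; first exact: ltW.
  by rewrite ler_expR -!mulrA; apply: ler_wpM2r => //; rewrite ler_nat.
Qed.

Lemma chain_first_junction e : (1 < e)%N -> (e <= E)%N ->
  N 0 1 * N 1 e <= 2 * C * expR (8 * h) * N 0 e.
Proof.
move=> e1 eE.
have p5 : 0 < N 0 e by apply: N_gt0; lia.
have [e2|e2] := leqP e 2.
  have ee : e = 2%N by lia.
  subst e; apply: le_trans (@junction 0 1 2 _ _ _) _ => //.
  apply: ler_wpM2r; first exact: ltW.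
  apply: (@le_trans _ _ (expR (8 * h))); first by rewrite ler_expR mulrC ler_wpM2r // ler_nat.
  apply: ler_peMl; first exact: expR_ge0.
  by rewrite mulr_ege1 // ler1n.
have IH := @chain_claim e 1 e (leq_addr _ _) isT e2 eE; rewrite muln1 mulr1 in IH.
have p1 : 0 < N 0 1 by apply: N_gt0; lia.
have p2 : 0 < N 1 2 by apply: N_gt0; lia.
have p3 : 0 < N 2 e by apply: N_gt0; lia.
have p4 : 0 < N 1 e by apply: N_gt0 eE; exact: ltnW.
have g0 : 0 <= G 1 2 by apply: G_ge0 => //; apply: leq_trans eE; exact: ltnW.
have gp := @gapE 0 1 2 e isT isT e2 eE.
have E2 : (2 <= E)%N by apply: ltnW; apply: leq_trans e2 eE.
have jn := @junction 0 1 2 isT isT E2; have gy := @gapY 1 2 isT E2.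
rewrite subSnn mulr1 in gy.
have := three_block_step p1 p2 p3 p4 g0 (ltW (expR_gt0 _)) _ C1 (ltW (expR_gt0 _)) jn gp IH gy.
move=> /(_ _ _)/le_trans; apply.
- by rewrite !mulr_ge0 // expR_ge0.
- have -> : expR (h * 2) * C * (2 * C * expR (8 * h)) * expR (h * 2 - 32 * h) =
     (2 * C ^+ 2) * (expR (h * 2) * expR (8 * h) * expR (h * 2 - 32 * h)) by ring.
  rewrite -!expRD.
  have -> : h * 2 + 8 * h + (h * 2 - 32 * h) = - (20 * h) by ring.
  rewrite expRN ler_pdivrMr ?expR_gt0 //.
  apply: (@le_trans _ _ (2^-1 * expR h)); first by move: Ch; set w := expR h; lra.
  rewrite ler_pM2l ?invr_gt0 // ler_expR.
  by rewrite ler_peMl // ler1n.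
- rewrite -[X in X * _]mulrA [expR _ * C]mulrC mulrA -!mulrA; apply: ler_wpM2l => //.
  apply: ler_wpM2l => //; apply: ler_wpM2r; first exact: ltW.
  by rewrite ler_expR mulrC; apply: ler_wpM2r => //; rewrite ler_nat.
Qed.

End Chain.

(** For a superadditive quantity of size [H 0 L] only few positions can start an
    interval on which it exceeds [h] times the length: disjoint such intervals
    cover them all. *)
Section RisingSun.
Variables (H : nat -> nat -> R) (h : R) (L : nat).
Hypothesis h0 : 0 <= h.
Hypothesis H_ge0 : forall i j, 0 <= H i j.
Hypothesis H_super : forall i j k, (i <= j)%N -> (j <= k)%N -> (k <= L)%N ->
  H i j + H j k <= H i k.

Definition heavy_start i := [exists e : 'I_L.+1, (i < e)%N && (h * (e - i)%:R < H i e)].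

Lemma rising_sun_from i : (i <= L)%N ->
  h * (\sum_(i <= j < L) heavy_start j)%:R <= H i L.
Proof.
move eqn : (L - i)%N => n; elim/ltn_ind: n i eqn => n IH i eqn iL.
have [iL'|Li] := ltnP i L; last by rewrite big_geq // mulr0.
rewrite big_ltn //; have [bad|good] := boolP (heavy_start i); last first.
  rewrite add0n; apply: (@le_trans _ _ (H i.+1 L)).
    by apply: (IH (L - i.+1)%N) => //; rewrite -eqn ltn_sub2l.
  by apply: le_trans (H_super (leqnSn i) iL' (leqnn L)); rewrite lerDr.
have /existsP [e /andP [ie he]] := bad.
have eL : (e <= L)%N by rewrite -ltnS.
apply: le_trans (H_super (ltnW ie) eL (leqnn L)).
apply: (@le_trans _ _ (h * (e - i)%:R + h * (\sum_(e <= j < L) heavy_start j)%:R)); last first.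
  apply: lerD; first exact: ltW.
  by apply: (IH (L - e)%N) => //; rewrite -eqn ltn_sub2l.
rewrite -mulrDr -natrD; apply: ler_wpM2l => //.
rewrite ler_nat (big_cat_nat (n := e)) //= -/(1%N) addnA leq_add2r add1n -(subnSK ie) ltnS.
apply: (@leq_trans (\sum_(i.+1 <= j < e) 1)%N); last by rewrite sum_nat_const_nat muln1.
by apply: leq_sum => j _; case: heavy_start.
Qed.

Lemma rising_sun : h * (\sum_(j < L) heavy_start j)%:R <= H 0 L.
Proof. by have := rising_sun_from (leq0n L); rewrite big_mkord. Qed.

End RisingSun.
End Avalanche.

Lemma card_set_span (L : nat) (A : {set 'I_L}) (r t : 'I_L) :
  (forall i, i \in A -> (r <= i)%N && (i <= t)%N) -> (#|A| <= (t - r).+1)%N.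
Proof.
move=> H; rewrite cardE -(size_map (@nat_of_ord L)) -[X in (_ <= X)%N](size_iota r).
apply: uniq_leq_size; first by rewrite map_inj_uniq ?enum_uniq //; exact: val_inj.
move=> _ /mapP [i + ->]; rewrite mem_enum mem_iota => /H /andP [ri it].
by rewrite ri addnS ltnS subnKC // (leq_trans ri).
Qed.

(** Half of the positions are good, so one letter occupies a proportion
    [1 / (2 #|T|)] of all positions; take its first and last good occurrence. *)
Lemma recurrent_letter (T : finType) (w : nat -> T) (good : pred nat) (L : nat) :
  (0 < L)%N -> (L <= 2 * \sum_(j < L) good j)%N ->
  exists r t : nat, [/\ (r <= t)%N, (t < L)%N, good r, good t & w r = w t] /\
    (L <= 2 * #|T| * (t - r).+1)%N.
Proof.
move=> L0 HL; pose A k := [set j : 'I_L | good j & w j == k]%SET.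
have sumA : (\sum_(j < L) good j = \sum_k #|A k|)%N.
  rewrite (eq_bigr (fun j : 'I_L => \sum_k ((j \in A k) : nat))%N); last first.
    move=> j _; rewrite (bigD1 (w j)) //= inE eqxx andbT big1 ?addn0 // => k kj.
    by rewrite inE eq_sym (negPf kj) andbF.
  by rewrite exchange_big; apply: eq_bigr => k _; rewrite -sum1_card [RHS]big_mkcond.
have [k Hk] : exists k, (L <= 2 * #|T| * #|A k|)%N.
  apply/existsP; apply: contraLR HL; rewrite negb_exists => /forallP H.
  have T0 : (0 < #|T|)%N by apply/card_gt0P; exists (w 0%N).
  rewrite -ltnNge sumA -(ltn_pmul2l T0) mulnCA mulnA big_distrr /=.
  apply: (@leq_trans (\sum_(k : T) L)%N); last by rewrite sum_nat_const.
  rewrite (bigD1 (w 0%N)) //= [X in (_ < X)%N](bigD1 (w 0%N)) //= -addSn.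
  apply: leq_add; first by rewrite ltnNge; apply: H.
  by apply: leq_sum => k _; apply: ltnW; rewrite ltnNge; apply: H.
have Ak : (0 < #|A k|)%N by move: Hk; case: #|A k| => //; rewrite muln0 leqNgt L0.
have [i0 Ai0] := card_gt0P Ak.
pose r := [arg min_(i < i0 in A k) (i : nat)].
pose t := [arg max_(i > i0 in A k) (i : nat)].
have [Ar Hr] : r \in A k /\ forall i, i \in A k -> (r <= i)%N.
  by rewrite /r; case: arg_minnP.
have [At Ht] : t \in A k /\ forall i, i \in A k -> (i <= t)%N.
  by rewrite /t; case: arg_maxnP.
exists r, t; move: (Ar) (At); rewrite !inE => /andP [gr /eqP wr] /andP [gt /eqP wt].
split; first by split=> //; [exact: Hr|rewrite wr wt].
apply: leq_trans Hk _; rewrite leq_mul2l; apply/orP; right.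
by apply: card_set_span => i Ai; rewrite Hr // Ht.
Qed.

(** * Good loops inside a typical word *)

Section Slice.
Context {T : eqType}.
Implicit Type W : seq T.

Definition slice (i j : nat) W := take (j - i) (drop i W).

Lemma slice_cat i j k W : (i <= j)%N -> (j <= k)%N ->
  slice i k W = slice i j W ++ slice j k W.
Proof.
move=> ij jk; rewrite /slice.
have -> : (k - i = (j - i) + (k - j))%N by rewrite addnC addnBA // subnK.
by rewrite takeD drop_drop subnK.
Qed.

Lemma size_slice i j W : (j <= size W)%N -> size (slice i j W) = (j - i)%N.
Proof.
by move=> jW; rewrite /slice size_takel // size_drop leq_sub2r.
Qed.

Lemma slice_all W : slice 0 (size W) W = W.
Proof. by rewrite /slice drop0 subn0 take_size. Qed.

Lemma slice1 x0 i W : (i < size W)%N -> slice i i.+1 W = [:: nth x0 W i].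
Proof. by move=> iW; rewrite /slice subSnn (drop_nth x0) //= take0. Qed.

End Slice.

Lemma subn_reflect L s t : (s <= t)%N -> (t <= L)%N -> (L - s - (L - t) = t - s)%N.
Proof. by move=> *; lia. Qed.

Lemma ltn_reflect i j t : (i < j)%N -> (j <= t)%N -> (t - j < t - i)%N.
Proof. by move=> *; lia. Qed.

(** [f] is the weight of a word, [N] the two minor norms, [G] the gap terms and
    [ng] marks the letters without a gap.  The constant [ka] converts a loss of
    multiplicativity of [f] into one of [N]. *)
Section WordSelection.
Context {R : realType} {T : finType}.
Variables (f : seq T -> R) (N G : bool -> seq T -> R) (ng : pred T).
Variables (C h ka : R).
Hypothesis C1 : 1 <= C.
Hypothesis h0 : 0 < h.
Hypothesis ka0 : 0 < ka.
Hypothesis Ch : 4 * C ^+ 2 <= expR h.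
Hypothesis f_ge0 : forall w, 0 <= f w.
Hypothesis f_sub : forall u v, f (u ++ v) <= f u * f v.
Hypothesis N_gt0 : forall i w, 0 < f w -> 0 < N i w.
Hypothesis G_ge0 : forall i w, 0 <= G i w.
Hypothesis G_sub : forall i u v, G i (u ++ v) <= G i u * G i v.
Hypothesis N_def : forall i u v, 0 < f (u ++ v) ->
  N i u * N i v <= expR (ka * (ln (f u) + ln (f v) - ln (f (u ++ v)))) * N i (u ++ v).
Hypothesis N_gap : forall i u v w,
  N i (u ++ v) * N i (v ++ w) <=
  C * (N i (u ++ v ++ w) * N i v + N i u * N i w * G i v).
Hypothesis G_gap : forall i a, 0 < f [:: a] -> ~~ ng a ->
  G i [:: a] <= expR (- (32 * h)) * N i [:: a] ^+ 2.
Hypothesis G_letter : forall i a, 0 < f [:: a] ->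
  G i [:: a] <= expR (32 * h) * N i [:: a] ^+ 2.

Lemma f_gt0_catl u v : 0 < f (u ++ v) -> 0 < f u.
Proof.
move=> fuv; rewrite lt_def f_ge0 andbT; apply: contraTneq fuv => E.
by rewrite -leNgt; apply: le_trans (f_sub _ _) _; rewrite E mul0r.
Qed.

Lemma f_gt0_catr u v : 0 < f (u ++ v) -> 0 < f v.
Proof.
move=> fuv; rewrite lt_def f_ge0 andbT; apply: contraTneq fuv => E.
by rewrite -leNgt; apply: le_trans (f_sub _ _) _; rewrite E mulr0.
Qed.

Definition letter_sum w := \sum_(a <- w) ln (f [:: a]).
Definition defect w := letter_sum w - ln (f w).
(** The coefficients make both losses visible in one superadditive quantity:
    [2 * ka * defect] bounds the logarithm of the squared loss of [N] over the letters, and a letter without a gap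
    spends [64 h], the difference between its own gap bound [32 h] and the gain
    [- 32 h] of an ordinary letter. *)
Definition weight w := 2 * ka * defect w + 64 * h * (count ng w)%:R.

Lemma letter_sum_cat u v : letter_sum (u ++ v) = letter_sum u + letter_sum v.
Proof. by rewrite /letter_sum big_cat. Qed.

Lemma ln_f_cat u v : 0 < f (u ++ v) -> ln (f (u ++ v)) <= ln (f u) + ln (f v).
Proof.
move=> fuv; have fu := f_gt0_catl fuv; have fv := f_gt0_catr fuv.
by rewrite -lnM ?posrE // ler_ln ?posrE ?mulr_gt0.
Qed.

(** [ln f] is subadditive while the sum over letters is additive. *)
Lemma weight_super u v : 0 < f (u ++ v) -> weight u + weight v <= weight (u ++ v).
Proof.
move=> fuv; rewrite /weight /defect letter_sum_cat count_cat natrD.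
have := ln_f_cat fuv; set x := ln _; set y := ln _; set z := ln _ => H.
have : 0 <= ka * (y + z - x) by rewrite mulr_ge0 ?(ltW ka0) // subr_ge0.
set s := letter_sum u; set t := letter_sum v; set p := _%:R; set q := _%:R.
nra.
Qed.

Lemma defect_ge0 w : w != [::] -> 0 < f w -> 0 <= defect w.
Proof.
elim: w => [//|a w IH] _ fw.
have [->|w0] := eqVneq w [::].
  by rewrite /defect /letter_sum big_seq1 subrr.
have fa := @f_gt0_catl [:: a] w fw; have fw' := @f_gt0_catr [:: a] w fw.
have := IH w0 fw'; have := @ln_f_cat [:: a] w fw.
rewrite /defect -(cat1s a w) letter_sum_cat {2}/letter_sum big_seq1 /=; lra.
Qed.

Lemma weight_ge0 w : w != [::] -> 0 < f w -> 0 <= weight w.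
Proof.
move=> w0 fw; rewrite /weight addr_ge0 // mulr_ge0 ?ler0n //.
- by rewrite mulr_ge0 // ltW.
- exact: defect_ge0.
- by rewrite mulr_ge0 // ltW.
Qed.

Lemma prod_letters_le i w : w != [::] -> 0 < f w ->
  \prod_(a <- w) N i [:: a] <= expR (ka * defect w) * N i w.
Proof.
elim: w => [//|a w IH] _ fw.
have [->|w0] := eqVneq w [::].
  by rewrite /defect /letter_sum !big_seq1 subrr mulr0 expR0 mul1r.
have fa := @f_gt0_catl [:: a] w fw; have fw' := @f_gt0_catr [:: a] w fw.
rewrite big_cons; apply: (@le_trans _ _ (N i [:: a] * (expR (ka * defect w) * N i w))).
  by apply: ler_wpM2l; [apply/ltW/N_gt0|apply: IH].
rewrite mulrCA.
apply: (@le_trans _ _ (expR (ka * defect w) *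
  (expR (ka * (ln (f [:: a]) + ln (f w) - ln (f (a :: w)))) * N i (a :: w)))).
  by apply: ler_wpM2l; [exact: expR_ge0|exact: (@N_def i [:: a] w)].
rewrite mulrA -expRD -mulrDr; apply: ler_wpM2r; first exact/ltW/N_gt0.
rewrite ler_expR; apply: ler_wpM2l; first exact: ltW.
by rewrite /defect -(cat1s a w) letter_sum_cat {2}/letter_sum big_seq1 /=; lra.
Qed.

(** Multiply the gap bounds of the letters; the squared product of their norms is
    recovered from [N w] at the price of the defect. *)
Lemma gap_le_weight i w : w != [::] -> 0 < f w ->
  G i w <= expR (weight w - 32 * h * (size w)%:R) * N i w ^+ 2.
Proof.
move=> w0 fw.
have Gp : G i w <= \prod_(a <- w) G i [:: a].
  elim: w w0 {fw} => [//|a w IH] _; rewrite big_cons.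
  have [->|w0] := eqVneq w [::]; first by rewrite big_nil mulr1.
  by apply: le_trans (@G_sub i [:: a] w) _; apply: ler_wpM2l => //; apply: IH.
have Np : \prod_(a <- w) G i [:: a] <=
   expR (64 * h * (count ng w)%:R - 32 * h * (size w)%:R) * (\prod_(a <- w) N i [:: a]) ^+ 2.
  elim: w fw {w0 Gp} => [|a w IH] fw.
    by rewrite !big_nil !mulr0 subrr expR0 mul1r expr1n.
  have fa := @f_gt0_catl [:: a] w fw; have fw' := @f_gt0_catr [:: a] w fw.
  rewrite !big_cons /= exprMn.
  have ga : G i [:: a] <= expR (64 * h * (ng a)%:R - 32 * h) * N i [:: a] ^+ 2.
    have [nga|nga] := boolP (ng a).
      by have -> : 64 * h * true%:R - 32 * h = 32 * h; [rewrite (_ : true%:R = 1) //; ring|apply: G_letter].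
    by have -> : 64 * h * false%:R - 32 * h = - (32 * h); [rewrite (_ : false%:R = 0) //; ring|apply: G_gap].
  apply: le_trans (ler_pM _ _ ga (IH fw')) _ => //; first exact: prodr_ge0.
  rewrite mulrACA -expRD le_eqVlt; apply/orP; left; apply/eqP; congr (expR _ * _).
  by rewrite natrD -(natr1 (size w)); ring.
apply: le_trans Gp _; apply: le_trans Np _.
have Nw := prod_letters_le i w0 fw.
apply: (@le_trans _ _ (expR (64 * h * (count ng w)%:R - 32 * h * (size w)%:R) *
   (expR (ka * defect w) * N i w) ^+ 2)).
  apply: ler_wpM2l; first exact: expR_ge0.
  rewrite lerXn2r ?nnegrE //.
    rewrite big_seq; apply: prodr_ge0 => a aw; apply/ltW/N_gt0.
    move: fw; case/splitPr: aw => u v; rewrite -(cat1s a v).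
    by move=> /f_gt0_catr /f_gt0_catl.
  by rewrite mulr_ge0 ?expR_ge0 // ltW // N_gt0.
rewrite exprMn mulrA expr2 -!expRD /weight le_eqVlt; apply/orP; left; apply/eqP.
congr (expR _ * _); ring.
Qed.

(** What survives a perturbation and suffices to concatenate: controlled
    junctions of [k] and [z] in both orders, and a small gap term for both. *)
Definition good_loop (A D : R) (k : T) (z : seq T) := forall i,
  [/\ N i [:: k] * N i z <= A * N i (k :: z), N i z * N i [:: k] <= A * N i (rcons z k),
      G i [:: k] <= D * N i [:: k] ^+ 2 & G i z <= D * N i z ^+ 2].

(** By the rising sun lemma, applied forwards and backwards, at least half of
    the positions start and end only intervals of weight at most [h] per
    letter.  A letter recurs at two of them, [r] and [t]; the avalanche from [r]
    to the right controls the junction of [k] with [z], the avalanche from [t] to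
    the left that of [z] with [k]. *)
Lemma word_selection W : 0 < f W ->
  (0 < size W)%N -> (4 * #|T| < size W)%N ->
  weight W <= h / 4 * (size W)%:R ->
  exists U k z V, [/\ W = U ++ k :: z ++ k :: V, z != [::],
    (size W <= 2 * #|T| * (size z + 2))%N &
    good_loop (2 * C * expR (8 * h)) (expR (- (30 * h))) k z].
Proof.
move=> fW L0 bigL HW; set L := size W in L0 bigL HW *.
have x0 : T by move: L0; rewrite /L; case: (W) => // a.
pose sl i j := slice i j W.
have slE i j k : (i <= j)%N -> (j <= k)%N -> sl i k = sl i j ++ sl j k by exact: slice_cat.
have sl_size i j : (j <= L)%N -> size (sl i j) = (j - i)%N by exact: size_slice.
have slW : sl 0 L = W by exact: slice_all.
have fsl i j : (i <= j)%N -> (j <= L)%N -> 0 < f (sl i j).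
  move=> ij jL; have := fW; rewrite -slW (slE 0 i L) ?(leq_trans ij) //.
  by move=> /f_gt0_catr; rewrite (slE i j L) // => /f_gt0_catl.
have sl0 i j : (i < j)%N -> (j <= L)%N -> sl i j != [::].
  by move=> ij jL; rewrite -size_eq0 sl_size // -lt0n subn_gt0.
have sl1 i : (i < L)%N -> sl i i.+1 = [:: nth x0 W i] by exact: slice1.
clearbody sl.
pose Hw (i j : nat) : R := if (i < j <= L)%N then weight (sl i j) else 0.
have HwE i j : (i < j)%N -> (j <= L)%N -> Hw i j = weight (sl i j).
  by move=> ij jL; rewrite /Hw ij jL.
have Hw0 i j : 0 <= Hw i j.
  rewrite /Hw; case: ifP => // /andP [ij jL].
  by apply: weight_ge0; [exact: sl0|apply: fsl => //; apply: ltnW].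
have Hws i j k : (i <= j)%N -> (j <= k)%N -> (k <= L)%N -> Hw i j + Hw j k <= Hw i k.
  move=> ij jk kL; rewrite leq_eqVlt in ij; case/orP: ij => [/eqP<-|ij].
    by rewrite {1}/Hw ltnn add0r.
  rewrite leq_eqVlt in jk; case/orP: jk => [/eqP<-|jk].
    by rewrite {2}/Hw ltnn addr0.
  have jL : (j <= L)%N by apply: leq_trans kL; apply: ltnW.
  have ik : (i < k)%N by apply: ltn_trans jk.
  rewrite (HwE i j ij jL) (HwE j k jk kL) (HwE i k ik kL) (slE i j k (ltnW ij) (ltnW jk)).
  apply: weight_super; rewrite -(slE i j k (ltnW ij) (ltnW jk)).
  exact: (fsl i k (ltnW ik) kL).
clearbody Hw.
have Hwm i i' j : (i <= i')%N -> (i' <= j)%N -> (j <= L)%N -> Hw i' j <= Hw i j.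
  by move=> a b c; apply: le_trans (Hws i i' j a b c); rewrite lerDr.
pose Hb (i j : nat) : R := Hw (L - j)%N (L - i)%N.
have Hbs i j k : (i <= j)%N -> (j <= k)%N -> (k <= L)%N -> Hb i j + Hb j k <= Hb i k.
  by move=> ij jk kL; rewrite addrC; apply: Hws; rewrite ?leq_sub2l ?leq_subr.
have HL : Hw 0 L <= h / 4 * L%:R by rewrite HwE // slW.
pose bf j := heavy_start Hw h L j.
pose bb j := heavy_start Hb h L (L - j.+1).
have quarter (c : nat) : h * c%:R <= h / 4 * L%:R -> (4 * c <= L)%N.
  rewrite -mulrA ler_pM2l // => H; rewrite -(ler_nat R) natrM -ler_pdivlMl //.
have cf : (4 * \sum_(j < L) bf j <= L)%N.
  by apply: quarter; apply: le_trans HL; exact: (rising_sun (ltW h0) Hw0 Hws).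
have cb : (4 * \sum_(j < L) bb j <= L)%N.
  apply: quarter; apply: le_trans HL.
  have -> : (\sum_(j < L) bb j = \sum_(j < L) heavy_start Hb h L j)%N.
    by rewrite [RHS](reindex_inj rev_ord_inj).
  have Hb0 i j : 0 <= Hb i j by exact: Hw0.
  have HbL : Hb 0%N L = Hw 0%N L by rewrite /Hb subnn subn0.
  by rewrite -HbL; exact: (rising_sun (ltW h0) Hb0 Hbs).
pose good j := ~~ bf j && ~~ bb j.
have cg : (L <= 2 * \sum_(j < L) good j)%N.
  have : (L <= \sum_(j < L) good j + \sum_(j < L) bf j + \sum_(j < L) bb j)%N.
    rewrite -!big_split -[X in (X <= _)%N]muln1 -[X in (X * _ <= _)%N]card_ord -sum_nat_const.
    by apply: leq_sum => j _; rewrite /good; case: (bf j); case: (bb j).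
  move: cf cb; set x := (\sum_(j < L) bf j)%N; set y := (\sum_(j < L) bb j)%N.
  set w := (\sum_(j < L) good j)%N; clearbody x y w L; clear; lia.
have [r [t [[rt tL gr gt wrt] Lrt]]] := @recurrent_letter T (nth x0 W) good L L0 cg.
have rt1 : (r.+1 < t)%N.
  rewrite ltnNge; apply: contraL bigL => tr; rewrite -leqNgt.
  apply: leq_trans Lrt _; rewrite -[4%N]/(2 * 2)%N [(2 * 2 * _)%N]mulnAC leq_mul2l ltnS leq_subLR addn1 tr.
  by rewrite orbT.
have {gr}[gr _] := andP gr; have {gt}[_ gt] := andP gt.
have fwd e : (r < e)%N -> (e <= L)%N -> Hw r e <= h * (e - r)%:R.
  move=> re eL; rewrite leNgt; apply: contra gr => H.
  by apply/existsP; exists (Ordinal (eL : (e < L.+1)%N)); rewrite re.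
have bwd s : (s < t.+1)%N -> Hw s t.+1 <= h * (t.+1 - s)%:R.
  move=> st; rewrite leNgt; apply: contra gt => H.
  have sL : (s <= L)%N by apply: leq_trans tL; rewrite -ltnS; apply: leq_trans st _.
  apply/existsP; exists (inord (L - s)); rewrite inordK ?ltnS ?leq_subr //.
  rewrite ltn_sub2l //=; last exact: leq_trans st tL.
  by rewrite (subn_reflect (ltnW st) tL) /Hb !subKn.
pose k := nth x0 W r.
have rL : (r < L)%N by apply: leq_ltn_trans tL.
have kr : sl r r.+1 = [:: k] by exact: sl1.
have kt : sl t t.+1 = [:: k] by rewrite /k wrt; exact: sl1.
pose z := sl r.+1 t.
have tL' : (t <= L)%N by exact: ltnW.
have sz : size z = (t - r.+1)%N := sl_size r.+1 t tL'.
have z0 : z != [::] := sl0 r.+1 t rt1 tL'.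
have r1L : (r.+1 <= L)%N := rL.
exists (sl 0%N r), k, z, (sl t.+1 L); split => //.
- rewrite -[LHS]slW (slE 0%N r L (leq0n r) (ltnW rL)) (slE r r.+1 L (leqnSn r) rL) kr.
  by rewrite (slE r.+1 t L (ltnW rt1) tL') (slE t t.+1 L (leqnSn t) tL) kt.
- by rewrite sz addn2 (subnSK (ltnW rt1)).
have A0 : 0 <= 2 * C * expR (8 * h) by rewrite !mulr_ge0 ?expR_ge0 // (le_trans _ C1).
have trn : (r + (t - r) = t)%N by rewrite subnKC.
have ka_def u v : 0 < f (u ++ v) -> u != [::] -> v != [::] ->
    ka * (ln (f u) + ln (f v) - ln (f (u ++ v))) <= weight (u ++ v).
  move=> fuv u0 v0; have := ln_f_cat fuv.
  have := defect_ge0 u0 (f_gt0_catl fuv); have := defect_ge0 v0 (f_gt0_catr fuv).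
  rewrite /weight /defect letter_sum_cat.
  have : 0 <= 64 * h * (count ng (u ++ v))%:R by rewrite !mulr_ge0 // ltW.
  set a := ln _; set b := ln _; set c := ln _; set d := letter_sum u; set e := letter_sum v.
  set q := 64 * _ * _ => q0 ev du cab.
  have e1 : 0 <= ka * (d + e - c - (a + b - c)) by rewrite mulr_ge0 // ?(ltW ka0) //; lra.
  have e2 : 0 <= ka * (a + b - c) by rewrite mulr_ge0 // ?(ltW ka0) //; lra.
  nra.
have fwd' i j : (i < j)%N -> (j <= t - r)%N -> weight (sl (r + i)%N (r + j)%N) <= h * j%:R.
  move=> ij jt; have rjL : (r + j <= L)%N.
    by apply: leq_trans tL'; rewrite -trn leq_add2l.
  rewrite -HwE ?ltn_add2l //.
  apply: le_trans (Hwm r (r + i)%N (r + j)%N (leq_addr _ _) _ rjL) _; first by rewrite leq_add2l ltnW.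
  have := fwd (r + j)%N; rewrite addKn; apply => //.
  by rewrite -{1}[r]addn0 ltn_add2l (leq_ltn_trans _ ij).
pose m := (t - r)%N.
have m1 : (1 < m)%N by rewrite /m ltn_subRL addn1.
have tm j : (j <= m)%N -> (j <= t.+1)%N.
  by move=> jm; apply: leq_trans jm _; apply: leq_trans (leq_subr _ _) _.
have ta i j : (i < j)%N -> (j <= m)%N -> (t.+1 - j < t.+1 - i)%N.
  by move=> ij jm; apply: ltn_reflect => //; exact: tm.
have t1L i : (t.+1 - i <= L)%N by apply: leq_trans (leq_subr _ _) tL.
have bwd' i j : (i < j)%N -> (j <= m)%N ->
    weight (sl (t.+1 - j)%N (t.+1 - i)%N) <= h * j%:R.
  move=> ij jm; rewrite -HwE ?ta //.
  apply: (@le_trans _ _ (Hw (t.+1 - j)%N t.+1)).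
    by apply: le_trans (Hws _ (t.+1 - i)%N _ _ _ tL); rewrite ?lerDl ?leq_subr // ltnW // ta.
  have B := bwd (t.+1 - j)%N; rewrite (subKn (tm _ jm)) in B; apply: B.
  by apply: leq_trans (ta 0%N j _ jm) _; rewrite ?subn0 // (leq_trans _ ij).
have szl i j : (j <= L)%N -> size (sl i j) = (j - i)%N := sl_size i j.
move=> i; split.
- (* distances are measured from r to the right *)
  have jL a : (a <= m)%N -> (r + a <= L)%N.
    by move=> am; apply: leq_trans tL'; rewrite -trn leq_add2l.
  have cat3 a b c : (a <= b)%N -> (b <= c)%N -> sl (r + a)%N (r + c)%N = sl (r + a)%N (r + b)%N ++ sl (r + b)%N (r + c)%N.
    by move=> ab bc; apply: slE; rewrite leq_add2l.
  have fp a b : (a <= b)%N -> (b <= m)%N -> 0 < f (sl (r + a)%N (r + b)%N).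
    by move=> ab bm; apply: fsl; [rewrite leq_add2l|exact: jL].
  have ne a b : (a < b)%N -> (b <= m)%N -> sl (r + a)%N (r + b)%N != [::].
    by move=> ab bm; apply: sl0; [rewrite ltn_add2l|exact: jL].
  have := @chain_first_junction R (fun a b => N i (sl (r + a)%N (r + b)%N))
    (fun a b => G i (sl (r + a)%N (r + b)%N)) C h m C1 (ltW h0) Ch.
  have -> : k :: z = sl (r + 0)%N (r + m)%N.
    by rewrite addn0 trn (slE r r.+1 t (leqnSn r) (ltnW rt1)) kr.
  have -> : [:: k] = sl (r + 0)%N (r + 1)%N by rewrite addn0 addn1 kr.
  have -> : z = sl (r + 1)%N (r + m)%N by rewrite addn1 trn.
  apply => //.
  + by move=> a b ab bm; apply: N_gt0; apply: fp => //; apply: ltnW.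
  + move=> a b c e ab bc ce em.
    have bE : (b <= e)%N by apply: ltnW; apply: ltn_trans ce.
    rewrite (cat3 a b c (ltnW ab) (ltnW bc)) (cat3 b c e (ltnW bc) (ltnW ce)).
    rewrite (cat3 a b e (ltnW ab) bE) (cat3 b c e (ltnW bc) (ltnW ce)).
    exact: N_gap.
  + move=> a b c ab bc cm.
    have ac := ltn_trans ab bc; have bm := ltnW (leq_trans bc cm).
    have fpc := fp _ _ (ltnW ac) cm.
    rewrite (cat3 a b c (ltnW ab) (ltnW bc)) in fpc *.
    apply: le_trans (N_def i fpc) _; apply: ler_wpM2r; first exact/ltW/N_gt0.
    rewrite ler_expR; apply: le_trans (ka_def _ _ fpc _ _) _; [exact: ne|exact: ne|].
    by rewrite -(cat3 a b c (ltnW ab) (ltnW bc)); apply: fwd'.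
  + move=> a b ab bm; apply: le_trans (gap_le_weight i (ne _ _ ab bm) (fp _ _ (ltnW ab) bm)) _.
    apply: ler_wpM2r; first by rewrite exprn_ge0 // ltW // N_gt0 // fp // ltnW.
    by rewrite ler_expR szl ?jL // subnDl lerD2r; apply: fwd'.
- (* distances are measured from the end of the letter at t to the left *)
  have cat3 a b c : (a <= b)%N -> (b <= c)%N ->
     sl (t.+1 - c)%N (t.+1 - a)%N = sl (t.+1 - c)%N (t.+1 - b)%N ++ sl (t.+1 - b)%N (t.+1 - a)%N.
    by move=> ab bc; apply: slE; apply: leq_sub2l.
  have fp a b : (a <= b)%N -> (b <= m)%N -> 0 < f (sl (t.+1 - b)%N (t.+1 - a)%N).
    by move=> ab bm; apply: fsl => //; apply: leq_sub2l.
  have ne a b : (a < b)%N -> (b <= m)%N -> sl (t.+1 - b)%N (t.+1 - a)%N != [::].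
    by move=> ab bm; apply: sl0 => //; exact: ta.
  have tm1 : (t.+1 - m = r.+1)%N by rewrite /m subSn ?leq_subr // subKn.
  have CH := @chain_first_junction R (fun a b => N i (sl (t.+1 - b)%N (t.+1 - a)%N))
    (fun a b => G i (sl (t.+1 - b)%N (t.+1 - a)%N)) C h m C1 (ltW h0) Ch.
  have -> : rcons z k = sl (t.+1 - m)%N (t.+1 - 0)%N.
    by rewrite subn0 tm1 (slE r.+1 t t.+1 (ltnW rt1) (leqnSn t)) kt cats1.
  have -> : [:: k] = sl (t.+1 - 1)%N (t.+1 - 0)%N by rewrite subn0 subn1 kt.
  have -> : z = sl (t.+1 - m)%N (t.+1 - 1)%N by rewrite subn1 tm1.
  rewrite [X in X <= _]mulrC; apply: CH => //.
  + by move=> a b ab bm; apply: N_gt0; apply: fp => //; apply: ltnW.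
  + move=> a b c e ab bc ce em.
    have bE : (b <= e)%N by apply: ltnW; apply: ltn_trans ce.
    have aC : (a <= c)%N by apply: ltnW; apply: ltn_trans bc.
    have := N_gap i (sl (t.+1 - e)%N (t.+1 - c)%N) (sl (t.+1 - c)%N (t.+1 - b)%N) (sl (t.+1 - b)%N (t.+1 - a)%N).
    rewrite -(cat3 a b c (ltnW ab) (ltnW bc)) -(cat3 b c e (ltnW bc) (ltnW ce)).
    rewrite -(cat3 a c e aC (ltnW ce)) [X in X <= _]mulrC.
    by rewrite [N i (sl (t.+1 - e) (t.+1 - c))%N * _]mulrC.
  + move=> a b c ab bc cm.
    have ac := ltn_trans ab bc; have bm := ltnW (leq_trans bc cm).
    have fpc := fp _ _ (ltnW ac) cm.
    rewrite (cat3 a b c (ltnW ab) (ltnW bc)) in fpc *; rewrite mulrC.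
    apply: le_trans (N_def i fpc) _; apply: ler_wpM2r; first exact/ltW/N_gt0.
    rewrite ler_expR; apply: le_trans (ka_def _ _ fpc _ _) _; [exact: ne|exact: ne|].
    by rewrite -(cat3 a b c (ltnW ab) (ltnW bc)); apply: bwd'.
  + move=> a b ab bm; apply: le_trans (gap_le_weight i (ne _ _ ab bm) (fp _ _ (ltnW ab) bm)) _.
    apply: ler_wpM2r; first by rewrite exprn_ge0 // ltW // N_gt0 // fp // ltnW.
    rewrite ler_expR szl ?t1L // subn_reflect ?tm // ?(ltnW ab) //.
    by rewrite lerD2r; apply: bwd'.
- have fk : 0 < f [:: k] by rewrite -kr; apply: fsl.
  apply: le_trans (gap_le_weight i _ fk) _ => //.
  apply: ler_wpM2r; first by rewrite exprn_ge0 // ltW // N_gt0.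
  rewrite ler_expR mulr1 -kr.
  have := fwd' 0%N 1%N isT (ltnW m1); rewrite addn0 addn1 mulr1.
  set w := weight _; move: h0; lra.
- have fz : 0 < f z by apply: fsl => //; apply: ltnW.
  apply: le_trans (gap_le_weight i z0 fz) _.
  apply: ler_wpM2r; first by rewrite exprn_ge0 // ltW // N_gt0.
  rewrite ler_expR sz.
  have := fwd' 1%N m m1 (leqnn m); rewrite addn1 trn -/z.
  have -> : (t - r.+1 = m.-1)%N by rewrite /m subnS.
  rewrite -[in h * m%:R](prednK (ltnW m1)) -natr1.
  have m11 : 1 <= m.-1%:R :> R by rewrite ler1n -ltnS prednK // ltnW.
  have : h <= h * m.-1%:R by rewrite ler_peMr // ltW.
  set w := weight _; set q := m.-1%:R; nra.
Qed.

End WordSelection.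

(** * Loops that carry the whole growth *)

Lemma square_le_exp (R : realType) (c K : R) : 0 < c ->
  exists n0 : nat, forall n : nat, (n0 <= n)%N -> K * (n + 2)%:R ^+ 2 <= expR (c * n%:R).
Proof.
move=> c0.
pose c4 := c / 4.
have c40 : 0 < c4 by rewrite divr_gt0.
(* (c n / 4)^4 <= exp (c n), and n^4 dominates K (n + 2)^2 *)
pose K' := Num.max K 1.
have K'1 : 1 <= K' by rewrite le_max lexx orbT.
exists (Num.truncn (9 * K' / c4 ^+ 4)).+2 => n hn.
have nlow : 9 * K' / c4 ^+ 4 <= n%:R.
  apply: ltW; apply: lt_le_trans (truncnS_gt _) _; rewrite ler_nat; exact: ltnW.
have n1 : 1 <= n%:R :> R by rewrite ler1n; apply: leq_trans hn.
have KK : K <= K' by rewrite le_max lexx.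
apply: (@le_trans _ _ ((c4 * n%:R) ^+ 4)); last first.
  have -> : c * n%:R = 4%:R * (c4 * n%:R) by rewrite /c4; field.
  have A : 0 <= c4 * n%:R by rewrite mulr_ge0 // ltW.
  have B : c4 * n%:R <= expR (c4 * n%:R).
    by apply: le_trans (expR_ge1Dx _); rewrite lerDr.
  by rewrite expRM_natl lerXn2r // nnegrE expR_ge0.
rewrite exprMn natrD.
move: nlow; rewrite ler_pdivrMr ?exprn_gt0 // => nlow.
have : 9 * K' * n%:R ^+ 3 <= c4 ^+ 4 * n%:R ^+ 4.
  have -> : c4 ^+ 4 * n%:R ^+ 4 = n%:R * c4 ^+ 4 * n%:R ^+ 3 by ring.
  by apply: ler_wpM2r => //; rewrite exprn_ge0.
move=> H; apply: le_trans H.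
apply: (@le_trans _ _ (K' * (n%:R + 2) ^+ 2)).
  by apply: ler_wpM2r => //; rewrite exprn_ge0 // addr_ge0.
rewrite [9 * K']mulrC -mulrA; apply: ler_wpM2l; first by apply: le_trans K'1.
set x := n%:R in n1 *; nra.
Qed.

Lemma add_two_letters r n m : (r + (n + m.+1).+1 = 2 + (r + n + m))%N.
Proof. lia. Qed.

(** [rho] is the growth rate of the total weight of the words of a given
    length.  The hypothesis [letter_mass] says that the letters without a gap
    are negligible even when each of them is multiplied by a large factor. *)
Section LoopExtraction.
Context {R : realType} {T : finType}.
Variables (f : seq T -> R) (N G : bool -> seq T -> R) (ng : pred T).
Variables (C h ka rho : R).
Hypothesis C1 : 1 <= C.
Hypothesis h0 : 0 < h.
Hypothesis ka0 : 0 < ka.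
Hypothesis Ch : 4 * C ^+ 2 <= expR h.
Hypothesis f_ge0 : forall w, 0 <= f w.
Hypothesis f_sub : forall u v, f (u ++ v) <= f u * f v.
Hypothesis N_gt0 : forall i w, 0 < f w -> 0 < N i w.
Hypothesis G_ge0 : forall i w, 0 <= G i w.
Hypothesis G_sub : forall i u v, G i (u ++ v) <= G i u * G i v.
Hypothesis N_def : forall i u v, 0 < f (u ++ v) ->
  N i u * N i v <= expR (ka * (ln (f u) + ln (f v) - ln (f (u ++ v)))) * N i (u ++ v).
Hypothesis N_gap : forall i u v w,
  N i (u ++ v) * N i (v ++ w) <=
  C * (N i (u ++ v ++ w) * N i v + N i u * N i w * G i v).
Hypothesis G_gap : forall i a, 0 < f [:: a] -> ~~ ng a ->
  G i [:: a] <= expR (- (32 * h)) * N i [:: a] ^+ 2.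
Hypothesis G_letter : forall i a, 0 < f [:: a] ->
  G i [:: a] <= expR (32 * h) * N i [:: a] ^+ 2.
Hypothesis rho0 : 0 < rho.
Hypothesis growth_low : forall L, rho ^+ L <= wsum L f.
Hypothesis growth_up : forall e, 0 < e -> exists2 K, 0 < K &
  forall n, wsum n f <= K * (rho * expR e) ^+ n.
Hypothesis letter_mass :
  \sum_a f [:: a] * expR (32 * h / ka * (ng a)%:R) <= rho / 2 * expR (h / (8 * ka)).

Local Notation weight := (weight f ng h ka).
Local Notation good := (good_loop N G (2 * C * expR (8 * h)) (expR (- (30 * h)))).

(** The factor [f W] cancels the logarithm of [f W] in the defect, which leaves a
    product over the letters. *)
Lemma weight_exp W : 0 < f W ->
  f W * expR (weight W / (2 * ka)) =
  \prod_(a <- W) (f [:: a] * expR (32 * h / ka * (ng a)%:R)).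
Proof.
move=> fW.
have -> : weight W / (2 * ka) = letter_sum f W - ln (f W) + 32 * h / ka * (count ng W)%:R.
  by rewrite /weight /defect; field; rewrite gt_eqF.
rewrite -{1}(lnK fW) -expRD.
have -> : ln (f W) + (letter_sum f W - ln (f W) + 32 * h / ka * (count ng W)%:R) =
  letter_sum f W + 32 * h / ka * (count ng W)%:R by ring.
elim: W fW => [|a W IH] fW.
  by rewrite /letter_sum !big_nil mulr0 addr0 expR0.
have fa := f_gt0_catl f_ge0 f_sub (fW : 0 < f ([:: a] ++ W)).
have fW' := f_gt0_catr f_ge0 f_sub (fW : 0 < f ([:: a] ++ W)).
rewrite big_cons -IH // /letter_sum big_cons /= natrD.
rewrite -{2}(lnK fa) -!expRD; congr expR; ring.
Qed.

Definition loop_ok k z := `[< good k z /\ 0 < f (k :: rcons z k) /\ z <> [::] >].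
Definition loop_sum k n := wsum n (fun z => if loop_ok k z then f z else 0).

(** Exponential Markov inequality: weighting each word by the exponential of its
    weight yields a product over letters, whose sum [letter_mass] bounds. *)
Lemma typical_mass L : (0 < L)%N ->
  2^-1 * rho ^+ L <= wsum L (fun W => if `[< 0 < f W /\ weight W <= h / 4 * L%:R >] then f W else 0).
Proof.
move=> L0.
have rL : 0 < rho ^+ L by rewrite exprn_gt0.
have atyp : wsum L (fun W => if `[< 0 < f W /\ weight W <= h / 4 * L%:R >] then 0 else f W)
    <= 2^-1 * rho ^+ L.
  apply: (@le_trans _ _ (wsum L (fun W => expR (- (h / (8 * ka) * L%:R)) *
      \prod_(a <- W) (f [:: a] * expR (32 * h / ka * (ng a)%:R))))).
    apply: ler_wsum => W WL; case: asboolP => H.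
      by rewrite mulr_ge0 ?expR_ge0 // prodr_ge0 // => a _; rewrite mulr_ge0 ?expR_ge0.
    have [fW|fW] := ltP 0 (f W); last first.
      apply: (@le_trans _ _ 0) => //.
      by rewrite mulr_ge0 ?expR_ge0 // prodr_ge0 // => a _; rewrite mulr_ge0 ?expR_ge0.
    rewrite -weight_exp // mulrCA -expRD ler_peMr //.
    rewrite -[leLHS]expR0 ler_expR addrC subr_ge0.
    have : h / 4 * L%:R < weight W by rewrite ltNge; apply/negP => ?; apply: H.
    move=> /ltW Hw; rewrite ler_pdivlMr ?mulr_gt0 //; apply: le_trans Hw.
    by rewrite le_eqVlt; apply/orP; left; apply/eqP; field; rewrite gt_eqF.
  rewrite wsumZ wsum_prod.
  apply: (@le_trans _ _ (expR (- (h / (8 * ka) * L%:R)) * (rho / 2 * expR (h / (8 * ka))) ^+ L)).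
    apply: ler_wpM2l; first exact: expR_ge0.
    rewrite lerXn2r ?nnegrE //; last by rewrite !mulr_ge0 ?expR_ge0 // ltW.
    by rewrite sumr_ge0 // => a _; rewrite mulr_ge0 ?expR_ge0.
  rewrite exprMn -expRM_natr mulrCA -expRD addNr expR0 mulr1 exprMn mulrC.
  apply: ler_wpM2r; first exact: ltW.
  by rewrite -[leRHS]expr1; apply: ler_wiXn2l; rewrite ?invr_ge0 // invf_le1 // ler1n.
have := growth_low L.
rewrite (@eq_wsum _ _ L f (fun W => (if `[< 0 < f W /\ weight W <= h / 4 * L%:R >] then f W else 0)
   + (if `[< 0 < f W /\ weight W <= h / 4 * L%:R >] then 0 else f W))); last first.
  by move=> W _; case: asboolP; rewrite ?addr0 ?add0r.
rewrite wsumD => H; move: atyp H; set x := wsum _ _; set y := wsum _ _; lra.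
Qed.

(** The product of the weights of the five factors [u], [k], [z], [k], [v] of a
    word, located by the position [r] of the first [k] and the length [n] of [z].
    The two occurrences of [k] are not tested, which costs a factor [#|T|] each
    in the sum over all words. *)
Definition loop_term r n k W :=
  f (take r W) * (f [:: k] * ((if loop_ok k (take n (drop r.+1 W))
    then f (take n (drop r.+1 W)) else 0) * (f [:: k] * f (drop (r + n.+2) W)))).

Lemma loop_term_ge0 r n k W : 0 <= loop_term r n k W.
Proof. by rewrite /loop_term !mulr_ge0 //; case: ifP. Qed.

Lemma wsum_loop_term r n m k :
  wsum (r + (n + m.+1).+1) (loop_term r n k) =
  wsum r f * (#|T|%:R * (f [:: k] * (loop_sum k n * (#|T|%:R * (f [:: k] * wsum m f))))).
Proof.
rewrite wsum_cat -wsumZr; apply: eq_wsum => u ur.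
have E a b z v : size z = n -> loop_term r n k (u ++ a :: z ++ b :: v) =
   f u * (f [:: k] * ((if loop_ok k z then f z else 0) * (f [:: k] * f v))).
  move=> zn; rewrite /loop_term take_size_cat //.
  have -> : drop r.+1 (u ++ a :: z ++ b :: v) = z ++ b :: v.
    by rewrite -cat_rcons drop_size_cat // size_rcons ur.
  have -> : drop (r + n.+2) (u ++ a :: z ++ b :: v) = v.
    by rewrite -cat_rcons -(cat_rcons b) catA drop_size_cat // size_cat !size_rcons ur zn addSnnS.
  by rewrite take_size_cat.
rewrite /=.
transitivity (\sum_(a : T) f u * (f [:: k] * (loop_sum k n * (#|T|%:R * (f [:: k] * wsum m f))))).
  apply: eq_bigr => a _; rewrite wsum_cat /loop_sum -wsumZr -!wsumZ.
  apply: eq_wsum => z zn /=.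
  under eq_bigr => b _ do (under eq_wsum => v _ do rewrite E //).
  rewrite sumr_const -mulr_natl !wsumZ; ring.
by rewrite sumr_const -mulr_natl; ring.
Qed.

Lemma typical_decomposition W : (4 * #|T| < size W)%N ->
  0 < f W -> weight W <= h / 4 * (size W)%:R ->
  exists r n m k, [/\ size W = (r + (n + m.+1).+1)%N,
    (size W <= 2 * #|T| * (n + 2))%N & f W <= loop_term r n k W].
Proof.
move=> L4 fW HW; have L0 : (0 < size W)%N by apply: leq_ltn_trans L4.
have [U [k [z [V [WE z0 Hz gz]]]]] := word_selection C1 h0 ka0 Ch f_ge0 f_sub N_gt0
  G_ge0 G_sub N_def N_gap G_gap G_letter fW L0 L4 HW.
exists (size U), (size z), (size V), k; split => //.
  by rewrite WE size_cat /= size_cat.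
have WE' : W = U ++ [:: k] ++ z ++ [:: k] ++ V by [].
have ok : loop_ok k z.
  apply/asboolP; split=> //; split; last by apply/eqP.
  have := fW; rewrite WE' => /(f_gt0_catr f_ge0 f_sub).
  by rewrite !catA => /(f_gt0_catl f_ge0 f_sub); rewrite -cats1.
rewrite /loop_term {2 3 4 5}WE take_size_cat //.
have -> : drop (size U).+1 (U ++ k :: z ++ k :: V) = z ++ k :: V.
  by rewrite -cat_rcons drop_size_cat // size_rcons.
have -> : drop (size U + (size z).+2) (U ++ k :: z ++ k :: V) = V.
  by rewrite -cat_rcons -(cat_rcons k) catA drop_size_cat // size_cat !size_rcons addSnnS.
rewrite take_size_cat // ok {1}WE'.
do 4!(apply: le_trans (f_sub _ _) _; apply: ler_wpM2l => //).
Qed.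

(** If for every letter the loops of every large length had mass below
    [(rho * expR (- eps)) ^+ n], then bounding each typical word by one of its
    decompositions [u k z k v], with [z] of length at least a fixed proportion of
    the whole, would make the typical mass smaller than [rho ^+ L / 2]. *)
Lemma loop_extraction (eps : R) (n1 : nat) : 0 < eps ->
  exists k n, [/\ (n1 <= n)%N, (0 < n)%N & (rho * expR (- eps)) ^+ n <= loop_sum k n].
Proof.
move=> eps0; pose J := #|T|.
have J0 : (0 < J)%N.
  rewrite lt0n; apply: contraTneq (growth_low 1) => J0; rewrite -ltNge expr1 /=.
  by rewrite big_pred0 // => a; have := card0_eq J0 a.
have JR : 1 <= J%:R :> R by rewrite ler1n.
have JR0 : 0 < J%:R :> R by rewrite ltr0n.
pose F1 := \sum_a f [:: a].
have fF1 k : f [:: k] <= F1 by rewrite /F1 (bigD1 k) //= lerDl sumr_ge0.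
have F10 : 0 < F1.
  by apply: lt_le_trans (growth_low 1 : rho ^+ 1 <= _); rewrite expr1.
pose e := eps / (4 * J%:R).
have e0 : 0 < e by rewrite divr_gt0 // mulr_gt0.
have [K K0 HK] := growth_up e0.
(* collects the constants in the bound of one term; 36 = 4 * 3 ^ 2 comes from
   the number of terms and from [L.+1 <= 3 * J * (n + 2)] *)
pose K1 := 36 * J%:R ^+ 5 * K ^+ 2 * F1 ^+ 2 * rho ^- 2 * expR eps.
have [n0 Hn0] := @square_le_exp R (eps / 2) K1 (divr_gt0 eps0 (ltr0n _ 2)).
pose ns := maxn n0 (maxn n1 1).
(* so long that the loop found in a typical word has length at least [ns] *)
pose L := (2 * J * (ns + 2) + 4 * J + 1)%N.
have L4 : (4 * J < L)%N by rewrite /L -addnA addn1 -addnS leq_addl.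
have nbig n : (L <= 2 * J * (n + 2))%N -> (ns <= n)%N.
  move=> H; rewrite leqNgt; apply/negP => ln.
  have H2 : (2 * J * (n + 2) <= 2 * J * (ns + 2))%N by rewrite leq_mul2l leq_add2r ltnW ?orbT.
  by have := leq_trans H H2; rewrite /L -addnA -[X in (_ <= X)%N]addn0 leq_add2l addn1.
apply: contrapT => Hno.
have Hls k n : (ns <= n)%N -> loop_sum k n <= (rho * expR (- eps)) ^+ n.
  move=> nn; rewrite leNgt; apply/negP => /ltW H; apply: Hno; exists k, n.
  move: nn; rewrite /ns !geq_max => /andP [_ /andP [a b]]; by split.
have Bd r n m k : L = (r + (n + m.+1).+1)%N -> (L <= 2 * J * (n + 2))%N ->
    4 * L.+1%:R ^+ 2 * J%:R * wsum L (loop_term r n k) <= rho ^+ L.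
  move=> LE Ln; have nsn := nbig _ Ln.
  have n0n : (n0 <= n)%N by apply: leq_trans nsn; rewrite leq_maxl.
  have ls0 : 0 <= loop_sum k n by apply: wsum_ge0 => z _; case: ifP.
  rewrite {2}LE wsum_loop_term -/J.
  have s1 := HK r; have s2 := HK m.
  have w1 : 0 <= wsum r f by apply: wsum_ge0.
  have w2 : 0 <= wsum m f by apply: wsum_ge0.
  have Lb : L.+1%:R <= 3 * J%:R * (n + 2)%:R :> R.
    rewrite -!natrM ler_nat; apply: (@leq_trans (2 * J * (n + 2) + 1 * J * (n + 2))%N).
      rewrite -addn1; apply: leq_add => //; rewrite mul1n muln_gt0 J0 addn2 //.
    by rewrite -!mulnDl.
  have rm : e * (r + m)%:R <= eps / 2 * (n + 2)%:R.
    apply: (@le_trans _ _ (e * (2 * J * (n + 2))%:R)).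
      rewrite ler_pM2l // ler_nat; apply: leq_trans Ln; rewrite LE leq_add2l.
      by apply: leq_trans (leq_addl n m) _; rewrite leqW // leq_add2l.
    by rewrite !natrM /e le_eqVlt; apply/orP; left; apply/eqP; field; rewrite gt_eqF.
  have key := Hn0 n n0n.

  set E := expR e in s1 s2; set q := expR (- eps) ^+ n.
  have q0 : 0 <= q by rewrite exprn_ge0 // expR_ge0.
  have fk0 := f_ge0 [:: k]; have fk1 := fF1 k.
  have ls1 : loop_sum k n <= rho ^+ n * q by rewrite -exprMn; apply: Hls.
  have XB : wsum r f * (J%:R * (f [:: k] * (loop_sum k n * (J%:R * (f [:: k] * wsum m f))))) <=
     (K * (rho * E) ^+ r) * (J%:R * (F1 * ((rho ^+ n * q) * (J%:R * (F1 * (K * (rho * E) ^+ m)))))).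
    apply: ler_pM => //; first by rewrite !mulr_ge0 // ltW.
    apply: ler_wpM2l; first exact: ltW.
    apply: ler_pM => //; first by rewrite !mulr_ge0 // ltW.
    apply: ler_pM => //; first by rewrite !mulr_ge0 // ltW.
    apply: ler_wpM2l; first exact: ltW.
    by apply: ler_pM.
  apply: (@le_trans _ _ (4 * (3 * J%:R * (n + 2)%:R) ^+ 2 * J%:R *
     ((K * (rho * E) ^+ r) * (J%:R * (F1 * ((rho ^+ n * q) * (J%:R * (F1 * (K * (rho * E) ^+ m))))))))).
    apply: ler_pM XB; rewrite ?mulr_ge0 //.
    apply: ler_wpM2r => //; apply: ler_wpM2l => //.
    by rewrite lerXn2r ?nnegrE // !mulr_ge0.
  have EE : E ^+ r * E ^+ m * q <= expR eps / expR (eps / 2 * n%:R).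
    rewrite -exprD /E /q -!expRM_natr -expRD -expRN -expRD ler_expR.
    have -> : eps - eps / 2 * n%:R = eps / 2 * (n + 2)%:R + - eps * n%:R.
      by rewrite natrD; field.
    by rewrite lerD2r.
  set y := expR (eps / 2 * n%:R) in key EE.
  have y0 : 0 < y by exact: expR_gt0.
  have -> : 4 * (3 * J%:R * (n + 2)%:R) ^+ 2 * J%:R *
     ((K * (rho * E) ^+ r) * (J%:R * (F1 * ((rho ^+ n * q) * (J%:R * (F1 * (K * (rho * E) ^+ m)))))))
   = (36 * J%:R ^+ 5 * K ^+ 2 * F1 ^+ 2 * (n + 2)%:R ^+ 2 * (rho ^+ r * rho ^+ n * rho ^+ m)) * (E ^+ r * E ^+ m * q).
    rewrite !exprMn; set a := J%:R; set b := rho ^+ r; set c := rho ^+ n; set d := rho ^+ m.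
    set a1 := E ^+ r; set a2 := E ^+ m; set a3 := (n + 2)%:R; ring.
  apply: (@le_trans _ _ ((36 * J%:R ^+ 5 * K ^+ 2 * F1 ^+ 2 * (n + 2)%:R ^+ 2 *
    (rho ^+ r * rho ^+ n * rho ^+ m)) * (expR eps / y))).
    by apply: ler_wpM2l => //; rewrite !mulr_ge0 ?exprn_ge0 // ltW.
  have -> : rho ^+ L = rho ^+ 2 * (rho ^+ r * rho ^+ n * rho ^+ m).
    by rewrite LE add_two_letters !exprD.
  have -> : 36 * J%:R ^+ 5 * K ^+ 2 * F1 ^+ 2 * (n + 2)%:R ^+ 2 *
    (rho ^+ r * rho ^+ n * rho ^+ m) * (expR eps / y) =
    (K1 * (n + 2)%:R ^+ 2 / y) * (rho ^+ 2 * (rho ^+ r * rho ^+ n * rho ^+ m)).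
    rewrite /K1; set a := J%:R; set b := rho ^+ r; set c := rho ^+ n; set d := rho ^+ m.
    set a1 := expR eps; set a2 := (n + 2)%:R; field; by rewrite !gt_eqF.
  rewrite ler_piMl //; first by rewrite !mulr_ge0 ?exprn_ge0 // ltW.
  by rewrite ler_pdivrMr // mul1r.
have L0 : (0 < L)%N by apply: leq_ltn_trans L4.
have := typical_mass L0; apply/negP; rewrite -ltNge.
pose cond (r n : 'I_L.+1) := `[< exists m, L = (r + (n + m.+1).+1)%N /\ (L <= 2 * J * (n + 2))%N >].
apply: (@le_lt_trans _ _ (wsum L (fun W => \sum_(p : 'I_L.+1 * 'I_L.+1 * T)
   if cond p.1.1 p.1.2 then loop_term p.1.1 p.1.2 p.2 W else 0))).
  apply: ler_wsum => W WL; case: asboolP => [[fW HW]|_]; last first.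
    by apply: sumr_ge0 => p _; case: ifP => // _; apply: loop_term_ge0.
  rewrite -WL in L4 HW.
  have [r [n [m [k [LE Ln Ht]]]]] := typical_decomposition L4 fW HW.
  rewrite WL in LE Ln.
  have rL : (r < L.+1)%N by rewrite ltnS LE leq_addr.
  have nL : (n < L.+1)%N.
    rewrite ltnS LE; apply: leq_trans (leq_addl r _).
    by apply: leq_trans (leq_addr m.+1 n) _.
  apply: le_trans Ht _; rewrite (bigD1 (Ordinal rL, Ordinal nL, k)) //=.
  have -> : cond (Ordinal rL) (Ordinal nL) by apply/asboolP; exists m.
  by rewrite lerDl; apply: sumr_ge0 => p _; case: ifP => // _; apply: loop_term_ge0.
rewrite wsum_exchange.
have B (p : 'I_L.+1 * 'I_L.+1 * T) :
   wsum L (fun W => if cond p.1.1 p.1.2 then loop_term p.1.1 p.1.2 p.2 W else 0) <=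
   rho ^+ L / (4 * L.+1%:R ^+ 2 * J%:R).
  case: p => [[r n] k] /=; rewrite /cond; case: asboolP => [[m [LE Ln]]|_].
    rewrite ler_pdivlMr ?mulr_gt0 ?exprn_gt0 // mulrC; exact: Bd LE Ln.
  rewrite (@eq_wsum _ _ L _ (fun W => 0 * f W)); last by move=> ? _; rewrite mul0r.
  by rewrite wsumZ mul0r divr_ge0 ?mulr_ge0 ?exprn_ge0 // ltW.
apply: (@le_lt_trans _ _ (\sum_(p : 'I_L.+1 * 'I_L.+1 * T) rho ^+ L / (4 * L.+1%:R ^+ 2 * J%:R))).
  by apply: ler_sum => p _; exact: B.
rewrite sumr_const !card_prod !card_ord -/J -[X in X < _]mulr_natl !natrM.
have rL0 : 0 < rho ^+ L by rewrite exprn_gt0.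
have -> : L.+1%:R * L.+1%:R * J%:R * (rho ^+ L / (4 * L.+1%:R ^+ 2 * J%:R)) = 4^-1 * rho ^+ L.
  by field; rewrite gt_eqF //= pnatr_eq0.
by rewrite ltr_pM2r // ltf_pV2 ?posrE // ltr_nat.
Qed.

End LoopExtraction.

(** * Growth rates of submultiplicative sequences *)

(** Real bounds on both sides characterise convergence also at an infinite
    limit, where one of the two conditions is void. *)
Lemma ereal_cvg_real_bounds (R : realType) (T : Type) (F : set_system T) {FF : Filter F}
    (f : T -> \bar R) (l : \bar R) :
  (forall q : R, (q%:E < l)%E -> \forall x \near F, (q%:E <= f x)%E) ->
  (forall q : R, (l < q%:E)%E -> \forall x \near F, (f x <= q%:E)%E) ->
  f x @[x --> F] --> l.
Proof.
move=> lo up A; case: l lo up => [r| |] lo up /=.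
- move=> [e /= e0 He]; have e20 : 0 < e / 2 by rewrite divr_gt0.
  have lo' := lo (r - e / 2); have up' := up (r + e / 2).
  rewrite lte_fin ltrBlDr ltrDl in lo'; rewrite lte_fin ltrDl in up'.
  apply: filterS2 (lo' e20) (up' e20) => x lx ux; change (A (f x)); move: lx ux; case: (f x) => [y| |] //.
  rewrite !lee_fin => h1 h2; apply: (He y) => /=.
  by rewrite ltr_distl; apply/andP; split; lra.
- move=> [M [Mr HM]]; apply: filterS (lo (M + 1) (ltry _)) => x Hx; apply: HM.
  by apply: lt_le_trans Hx; rewrite lte_fin ltrDl.
- move=> [M [Mr HM]]; apply: filterS (up (M - 1) (ltNyr _)) => x Hx; apply: HM.
  by apply: le_lt_trans Hx _; rewrite lte_fin ltrBlDr ltrDl.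
Qed.

Section GrowthRate.
Context {R : realType}.
Variables (a : nat -> R) (C : R).
Hypothesis a_ge0 : forall n, 0 <= a n.
Hypothesis C1 : 1 <= C.
Hypothesis a_sub : forall n m, a (n + m)%N <= C * (a n * a m).

Definition growth_le (q : R) := exists2 K, 0 < K & forall n, a n <= K * expR (q * n%:R).

Definition growth_rate : \bar R :=
  limn (fun n => ((n%:R^-1)%:E * lne (a n)%:E)%E).

Lemma growth_le_mono p q : p <= q -> growth_le p -> growth_le q.
Proof.
move=> pq [K K0 HK]; exists K => // n; apply: le_trans (HK n) _.
by rewrite ler_pM2l // ler_expR ler_wpM2r.
Qed.

(** If the lower bound fails at one [n0], submultiplicativity propagates the
    failure to all lengths. *)
Lemma growth_dichotomy q : growth_le q \/ forall n, (0 < n)%N -> expR (q * n%:R) <= C * a n.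
Proof.
have [[n0 [n00 Hn0]]|H] := pselect (exists n, (0 < n)%N /\ C * a n < expR (q * n%:R)); last first.
  by right=> n n0; rewrite leNgt; apply/negP => Hn; apply: H; exists n.
left; pose K := 1 + \sum_(i < n0) a i * expR (- (q * i%:R)).
have K0 : 0 < K by rewrite ltr_pwDl // sumr_ge0 // => i _; rewrite mulr_ge0 ?expR_ge0.
exists K => // n; elim/ltn_ind: n => n IH.
have [nn0|n0n] := ltnP n n0.
  rewrite -ler_pdivrMr ?expR_gt0 // -expRN /K (bigD1 (Ordinal nn0)) //= addrCA lerDl.
  by rewrite addr_ge0 // sumr_ge0 // => i _; rewrite mulr_ge0 ?expR_ge0.
rewrite -(subnKC n0n); apply: le_trans (a_sub _ _) _.
have := IH (n - n0)%N; rewrite -[X in (_ < X)%N]subn0 ltn_sub2l // => [/(_ isT) IHn|]; last exact: leq_trans n0n.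
rewrite mulrA natrD mulrDr expRD mulrCA; apply: ler_pM => //.
- by rewrite mulr_ge0 // (le_trans _ C1).
- exact: ltW.
Qed.

Lemma log_average_le n (x q : R) : (0 < n)%N -> 0 <= x -> x <= expR (q * n%:R) ->
  ((n%:R^-1)%:E * lne x%:E <= q%:E)%E.
Proof.
move=> n0 x0 xq; have nR : 0 < n%:R :> R by rewrite ltr0n.
have [->|xn] := eqVneq x 0.
  by rewrite le0_lneNy // gt0_muleNy ?lte_fin ?invr_gt0 // leNye.
have xgt : 0 < x by rewrite lt_def xn.
rewrite lne_EFin // -EFinM lee_fin mulrC ler_pdivrMr //.
by rewrite -(expRK (q * n%:R)) ler_ln ?posrE ?expR_gt0.
Qed.

Lemma log_average_ge n (x q : R) : (0 < n)%N -> expR (q * n%:R) <= x ->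
  (q%:E <= (n%:R^-1)%:E * lne x%:E)%E.
Proof.
move=> n0 xq; have nR : 0 < n%:R :> R by rewrite ltr0n.
have xgt : 0 < x by apply: lt_le_trans xq; exact: expR_gt0.
rewrite lne_EFin // -EFinM lee_fin mulrC ler_pdivlMr //.
by rewrite -(expRK (q * n%:R)) ler_ln ?posrE ?expR_gt0.
Qed.

Lemma near_absorb (c K : R) : 0 < c -> \forall n \near \oo, K <= expR (c * n%:R).
Proof.
move=> c0; near=> n; apply: le_trans (expR_ge1Dx _).
apply: (@le_trans _ _ (c * n%:R)); last by rewrite lerDr.
rewrite -ler_pdivrMl //; near: n; exact: nbhs_infty_ger.
Unshelve. all: end_near. Qed.

Let l : \bar R := ereal_inf [set q%:E | q in growth_le].

(** Fekete's lemma up to a multiplicative constant, with the limit written as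
    the infimum of the admissible exponential rates. *)
Lemma growth_cvg : (fun n => ((n%:R^-1)%:E * lne (a n)%:E)%E) @ \oo --> l.
Proof.
apply: ereal_cvg_real_bounds => q.
- move=> ql; have [p qp pl] : exists2 p, q < p & (p%:E < l)%E.
    case: (l) ql => [r| |] //; last by exists (q + 1); rewrite ?ltrDl ?ltry.
    by rewrite lte_fin => qr; exists ((q + r) / 2); rewrite ?lte_fin; lra.
  have [Hp|Hp] := growth_dichotomy p.
    by move: pl; rewrite ltNge ereal_inf_lbound //; exists p.
  have pq0 : 0 < p - q by rewrite subr_gt0.
  near=> n.
  have n0 : (0 < n)%N by near: n; exact: nbhs_infty_gt.
  apply: log_average_ge => //.
  have HC : C <= expR ((p - q) * n%:R) by near: n; exact: near_absorb.
  have C0 : 0 < C by apply: lt_le_trans C1.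
  have := Hp _ n0; rewrite -(ler_pM2l C0) => H; rewrite -(ler_pM2l C0).
  apply: (@le_trans _ _ (expR (p * n%:R))); last by rewrite -(ler_pM2l C0).
  have -> : p * n%:R = (p - q) * n%:R + q * n%:R by ring.
  by rewrite expRD ler_wpM2r ?expR_ge0.
- move=> lq; have /ereal_inf_lt [_ [p [K K0 HK] <-]] := lq.
  rewrite lte_fin => pq; have pq0 : 0 < q - p by rewrite subr_gt0.
  near=> n.
  have n0 : (0 < n)%N by near: n; exact: nbhs_infty_gt.
  apply: log_average_le => //; apply: le_trans (HK n) _.
  have -> : q * n%:R = (q - p) * n%:R + p * n%:R by ring.
  by rewrite expRD ler_wpM2r ?expR_ge0 //; near: n; exact: near_absorb.
Unshelve. all: end_near. Qed.

Lemma growth_rateE : growth_rate = l.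
Proof. exact/cvg_lim/growth_cvg. Qed.

Lemma growth_rate_le q : growth_le q -> (growth_rate <= q%:E)%E.
Proof. by move=> H; rewrite growth_rateE; apply: ereal_inf_lbound; exists q. Qed.

Lemma growth_rate_lt q : (growth_rate < q%:E)%E -> growth_le q.
Proof.
rewrite growth_rateE => /ereal_inf_lt [_ [p Hp <-]]; rewrite lte_fin => /ltW pq.
exact: growth_le_mono Hp.
Qed.

(** Along multiples of a fixed length a constant factor is harmless. *)
Lemma growth_rate_ge q n0 c : (0 < n0)%N -> 0 < c ->
  (forall M, (0 < M)%N -> c * expR (q * (M * n0)%:R) <= a (M * n0)%N) ->
  (q%:E <= growth_rate)%E.
Proof.
move=> n00 c0 H; rewrite leNgt; apply/negP => gq.
have [p Hp pq] : exists2 p, growth_le p & p < q.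
  move: gq; rewrite growth_rateE => /ereal_inf_lt [_ [p Hp <-]]; rewrite lte_fin => pq.
  by exists p.
have [K K0 HK] := Hp; have d0 : 0 < (q - p) * n0%:R by rewrite mulr_gt0 ?subr_gt0 ?ltr0n.
have := @near_absorb ((q - p) * n0%:R) (K / c + 1) d0.
case=> M0 _ HM; have := HM M0.+1 (leqnSn M0) => /=.
have := le_trans (H M0.+1 isT) (HK _).
set x := (M0.+1 * n0)%N.
have -> : q * x%:R = (q - p) * n0%:R * M0.+1%:R + p * x%:R by rewrite /x natrM; ring.
rewrite expRD mulrA ler_pM2r ?expR_gt0 // -ler_pdivlMl // => h1 h2.
by have := le_trans h2 h1; rewrite [c^-1 * _]mulrC gerDl ler10.
Qed.

End GrowthRate.

(** * Points of the subshift and their prefixes *)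

Local Notation coord := Defs.coord.
Local Notation shift := Defs.shift.

Section ShiftSpace.
Context {S : finType} {F : seq (seq S)}.
Local Notation X := (sft F).
Local Notation Pt := {ptws nat -> discrete_topology S}.

Definition pref (x : X) (n : nat) : seq S := mkseq (coord x) n.

Lemma size_pref x n : size (pref x n) = n.
Proof. by rewrite size_mkseq. Qed.

Lemma coord_iter_shift (x : X) i k : coord (iter i shift x) k = coord x (i + k).
Proof.
elim: i k => // i IH k.
by rewrite iterS -[LHS]/(coord (iter i shift x) k.+1) IH addnS addSn.
Qed.

Lemma pref_add x n m : pref x (n + m) = pref x n ++ pref (iter n shift x) m.
Proof.
rewrite /pref /mkseq iotaD map_cat add0n; congr cat.
rewrite -[in LHS](addn0 n) iotaDl -map_comp; apply: eq_map => i /=.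
by rewrite coord_iter_shift.
Qed.

Lemma pref_coord x y n i : pref x n = pref y n -> (i < n)%N -> coord x i = coord y i.
Proof. by move=> E ni; rewrite -(nth_mkseq (coord x 0) (coord x) ni) -/(pref _ _) E nth_mkseq. Qed.

Lemma eq_pref x y n : (forall i, (i < n)%N -> coord x i = coord y i) -> pref x n = pref y n.
Proof.
by move=> H; apply/eq_in_map => i; rewrite mem_iota add0n => /H.
Qed.

Lemma pref_sub x y n i m : pref x n = pref y n -> (i + m <= n)%N ->
  pref (iter i shift x) m = pref (iter i shift y) m.
Proof.
move=> E im; apply: eq_pref => k km; rewrite !coord_iter_shift.
by apply: pref_coord E _; apply: leq_trans im; rewrite ltn_add2l.
Qed.

Lemma nbhs_ptws_cyl (p : Pt) U : nbhs p U ->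
  exists k, forall q : Pt, (forall i, (i < k)%N -> q i = p i) -> U q.
Proof.
move=> pU; apply: contrapT => H.
have {H} /choice [q Hq] : forall k, exists q : Pt, (forall i, (i < k)%N -> q i = p i) /\ ~ U q.
  move=> k; apply: contrapT => H'; apply: H; exists k => q qp; apply: contrapT => Uq.
  by apply: H'; exists q.
have : {ptws, q @ \oo --> p}.
  apply/pointwise_cvgP => i; apply/discrete_cvg.
  by exists i.+1 => // n /= ni; apply: (Hq n).1.
move=> /(_ U pU) [n _ /(_ n (leqnn n))]; exact: (Hq n).2.
Qed.

Lemma cyl_nbhs_ptws (p : Pt) k : nbhs p [set q : Pt | forall i, (i < k)%N -> q i = p i].
Proof.
elim: k => [|k IH]; first exact: filterS filterT.
have pk : nbhs p [set q : Pt | q k = p k].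
  have := @proj_continuous _ (fun _ : nat => discrete_topology S) k p [set p k].
  by apply; exact: discrete_set1.
apply: filterS2 IH pk => q q1 q2 i; rewrite ltnS leq_eqVlt => /orP [/eqP->//|]; exact: q1.
Qed.

Lemma ptws_compact : compact [set: Pt].
Proof.
have := @tychonoff _ (fun _ : nat => discrete_topology S) (fun=> setT).
have -> : [set f : forall i : nat, discrete_topology S | forall i, [set: discrete_topology S] (f i)] = setT.
  by apply/seteqP; split.
by apply => _; apply: finite_compact; exact: finite_finset.
Qed.

(** Compactness of the full shift, and closedness of the subshift, in terms of
    prefixes. *)
Lemma sft_cluster (x : nat -> X) : exists p : X, forall k,
  exists2 m, (k <= m)%N & pref (x m) k = pref p k.
Proof.
have [] := ptws_compact (F := (fun m => set_val (x m) : Pt) @ \oo); first exact: filterT.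
move=> p [_ Hp].
have {}Hp k : exists2 m, (k <= m)%N & forall i, (i < k)%N -> coord (x m) i = p i.
  have [] := Hp [set q : Pt | exists2 m, (k <= m)%N & q = set_val (x m)] _ _ (cyl_nbhs_ptws p k).
    by exists k => // m /= km; exists m.
  by move=> _ [[m km ->] H]; exists m.
have Fp : sft F p.
  move=> k w wF E; have [m _ Hm] := Hp (k + size w)%N.
  apply: (set_valP (x m) k w wF); rewrite -[RHS]E.
  by apply/eq_in_map => i; rewrite mem_iota add0n /= => iw; apply: Hm; rewrite ltn_add2l.
exists (SigSub (mem_set Fp)) => k; have [m km Hm] := Hp k.
by exists m => //; apply: eq_pref => i /Hm.
Qed.

Context {R : realType}.
Variable g : X -> R.
Hypothesis hg : continuous g.

Lemma continuous_unif e : 0 < e -> exists m, forall x y,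
  pref x m = pref y m -> `|g x - g y| <= e.
Proof.
move=> e0; apply: contrapT => H.
have {H} /choice [xy Hxy] : forall m, exists xy : X * X, pref xy.1 m = pref xy.2 m /\ e < `|g xy.1 - g xy.2|.
  move=> m; apply: contrapT => H'; apply: H; exists m => x y xy; rewrite leNgt; apply/negP => h.
  by apply: H'; exists (x, y).
have [p Hp] := sft_cluster (fun m => (xy m).1).
have e2 : 0 < e / 2 by rewrite divr_gt0.
have := @hg p; move/cvgrPdist_lt => /(_ _ e2) [/= _ [[B Bop <-] Bp BU]].
have [k Hk] := nbhs_ptws_cyl (open_nbhs_nbhs (conj Bop Bp)).
have near q : pref q k = pref p k -> `|g p - g q| < e / 2.
  move=> qp; apply: (BU q); apply: Hk => i ik; exact: pref_coord qp ik.
have [m km Hm] := Hp k; have [Em em] := Hxy m.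
have n1 := near _ Hm.
have n2 : `|g p - g (xy m).2| < e / 2.
  apply: near; rewrite -Hm; apply: eq_pref => i ik.
  by apply/esym; apply: pref_coord Em _; apply: leq_trans km.
move: em; apply/negP; rewrite -leNgt.
have -> : g (xy m).1 - g (xy m).2 = (g p - g (xy m).2) - (g p - g (xy m).1) by ring.
apply: le_trans (ler_normB _ _) _; lra.
Qed.

Lemma continuous_bounded : exists2 Ga, 0 <= Ga & forall x, `|g x| <= Ga.
Proof.
have [m Hm] := continuous_unif ltr01.
pose rep (w : m.-tuple S) : R := if pselect (exists x, pref x m = w) is left e
  then `|g (projT1 (cid e))| else 0.
exists (1 + \sum_(w : m.-tuple S) rep w).
  rewrite addr_ge0 // sumr_ge0 // => w _; rewrite /rep; case: pselect => // e; exact: normr_ge0.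
move=> x; have sx : size (pref x m) == m by rewrite size_pref.
rewrite (bigD1 (Tuple sx)) //= addrA.
apply: (@le_trans _ _ (1 + rep (Tuple sx))); last first.
  rewrite lerDl sumr_ge0 // => w _; rewrite /rep; case: pselect => // e; exact: normr_ge0.
rewrite /rep; case: pselect => [e|]; last by case; exists x.
case: (cid e) => y /= yx; have := Hm x y (esym yx).
move=> h; rewrite -[g x](subrK (g y)); apply: le_trans (ler_normD _ _) _.
by rewrite lerD2r.
Qed.

End ShiftSpace.

(** * The pressure as a growth rate *)

Section CylinderSums.
Context {R : realType} {S : finType} {F : seq (seq S)}.
Local Notation X := (sft F).
Implicit Types (V : X -> R) (w : seq S).

(** The real-valued supremum, equal to 0 on words that do not occur. *)
Definition wsup V (n : nat) (w : seq S) : R :=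
  sup [set V y | y in [set y : X | pref y n = w]].

Definition cylsum (V : nat -> X -> R) (n : nat) : R := wsum n (wsup (V n) n).

Lemma wsup_le V n w c : 0 <= c -> (forall y, pref y n = w -> V y <= c) ->
  wsup V n w <= c.
Proof.
move=> c0 H; rewrite /wsup.
have [->|/set0P ne] := eqVneq [set V y | y in [set y : X | pref y n = w]] set0.
  by rewrite sup0.
by apply: ge_sup => // _ [y yw <-]; apply: H.
Qed.

Lemma wsup_ge V n K (y : X) : (forall y, V y <= K) -> V y <= wsup V n (pref y n).
Proof.
move=> VK; apply: ub_le_sup; last by exists y.
by exists K => _ [z _ <-].
Qed.

Lemma wsup_ge0 V n w : (forall y, 0 <= V y) -> 0 <= wsup V n w.
Proof.
move=> V0; rewrite /wsup.
set E := [set V y | y in [set y : X | pref y n = w]].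
have [[_ [y yw _]]|E0] := pselect (E !=set0); last first.
  by rewrite (_ : E = set0) ?sup0 //; apply/eqP/negPn/negP => /set0P.
have [ub|nub] := pselect (has_ubound E).
  by apply: le_trans (V0 y) _; apply: ub_le_sup => //; exists y.
by rewrite sup_out // => -[].
Qed.

Lemma wsup_gt0 V n w : 0 < wsup V n w -> exists y : X, pref y n = w.
Proof.
have [//|H] := pselect (exists y : X, pref y n = w).
rewrite /wsup (_ : [set y : X | _] = set0) ?image_set0 ?sup0 ?ltxx //.
by apply/eqP/negPn/negP => /set0P.
Qed.

Lemma cylsum_ge0 (V : nat -> X -> R) n : (forall n y, 0 <= V n y) -> 0 <= cylsum V n.
Proof. by move=> V0; apply: wsum_ge0 => w _; apply: wsup_ge0. Qed.

Lemma cylsum_le (V W : nat -> X -> R) n c K : 0 <= c ->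
  (forall y, 0 <= W n y) -> (forall y, W n y <= K) ->
  (forall y, V n y <= c * W n y) -> cylsum V n <= c * cylsum W n.
Proof.
move=> c0 W0 WK VW; rewrite -wsumZ; apply: ler_wsum => w _.
apply: wsup_le => [|y <-]; first by rewrite mulr_ge0 // wsup_ge0.
by apply: le_trans (VW y) _; apply: ler_wpM2l => //; apply: wsup_ge WK.
Qed.

Lemma cylsum_sub (V : nat -> X -> R) (K : nat -> R) C : 0 <= C ->
  (forall n y, 0 <= V n y) -> (forall n y, V n y <= K n) ->
  (forall n m y, V (n + m)%N y <= C * (V n y * V m (iter n shift y))) ->
  forall n m, cylsum V (n + m) <= C * (cylsum V n * cylsum V m).
Proof.
move=> C0 V0 VK VM n m; rewrite /cylsum wsum_cat -wsumZr -wsumZ.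
apply: ler_wsum => u un; rewrite -wsumZ -wsumZ; apply: ler_wsum => v vm.
have W0 k w : 0 <= wsup (V k) k w by apply: wsup_ge0.
apply: wsup_le => [|y]; first by rewrite !mulr_ge0.
rewrite pref_add => /eqP; rewrite eqseq_cat ?size_pref ?un // => /andP [/eqP<- /eqP<-].
apply: le_trans (VM n m y) _; apply: ler_wpM2l => //.
by apply: ler_pM => //; apply: wsup_ge; exact: VK.
Qed.

End CylinderSums.

Section PressureGrowth.
Context {R : realType} {S : finType} {F : seq (seq S)} {d : nat}.
Hypothesis d0 : (0 < d)%N.
Local Notation X := (sft F).
Implicit Types (g : X -> R) (B : X -> 'M[R]_d) (s t : R).

Lemma birkhoff_sum_add g n m x :
  birkhoff_sum g (n + m) x = birkhoff_sum g n x + birkhoff_sum g m (iter n shift x).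
Proof.
rewrite /birkhoff_sum big_split_ord /=; congr (_ + _); apply: eq_bigr => i _.
by rewrite addnC iterD.
Qed.

Lemma cocycle_prod_add B n m x :
  cocycle_prod B x (n + m) = cocycle_prod B (iter n shift x) m *m cocycle_prod B x n.
Proof.
elim: m => [|m IH]; first by rewrite addn0 mul1mx.
by rewrite addnS /= IH mulmxA addnC iterD.
Qed.

(** Along two points with a common prefix of length [n] the values of [g] agree
    up to [e] except at a bounded number of final times. *)
Lemma birkhoff_variation g : continuous g -> forall e, 0 < e ->
  exists2 K, 0 <= K & forall n x y, pref x n = pref y n ->
    `|birkhoff_sum g n x - birkhoff_sum g n y| <= e * n%:R + K.
Proof.
move=> hg e e0; have [m Hm] := continuous_unif hg e0.
have [Ga Ga0 HGa] := continuous_bounded hg.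
exists (m%:R * (2 * Ga)) => [|n x y xy]; first by rewrite !mulr_ge0.
rewrite /birkhoff_sum -sumrB; apply: le_trans (ler_norm_sum _ _ _) _.
apply: (@le_trans _ _ (\sum_(i < n) (e + (n < i + m)%N%:R * (2 * Ga)))).
  apply: ler_sum => i _; have [im|im] := leqP (i + m) n.
    by rewrite mul0r addr0; apply: Hm; apply: pref_sub xy im.
  rewrite mul1r; apply: (@le_trans _ _ (2 * Ga)); last by rewrite lerDr ltW.
  apply: le_trans (ler_normB _ _) _.
  by have := HGa (iter i shift x); have := HGa (iter i shift y); lra.
rewrite big_split /= sumr_const card_ord -[e *+ n]mulr_natr lerD2l -mulr_suml.
apply: ler_wpM2r; first by rewrite mulr_ge0.
rewrite -natr_sum ler_nat.
apply: (@leq_trans (\sum_(i < n) (i < m)%N)%N).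
  rewrite (reindex_inj rev_ord_inj) /=; apply: leq_sum => i _.
  have E : n = (n - i.+1 + i.+1)%N by rewrite subnK.
  rewrite [X in (X < _)%N]E ltn_add2l.
  by case: (ltnP i.+1 m) => // im; rewrite (ltn_trans (ltnSn i) im).
elim: n {xy} => [|n IH]; first by rewrite big_ord0.
rewrite big_ord_recr /=; case: (ltnP n m) => nm; last by rewrite addn0.
apply: (@leq_trans n.+1) => //; rewrite addn1 ltnS.
apply: leq_trans (_ : (\sum_(i < n) 1 <= n)%N).
  by apply: leq_sum => i _; case: (_ < _)%N.
by rewrite sum_nat_const card_ord muln1.
Qed.

(** The quantity whose supremum over each cylinder is summed. *)
Definition cylval g B s (n : nat) (y : X) : R :=
  expR (birkhoff_sum g n y) * phi s (cocycle_prod B y n).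

Lemma cylval_ge0 g B s n y : 0 <= cylval g B s n y.
Proof. by rewrite mulr_ge0 ?expR_ge0 ?phi_ge0. Qed.

Lemma cylval_submul : exists2 C : R, 1 <= C & forall g B s, 0 <= s -> forall n m y,
  cylval g B s (n + m) y <= C * (cylval g B s n y * cylval g B s m (iter n shift y)).
Proof.
have [C C1 HC] := @phi_submul R d d0; exists C => // g B s s0 n m y.
rewrite /cylval birkhoff_sum_add cocycle_prod_add expRD -[leLHS]mulrA.
set a := expR _; set b := expR _; set u := phi _ _; set v := phi s _; set w := phi s _.
have -> : C * (a * v * (b * w)) = a * (b * (C * (w * v))) by ring.
apply: ler_wpM2l; first exact: expR_ge0.
by apply: ler_wpM2l; [exact: expR_ge0|exact: HC].
Qed.

Definition bounded_by (K : R) B := forall x, minor_norm 1 (B x) <= K.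

Lemma cocycle_norm K B n x : 0 <= K -> bounded_by K B ->
  minor_norm 1 (cocycle_prod B x n) <= minor_norm 1 (1%:M : 'M[R]_d) * K ^+ n.
Proof.
move=> K0 BK; elim: n => [|n IH] /=; first by rewrite expr0 mulr1.
apply: le_trans (minor_normM _ _ _) _; rewrite exprS mulrCA.
by apply: ler_pM; rewrite ?minor_norm_ge0 ?BK.
Qed.

Lemma cylval_bounded g K B s : continuous g -> 0 <= K -> bounded_by K B -> 0 <= s ->
  exists L : nat -> R, forall n y, cylval g B s n y <= L n.
Proof.
move=> hg K0 BK s0; have [Ga Ga0 HGa] := continuous_bounded hg.
have [C C1 HC] := @phi_mono R d d0.
exists (fun n => expR (n%:R * Ga) * (C * ((C * (minor_norm 1 (1%:M : 'M[R]_d) * K ^+ n)) `^ s))) => n y.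
apply: ler_pM; rewrite ?expR_ge0 ?phi_ge0 //.
  rewrite ler_expR mulr_natl -[n in _ *+ n]card_ord -sumr_const; apply: ler_sum => i _.
  exact: le_trans (ler_norm _) (HGa _).
apply: le_trans (HC 0 s _ (lexx 0) s0) _; rewrite subr0.
have -> : phi 0 (cocycle_prod B y n) = 1.
  by have := @phi_nat R d d0 0 (cocycle_prod B y n) (leq0n d); rewrite prod_sv0.
have C0 : 0 <= C by apply: le_trans C1.
rewrite mul1r; apply: ler_wpM2l => //; apply: ler_powRl => //.
  by rewrite mulr_ge0 // minor_norm_ge0.
by apply: ler_wpM2l => //; apply: cocycle_norm.
Qed.

Definition psum g B s : nat -> R := cylsum (cylval g B s).

Lemma psum_ge0 g B s n : 0 <= psum g B s n.
Proof. by apply: cylsum_ge0 => *; apply: cylval_ge0. Qed.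

(** The constant depends only on [d]: this uniformity is what allows the
    cocycle and the exponent to vary. *)
Lemma psum_sub : exists2 C : R, 1 <= C & forall g K B s, continuous g -> 0 <= K ->
  bounded_by K B -> 0 <= s ->
  forall n m, psum g B s (n + m)%N <= C * (psum g B s n * psum g B s m).
Proof.
have [C C1 HC] := cylval_submul; exists C => // g K B s hg K0 BK s0.
have [L HL] := cylval_bounded hg K0 BK s0.
by apply: (cylsum_sub (K := L)); [exact: le_trans C1|move=> *; apply: cylval_ge0|exact: HL|exact: HC].
Qed.

Lemma partition_sumE g K B s n : continuous g -> 0 <= K -> bounded_by K B -> 0 <= s ->
  partition_sum g B s n = (psum g B s n)%:E.
Proof.
move=> hg K0 BK s0; have [L HL] := cylval_bounded hg K0 BK s0.
have cylE (w : n.-tuple S) : cylinder w = [set y : X | pref y n = w].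
  apply/seteqP; split=> y /=.
    move=> H; apply: (@eq_from_nth _ (coord y 0%N)); rewrite ?size_pref ?size_tuple // => i ni.
    by rewrite nth_mkseq // (H (Ordinal ni)) (tnth_nth (coord y 0%N)).
  by move=> H i; rewrite (tnth_nth (coord y 0%N)) -H nth_mkseq.
rewrite /partition_sum /psum /cylsum wsum_tuple -sumEFin big_mkcond /=.
apply: eq_bigr => w _; rewrite inE cylE /wsup; case: asboolP => [[y yw]|H].
  rewrite -ereal_sup_EFin; [|by exists (L n) => _ [z _ <-]; exact: HL|by exists (cylval g B s n y), y].
  by congr ereal_sup; rewrite image_comp.
by rewrite (_ : [set y | _] = set0) ?image_set0 ?sup0 //; apply/eqP/negPn/negP => /set0P.
Qed.

(** For a bounded cocycle the suprema are finite and the extended-real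
    definition reduces to real sums. *)
Lemma pressureE g K B s : continuous g -> 0 <= K -> bounded_by K B -> 0 <= s ->
  pressure g B s = growth_rate (psum g B s).
Proof.
move=> hg K0 BK s0; rewrite /pressure /growth_rate.
have -> // : (fun n => (n%:R^-1)%:E * lne (partition_sum g B s n))%E =
  (fun n => ((n%:R^-1)%:E * lne (psum g B s n)%:E)%E).
by apply/funext => n; rewrite (partition_sumE _ hg K0 BK s0).
Qed.

End PressureGrowth.

(** * Change of exponent, and uniformly close cocycles *)

Section ExponentComparison.
Context {R : realType} {S : finType} {F : seq (seq S)} {d : nat}.
Hypothesis d0 : (0 < d)%N.
Local Notation X := (sft F).
Implicit Types (g : X -> R) (A B : X -> 'M[R]_d) (s t K : R).

Lemma expX_ln (K : R) n a : 0 < K -> (K ^+ n) `^ a = expR (a * ln K * n%:R).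
Proof.
move=> K0; rewrite /powR gt_eqF ?exprn_gt0 // lnXn // -mulr_natr; congr expR; ring.
Qed.

(** Raising the exponent costs at most the norm of the product, hence at most
    [K] per step and per unit of exponent. *)
Lemma growth_exponent_up g B K s t q : continuous g -> 0 < K -> bounded_by K B ->
  0 <= s -> s <= t -> growth_le (psum g B s) q ->
  growth_le (psum g B t) (q + (t - s) * ln K).
Proof.
move=> hg K0 BK s0 st [L L0 HL].
have [C C1 HC] := @phi_mono R d d0.
have C0 : 0 < C by apply: lt_le_trans C1.
have C0' := ltW C0.
pose c := minor_norm 1 (1%:M : 'M[R]_d) + 1.
have cM : 0 <= minor_norm 1 (1%:M : 'M[R]_d) by exact: minor_norm_ge0.
have c0 : 0 < c by rewrite ltr_wpDl.
have [V HV] := cylval_bounded d0 hg (ltW K0) BK s0.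
have ts0 : 0 <= t - s by rewrite subr_ge0.
pose D := C * (C * c) `^ (t - s).
have D0 : 0 < D by rewrite mulr_gt0 // powR_gt0 // mulr_gt0.
exists (D * L) => [|n]; first by rewrite mulr_gt0.
have step y : cylval g B t n y <= D * (K ^+ n) `^ (t - s) * cylval g B s n y.
  rewrite /cylval; set M := cocycle_prod B y n.
  have NM : C * minor_norm 1 M <= C * c * K ^+ n.
    rewrite -mulrA ler_pM2l //; apply: le_trans (cocycle_norm n y (ltW K0) BK) _.
    by apply: ler_wpM2r; rewrite ?exprn_ge0 ?(ltW K0) // lerDl.
  have -> : D * (K ^+ n) `^ (t - s) * (expR (birkhoff_sum g n y) * phi s M) =
    expR (birkhoff_sum g n y) * (C * (phi s M * (C * c * K ^+ n) `^ (t - s))).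
    rewrite (@powRM _ (C * c) (K ^+ n)) ?exprn_ge0 ?(ltW K0) ?mulr_ge0 ?(ltW c0) // /D.
    set u := expR _; set v := phi s M; set w := _ `^ _; set z := _ `^ _; ring.
  apply: ler_wpM2l; first exact: expR_ge0.
  apply: le_trans (HC s t M s0 st) _; apply: ler_wpM2l => //.
  apply: ler_wpM2l; first exact: phi_ge0.
  by apply: ler_powRl => //; rewrite mulr_ge0 // minor_norm_ge0.
have DK : 0 <= D * (K ^+ n) `^ (t - s) by rewrite mulr_ge0 ?powR_ge0 // ltW.
apply: le_trans (cylsum_le DK (fun y => cylval_ge0 g B s n y) (HV n) step) _.
apply: (@le_trans _ _ (D * (K ^+ n) `^ (t - s) * (L * expR (q * n%:R)))).
  by apply: ler_wpM2l => //; exact: HL.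
rewrite expX_ln // (mulrDl q) expRD.
set u := expR _; set v := expR _; rewrite le_eqVlt; apply/orP; left; apply/eqP; ring.
Qed.

(** With determinants bounded below the last singular value of a product decays
    at most exponentially, so lowering the exponent is controlled as well. *)
Lemma growth_exponent_down K e : 0 < K -> 0 < e -> exists2 k : R, 0 <= k &
  forall g B s t q, continuous g -> bounded_by K B -> (forall x, e <= `|\det (B x)|) ->
  0 <= s -> s <= t -> t <= d%:R -> growth_le (psum g B t) q ->
  growth_le (psum g B s) (q + (t - s) * k).
Proof.
move=> K0 e0.
have [C C1 HC] := @det_le_sv_last R d d0.
have C0 : 0 < C by apply: lt_le_trans C1.
have cM : 0 <= minor_norm 1 (1%:M : 'M[R]_d) by exact: minor_norm_ge0.
pose c := minor_norm 1 (1%:M : 'M[R]_d) + 1.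
have c0 : 0 < c by rewrite ltr_wpDl.
pose k0 := K ^+ d.-1 / e; have k00 : 0 < k0 by rewrite divr_gt0 // exprn_gt0.
exists `|ln k0| => // g B s t q hg BK Be s0 st td [L L0 HL].
have ts0 : 0 <= t - s by rewrite subr_ge0.
have t0 : 0 <= t by apply: le_trans st.
have [V HV] := cylval_bounded d0 hg (ltW K0) BK t0.
pose D0 := C * (C * c) ^+ d.-1; have D00 : 0 < D0 by rewrite mulr_gt0 // exprn_gt0 // mulr_gt0.
pose D := D0 `^ (t - s); have Dg : 0 < D by rewrite powR_gt0.
have detB n x : e ^+ n <= `|\det (cocycle_prod B x n)|.
  elim: n => [|n IH] /=; first by rewrite det1 normr1 expr0.
  by rewrite det_mulmx normrM exprS; apply: ler_pM; rewrite ?exprn_ge0 // ltW.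
have svl n x : 1 <= D0 * k0 ^+ n * sv (cocycle_prod B x n) d.-1.
  set M := cocycle_prod B x n.
  have E : e ^+ n <= D0 * (K ^+ d.-1) ^+ n * sv M d.-1.
    apply: le_trans (detB n x) _; apply: le_trans (HC _) _; rewrite -/M.
    apply: ler_wpM2r; first exact: sv_ge0.
    rewrite /D0 -[X in _ <= X]mulrA; apply: ler_wpM2l; first exact: ltW.
    rewrite -exprM mulnC exprM -exprMn lerXn2r ?nnegrE ?mulr_ge0 ?minor_norm_ge0 ?exprn_ge0 ?(ltW C0) ?(ltW c0) ?(ltW K0) //.
    rewrite -mulrA; apply: ler_wpM2l; first exact: ltW.
    apply: le_trans (cocycle_norm n x (ltW K0) BK) _.
    by apply: ler_wpM2r; rewrite ?exprn_ge0 ?(ltW K0) // lerDl.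
  rewrite /k0 expr_div_n mulrA mulrAC ler_pdivlMr ?exprn_gt0 // mul1r.
  exact: E.
exists (D * L) => [|n]; first by rewrite mulr_gt0.
have step y : cylval g B s n y <= D * (k0 ^+ n) `^ (t - s) * cylval g B t n y.
  rewrite /cylval; set M := cocycle_prod B y n.
  have H := phi_lower_sv d0 M s0 st td.
  have H2 : 1 <= D * (k0 ^+ n) `^ (t - s) * sv M d.-1 `^ (t - s).
    have kn0 : 0 <= k0 ^+ n by rewrite exprn_ge0 // ltW.
    rewrite /D -(powRM (t - s) (ltW D00) kn0) -(powRM (t - s) (mulr_ge0 (ltW D00) kn0) (sv_ge0 M d.-1)).
    have := svl n y; rewrite -/M => /(ler_powRl ts0) -/(_ ler01); rewrite powR1; apply.
  have -> : D * (k0 ^+ n) `^ (t - s) * (expR (birkhoff_sum g n y) * phi t M) =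
     expR (birkhoff_sum g n y) * (D * (k0 ^+ n) `^ (t - s) * phi t M).
    set u := expR _; set v := _ `^ _; ring.
  apply: ler_wpM2l; first exact: expR_ge0.
  apply: (@le_trans _ _ (D * (k0 ^+ n) `^ (t - s) * (phi s M * sv M d.-1 `^ (t - s)))).
    rewrite mulrCA ler_peMr //; exact: phi_ge0.
  by apply: ler_wpM2l => //; rewrite mulr_ge0 ?powR_ge0 // ltW.
have DK : 0 <= D * (k0 ^+ n) `^ (t - s) by rewrite mulr_ge0 ?powR_ge0 // ltW.
apply: le_trans (cylsum_le DK (fun y => cylval_ge0 g B t n y) (HV n) step) _.
apply: (@le_trans _ _ (D * (k0 ^+ n) `^ (t - s) * (L * expR (q * n%:R)))).
  by apply: ler_wpM2l => //; exact: HL.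
rewrite expX_ln //.
have -> : D * expR ((t - s) * ln k0 * n%:R) * (L * expR (q * n%:R)) =
   D * L * expR (q * n%:R + (t - s) * ln k0 * n%:R).
  rewrite expRD; set u := expR _; set v := expR _; ring.
apply: ler_wpM2l; first by rewrite mulr_ge0 // ltW.
rewrite ler_expR (mulrDl q) lerD2l; apply: ler_wpM2r => //.
by apply: ler_wpM2l => //; exact: ler_norm.
Qed.

End ExponentComparison.

Section Closeness.
Context {R : realType} {S : finType} {F : seq (seq S)} {d : nat}.
Hypothesis d0 : (0 < d)%N.
Local Notation X := (sft F).
Implicit Types (g : X -> R) (A B : X -> 'M[R]_d) (s t K : R).

(** The trace on plain functions of the neighbourhoods of [A] for uniform
    convergence, with an explicit distance. *)
Definition closef A : set_system (X -> 'M[R]_d) :=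
  [set Q | exists2 e, 0 < e & forall B, (forall x, minor_norm 1 (B x - A x) <= e) -> Q B].

Global Instance closef_filter A : Filter (closef A).
Proof.
split; first by exists 1.
- move=> P Q [e e0 HP] [e' e0' HQ]; exists (Num.min e e') => [|B HB].
    by rewrite lt_min e0.
  by split; [apply: HP|apply: HQ] => x; apply: le_trans (HB x) _; rewrite ge_min lexx ?orbT.
- by move=> P Q PQ [e e0 HP]; exists e => // B /HP /PQ.
Qed.

Lemma minor_norm1E (M : 'M[R]_d) : minor_norm 1 M = \sum_i \sum_j `|M i j|.
Proof.
pose h (i : 'I_d) : {ffun 'I_1 -> 'I_d} := [ffun=> i].
have hb : bijective h.
  exists (fun f : {ffun 'I_1 -> 'I_d} => f ord0) => [i|f]; first by rewrite ffunE.
  by apply/ffunP => i; rewrite ffunE /= (ord1 i).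
rewrite /minor_norm (reindex h) /=; last exact: onW_bij.
apply: eq_bigr => i _; rewrite (reindex h) /=; last exact: onW_bij.
by apply: eq_bigr => j _; rewrite det_mx11 mxE !ffunE.
Qed.

Lemma minor_norm1D (M N : 'M[R]_d) :
  minor_norm 1 (M + N) <= minor_norm 1 M + minor_norm 1 N.
Proof.
rewrite !minor_norm1E -big_split; apply: ler_sum => i _ /=.
rewrite -big_split; apply: ler_sum => j _ /=; rewrite mxE; exact: ler_normD.
Qed.

(** Telescoping, with the norm of the unperturbed product as a bound. *)
Lemma close_cocycle A K m e : 0 <= K -> bounded_by K A -> 0 < e ->
  \forall B \near closef A, forall x,
    minor_norm 1 (cocycle_prod B x m - cocycle_prod A x m) <= e.
Proof.
move=> K0 AK; elim: m e => [|m IH] e e0.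
  near=> B => x; rewrite /= subrr; rewrite minor_norm1E big1 ?ltW // => i _.
  by rewrite big1 // => j _; rewrite mxE normr0.
pose L := minor_norm 1 (1%:M : 'M[R]_d) * K ^+ m.
have L0 : 0 <= L by rewrite mulr_ge0 ?minor_norm_ge0 ?exprn_ge0.
pose e1 := Num.min 1 (e / (2 * (K + 1))).
have K1 : 0 < K + 1 by rewrite ltr_wpDl.
have L1 : 0 < L + 1 by rewrite ltr_wpDl.
have e10 : 0 < e1 by rewrite lt_min ltr01 divr_gt0 // mulr_gt0.
have e20 : 0 < e / (2 * (L + 1)) by rewrite divr_gt0 // mulr_gt0.
have H1 := IH e1 e10.
have H2 : \forall B \near closef A, forall x, minor_norm 1 (B x - A x) <= e / (2 * (L + 1)).
  by exists (e / (2 * (L + 1))).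
apply: filterS2 H1 H2 => B H1 H2 x /=.
set T := iter m shift x; set P := cocycle_prod B x m; set Q := cocycle_prod A x m.
have -> : B T *m P - A T *m Q = (B T - A T) *m P + A T *m (P - Q).
  by rewrite mulmxBl mulmxBr addrA subrK.
apply: le_trans (minor_norm1D _ _) _.
have HP : minor_norm 1 P <= L + 1.
  have -> : P = (P - Q) + Q by rewrite subrK.
  apply: le_trans (minor_norm1D _ _) _; rewrite addrC; apply: lerD.
    exact: cocycle_norm.
  by apply: le_trans (H1 x) _; rewrite ge_min lexx.
have a1 : minor_norm 1 ((B T - A T) *m P) <= e / 2.
  apply: le_trans (minor_normM _ _ _) _.
  apply: (@le_trans _ _ (e / (2 * (L + 1)) * (L + 1))).
    by apply: ler_pM; rewrite ?minor_norm_ge0.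
  by rewrite le_eqVlt; apply/orP; left; apply/eqP; field; rewrite gt_eqF.
have a2 : minor_norm 1 (A T *m (P - Q)) <= e / 2.
  apply: le_trans (minor_normM _ _ _) _.
  apply: (@le_trans _ _ ((K + 1) * (e / (2 * (K + 1))))).
    apply: ler_pM; rewrite ?minor_norm_ge0 //.
      by apply: le_trans (AK T) _; rewrite lerDl.
    by apply: le_trans (H1 x) _; rewrite ge_min lexx orbT.
  by rewrite le_eqVlt; apply/orP; left; apply/eqP; field; rewrite gt_eqF.
by lra.
Unshelve. all: end_near. Qed.

Lemma nbhs_minor_norm1 (M : 'M[R]_d) (Q : set 'M[R]_d) : nbhs M Q ->
  exists2 e, 0 < e & forall M', minor_norm 1 (M' - M) <= e -> Q M'.
Proof.
move=> /nbhs_ballP [e /= e0 He]; exists (e / 2) => [|M' H]; first by rewrite divr_gt0.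
apply: He; split => // i j; rewrite /ball /= distrC.
have : `|M' i j - M i j| <= minor_norm 1 (M' - M).
  rewrite minor_norm1E (bigD1 i) //= (bigD1 j) //= !mxE -addrA lerDl addr_ge0 ?sumr_ge0 // => k _.
  by rewrite sumr_ge0.
by move=> /le_trans /(_ H) /le_lt_trans; apply; rewrite ltr_pdivrMr // ltr_pMr // ltr1n.
Qed.

End Closeness.

(** * Upper semicontinuity *)

Section FiniteMinimum.
Context {R : realType}.

Lemma finite_lower (T : finType) (h : T -> R) b : 0 < b -> (forall i, 0 < h i) ->
  exists h0, [/\ 0 < h0, h0 <= b & forall i, h0 <= h i].
Proof.
move=> b0 hp; exists (\big[Num.min/b]_i h i); split => [||i].
- by apply/bigmin_gtP; split.
- exact: bigmin_le_id.
- exact: bigmin_le_cond.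
Qed.

End FiniteMinimum.

Section WordMatrices.
Context {R : realType} {S : finType} {d : nat}.
Variable a : S -> 'M[R]_d.

Fixpoint wmat (w : seq S) : 'M[R]_d := if w is c :: w' then wmat w' *m a c else 1%:M.

Lemma wmat_cat u v : wmat (u ++ v) = wmat v *m wmat u.
Proof. by elim: u => [|c u IH] /=; rewrite ?mulmx1 // IH mulmxA. Qed.

Context {F : seq (seq S)}.
Local Notation X := (sft F).

Lemma cocycle_prod_word (A : X -> 'M[R]_d) : (forall x, A x = a (coord x 0%N)) ->
  forall x n, cocycle_prod A x n = wmat (pref x n).
Proof.
move=> Aa x; elim=> [//|n IH].
by rewrite -addn1 pref_add wmat_cat addn1 /= IH Aa !coord_iter_shift !addn0 mul1mx.
Qed.

End WordMatrices.

Section UpperSemicontinuity.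
Context {R : realType} {S : finType} {F : seq (seq S)} {d : nat}.
Hypothesis d0 : (0 < d)%N.
Local Notation X := (sft F).
Implicit Types (g : X -> R) (A B : X -> 'M[R]_d) (s t K : R).

(** A letter that starts no point receives the identity, so that invertibility
    of all values of [A] passes to the matrices of all letters. *)
Lemma locally_constant_symbols A : locally_constant A ->
  exists2 a : S -> 'M[R]_d, (forall x, A x = a (coord x 0%N)) &
    (forall c, (exists x, A x = a c) \/ a c = 1%:M).
Proof.
move=> lc.
have /choice [a Ha] : forall c : S, exists m : 'M[R]_d,
    (forall x, coord x 0%N = c -> A x = m) /\ ((exists x, A x = m) \/ m = 1%:M).
  move=> c; have [[x xc]|H] := pselect (exists x : X, coord x 0%N = c).
    by exists (A x); split; [move=> y yc; apply: lc; rewrite yc|left; exists x].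
  by exists 1%:M; split; [move=> x xc; case: H; exists x|right].
by exists a => [x|c]; [exact: (Ha _).1|exact: (Ha c).2].
Qed.

Lemma locally_constant_bounded A : locally_constant A -> exists2 K, 1 <= K &
  bounded_by K A /\ \forall B \near closef A, bounded_by K B.
Proof.
move=> /locally_constant_symbols [a Ha _].
pose K := \sum_c minor_norm 1 (a c).
have K0 : 0 <= K by apply: sumr_ge0 => c _; exact: minor_norm_ge0.
have AK x : minor_norm 1 (A x) <= K.
  rewrite Ha /K (bigD1 (coord x 0%N)) //= lerDl; apply: sumr_ge0 => c _; exact: minor_norm_ge0.
exists (K + 1); first by rewrite lerDr.
split=> [x|]; first by apply: le_trans (AK x) _; rewrite lerDl.
exists 1 => // B HB x; rewrite -[B x](subrK (A x)) addrC.
by apply: le_trans (minor_norm1D _ _) _; rewrite addrC (addrC K) lerD.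
Qed.

Lemma phi_left_cont_ge0 s (M : 'M[R]_d) e : 0 <= s -> 0 < e ->
  exists2 h, 0 < h & forall t, 0 <= t -> t <= s -> s - t < h -> phi t M <= phi s M + e.
Proof.
rewrite le_eqVlt => /orP [/eqP<-|s0] e0; last exact: phi_left_cont.
exists 1 => // t t0 t1 _; have -> : t = 0 by apply/eqP; rewrite eq_le t0 t1.
by rewrite lerDl ltW.
Qed.

(** Only finitely many products of length [n] occur for [A], so left continuity
    in the exponent and upper semicontinuity in the matrix hold uniformly. *)
Lemma psum_near g A K s : continuous g -> locally_constant A -> 0 <= K -> bounded_by K A ->
  0 <= s -> exists2 C, 1 <= C & forall n e, 0 < e -> exists2 h, 0 < h &
  forall t, 0 <= t -> t <= s -> s - t < h -> \forall B \near closef A,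
    psum g B t n <= C * psum g A s n + e.
Proof.
move=> hg lc K0 AK s0; have [a Ha _] := locally_constant_symbols lc.
have [C C1 HC] := @phi_usc R d d0.
have C0 : 0 <= C by apply: le_trans C1.
exists C => // n e e0.
have [Ga Ga0 HGa] := continuous_bounded hg.
pose c := expR (n%:R * Ga) * wsum n (fun _ : seq S => 1 : R).
have w0 : 0 <= wsum n (fun _ : seq S => 1 : R) by apply: wsum_ge0.
have c0 : 0 <= c by rewrite mulr_ge0 // expR_ge0.
have c1 : 0 < c + 1 by rewrite ltr_wpDl.
pose e1 := e / (c + 1) / 2; have e10 : 0 < e1 by rewrite !divr_gt0.
have eC : 0 < e1 / C by rewrite divr_gt0 // (lt_le_trans _ C1).
have /choice [hh Hhh] : forall w : n.-tuple S, exists h, 0 < h /\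
    forall t, 0 <= t -> t <= s -> s - t < h -> phi t (wmat a w) <= phi s (wmat a w) + e1 / C.
  by move=> w; have [h h0 H] := phi_left_cont_ge0 (wmat a w) s0 eC; exists h.
have [h [h0 _ Hh]] := finite_lower ltr01 (fun w => (Hhh w).1).
exists h => // t t0 ts sth.
have /choice [dd Hdd] : forall w : n.-tuple S, exists r, 0 < r /\
    forall M', minor_norm 1 (M' - wmat a w) <= r -> phi t M' <= C * phi t (wmat a w) + e1.
  by move=> w; have [r r0 H] := nbhs_minor_norm1 (HC t (wmat a w) e1 t0 e10); exists r.
have [r [r0 _ Hr]] := finite_lower ltr01 (fun w => (Hdd w).1).
apply: filterS (close_cocycle n K0 AK r0) => B HB.
have [L HL] := cylval_bounded d0 hg K0 AK s0.
have step y : cylval g B t n y <= C * cylval g A s n y + expR (n%:R * Ga) * (e / (c + 1)).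
  have sy : size (pref y n) == n by rewrite size_pref.
  pose w := Tuple sy.
  have H1 : phi t (cocycle_prod B y n) <= C * phi t (wmat a w) + e1.
    apply: (Hdd w).2; rewrite -(cocycle_prod_word Ha).
    exact: le_trans (HB y) (Hr w).
  have H2 : phi t (wmat a w) <= phi s (wmat a w) + e1 / C.
    by apply: (Hhh w).2 => //; apply: lt_le_trans sth (Hh w).
  have {}H2 : phi t (cocycle_prod B y n) <= C * phi s (wmat a w) + e / (c + 1).
    apply: le_trans H1 _; have := ler_wpM2l C0 H2.
    rewrite mulrDr (mulrC C (_ / C)) divfK ?gt_eqF ?(lt_le_trans _ C1) // => H3.
    have -> : e / (c + 1) = e1 + e1 by rewrite /e1 [LHS]splitr.
    by rewrite addrA lerD2r.
  rewrite /cylval (cocycle_prod_word Ha) -[wmat a _]/(wmat a w) [C * _]mulrCA.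
  set u := expR (birkhoff_sum g n y); have u0 : 0 <= u by exact: expR_ge0.
  apply: le_trans (ler_wpM2l u0 H2) _; rewrite mulrDr lerD2l; apply: ler_wpM2r.
    by rewrite divr_ge0 ?ltW.
  rewrite ler_expR mulr_natl -[n in _ *+ n]card_ord -sumr_const; apply: ler_sum => i _.
  exact: le_trans (ler_norm _) (HGa _).
apply: (@le_trans _ _ (wsum n (fun w => C * wsup (cylval g A s n) n w + expR (n%:R * Ga) * (e / (c + 1)) * 1))).
  apply: ler_wsum => w _; rewrite mulr1; apply: wsup_le => [|y <-].
    apply: addr_ge0; first by rewrite mulr_ge0 // wsup_ge0 // => y; exact: cylval_ge0.
    by rewrite mulr_ge0 ?expR_ge0 // divr_ge0 ?ltW.
  by apply: le_trans (step y) _; rewrite lerD2r; apply: ler_wpM2l => //; apply: wsup_ge (HL n).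
rewrite wsumD !wsumZ lerD2l mulrAC -/c mulrA ler_pdivrMr // mulrC ler_pM2l //.
by rewrite lerDl.
Qed.

Lemma real_between (l : \bar R) (q : R) : (l < q%:E)%E -> exists2 p, p < q & (l < p%:E)%E.
Proof.
case: l => [r| |] //; last by exists (q - 1); rewrite ?ltrBlDr ?ltrDl ?ltNyr.
by rewrite lte_fin => rq; exists ((r + q) / 2); rewrite ?lte_fin; lra.
Qed.

(** For [n] large the sum of length [n] at an exponent [t0] slightly below [s]
    certifies a growth rate below [q] for all nearby [B]; all exponents beyond
    [t0] follow by [growth_exponent_up]. *)
Lemma pressure_usc g A s q : continuous g -> locally_constant A -> 0 <= s ->
  (pressure g A s < q%:E)%E -> exists2 h, 0 < h &
  \forall B \near closef A, forall t, 0 <= t -> `|t - s| < h ->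
    (pressure g B t <= q%:E)%E.
Proof.
move=> hg lc s0 /real_between [q1 q1q] /real_between [q2 q21 Hp].
have [K K1 [AK BK]] := locally_constant_bounded lc.
have K0 : 0 < K by apply: lt_le_trans K1.
have [C C1 HC] := @psum_sub R S F d d0.
have Crate B t : bounded_by K B -> 0 <= t -> forall n m,
    psum g B t (n + m) <= C * (psum g B t n * psum g B t m).
  by move=> HB t0; apply: (HC g K) => //; exact: ltW.
have psum0 B t n : 0 <= psum g B t n by exact: psum_ge0.
move: Hp; rewrite (pressureE d0 hg (ltW K0) AK s0).
move=> /(growth_rate_lt (psum0 A s) C1 (Crate A s AK s0)) [L L0 HL].
have [C' C'1 HC'] := psum_near hg lc (ltW K0) AK s0.
have q12 : 0 < q1 - q2 by rewrite subr_gt0.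
have C0 : 0 < C by apply: lt_le_trans C1.
have [n n0 Hn] : exists2 n, (0 < n)%N & C * (C' * L + 1) + 1 <= expR ((q1 - q2) * n%:R).
  have [N _ HN] := near_absorb (C * (C' * L + 1) + 1) q12.
  by exists N.+1 => //; apply: HN => /=.
have [h h0 Hh] := HC' n _ (expR_gt0 (q2 * n%:R)).
have lnK : 0 <= ln K by rewrite ln_ge0.
pose h1 := Num.min (h / 2) ((q - q1) / (2 * (ln K + 1))).
have lnK1 : 0 < ln K + 1 by rewrite ltr_wpDl.
have h10 : 0 < h1 by rewrite lt_min !divr_gt0 ?mulr_gt0 // subr_gt0.
exists h1 => //.
pose t0 := Num.max 0 (s - h1).
have t00 : 0 <= t0 by rewrite le_max lexx.
have t0s : t0 <= s by rewrite ge_max s0 lerBlDr lerDl ltW.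
have st0 : s - t0 <= h1 by rewrite lerBlDr -lerBlDl le_max lexx orbT.
have st0h : s - t0 < h.
  apply: le_lt_trans st0 _; apply: (@le_lt_trans _ _ (h / 2)); first by rewrite ge_min lexx.
  by rewrite ltr_pdivrMr // ltr_pMr // ltr1n.
apply: filterS2 BK (Hh t0 t00 t0s st0h) => B HBK HB t t_0 ts.
have G : growth_le (psum g B t0) q1.
  have [//|H] := growth_dichotomy (psum0 B t0) C1 (Crate B t0 HBK t00) q1.
  have := H n n0; rewrite leNgt => /negP []; apply: le_lt_trans (ler_wpM2l (ltW C0) HB) _.
  have -> : expR (q1 * n%:R) = expR ((q1 - q2) * n%:R) * expR (q2 * n%:R).
    by rewrite -expRD -mulrDl subrK.
  have E0 := expR_gt0 (q2 * n%:R).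
  apply: (@lt_le_trans _ _ ((C * (C' * L + 1) + 1) * expR (q2 * n%:R))); last by rewrite ler_pM2r.
  apply: (@le_lt_trans _ _ (C * (C' * L + 1) * expR (q2 * n%:R))); last first.
    by rewrite ltr_pM2r // ltrDl.
  rewrite -mulrA ler_pM2l // mulrDl mul1r lerD2r -mulrA ler_pM2l //.
  exact: lt_le_trans C'1.
have t0t : t0 <= t.
  rewrite ge_max t_0 /=; move: ts; rewrite ltr_distl => /andP [H _]; exact: ltW.
have Gt := growth_exponent_up d0 hg K0 HBK t00 t0t G.
rewrite (pressureE d0 hg (ltW K0) HBK t_0).
apply: (growth_rate_le (psum0 B t) C1 (Crate B t HBK t_0)).
apply: growth_le_mono Gt; rewrite -lerBrDl.
apply: (@le_trans _ _ (2 * h1 * (ln K + 1))).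
  apply: ler_pM; rewrite ?subr_ge0 //; last by rewrite lerDl.
  have -> : t - t0 = (t - s) + (s - t0) by ring.
  rewrite mulr_natl mulr2n; apply: lerD; last exact: st0.
  by move: ts; rewrite ltr_distl => /andP [_ H]; rewrite lerBlDl ltW.
apply: (@le_trans _ _ (2 * ((q - q1) / (2 * (ln K + 1))) * (ln K + 1))).
  by rewrite ler_pM2r // ler_pM2l // ge_min lexx orbT.
by rewrite le_eqVlt; apply/orP; left; apply/eqP; field; rewrite gt_eqF.
Qed.

End UpperSemicontinuity.

(** * Interpolating pairs of minor norms *)

Section WordWeights.
Context {R : realType} {S : finType} {F : seq (seq S)}.
Local Notation X := (sft F).
Variable g : X -> R.
Hypothesis hg : continuous g.

(** The exponential Birkhoff weight of a word; unlike the weights of points it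
    is exactly submultiplicative. *)
Definition Om (w : seq S) : R := wsup (fun y => expR (birkhoff_sum g (size w) y)) (size w) w.

Lemma birkhoff_bounded : exists K : nat -> R, forall n y, expR (birkhoff_sum g n y) <= K n.
Proof.
have [Ga Ga0 HGa] := continuous_bounded hg.
exists (fun n => expR (n%:R * Ga)) => n y.
rewrite ler_expR mulr_natl -[n in _ *+ n]card_ord -sumr_const; apply: ler_sum => i _.
exact: le_trans (ler_norm _) (HGa _).
Qed.

Lemma Om_ge0 w : 0 <= Om w.
Proof. by apply: wsup_ge0 => y; exact: expR_ge0. Qed.

Lemma Om_gt0 w : 0 < Om w -> exists y : X, pref y (size w) = w.
Proof. exact: wsup_gt0. Qed.

Lemma Om_ge (y : X) n : expR (birkhoff_sum g n y) <= Om (pref y n).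
Proof.
have [K HK] := birkhoff_bounded; rewrite /Om size_pref.
exact: (@wsup_ge R S F (fun z => expR (birkhoff_sum g n z)) n (K n) y (HK n)).
Qed.

Lemma Om_sub u v : Om (u ++ v) <= Om u * Om v.
Proof.
apply: wsup_le => [|y]; first by rewrite mulr_ge0 ?Om_ge0.
rewrite size_cat pref_add => /eqP; rewrite eqseq_cat ?size_pref // => /andP [/eqP Eu /eqP Ev].
rewrite birkhoff_sum_add expRD; apply: ler_pM; rewrite ?expR_ge0 //.
  by rewrite -{2}Eu; exact: Om_ge.
by rewrite -{2}Ev; exact: Om_ge.
Qed.

Lemma Om_variation e : 0 < e -> exists2 K, 0 <= K & forall n (y : X),
  Om (pref y n) <= expR (e * n%:R + K) * expR (birkhoff_sum g n y).
Proof.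
move=> /(birkhoff_variation hg) [K K0 HK]; exists K => // n y.
apply: wsup_le => [|z]; first by rewrite mulr_ge0 ?expR_ge0.
rewrite size_pref => zy; rewrite -expRD ler_expR addrC -lerBlDl.
by apply: le_trans (ler_norm _) _; exact: HK.
Qed.

End WordWeights.

Section WordSums.
Context {R : realType} {S : finType} {F : seq (seq S)} {d : nat}.
Hypothesis d0 : (0 < d)%N.
Local Notation X := (sft F).
Variable g : X -> R.
Hypothesis hg : continuous g.
Variables (A : X -> 'M[R]_d) (a : S -> 'M[R]_d).
Hypothesis Aa : forall x, A x = a (coord x 0%N).
Implicit Types (s : R) (p q : nat).

(** For a locally constant cocycle [phi] is constant on each cylinder. *)
Lemma psum_word s n : psum g A s n = wsum n (fun w => Om g w * phi s (wmat a w)).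
Proof.
have E0 (w : seq S) (y : X) : pref y (size w) = w ->
    cylval g A s (size w) y = expR (birkhoff_sum g (size w) y) * phi s (wmat a w).
  by move=> yw; rewrite /cylval (cocycle_prod_word Aa) yw.
have [K HK] := birkhoff_bounded hg.
apply: eq_wsum => w wn; subst n; apply/le_anti/andP; split.
  apply: wsup_le => [|y yw]; first by rewrite mulr_ge0 ?Om_ge0 ?phi_ge0.
  rewrite E0 // ler_wpM2r ?phi_ge0 // -[w in Om _ w]yw; exact: Om_ge.
have V0 : 0 <= wsup (cylval g A s (size w)) (size w) w.
  by apply: wsup_ge0 => y; exact: cylval_ge0.
have [->|ph0] := eqVneq (phi s (wmat a w)) 0; first by rewrite mulr0.
have ph : 0 < phi s (wmat a w) by rewrite lt_def ph0 phi_ge0.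
rewrite -ler_pdivlMr //; apply: wsup_le => [|y yw]; first by rewrite divr_ge0 // ltW.
rewrite ler_pdivlMr // -(E0 w) //.
apply: ub_le_sup; last by exists y.
exists (K (size w) * phi s (wmat a w)) => _ [z zw <-].
by rewrite E0 // ler_wpM2r ?phi_ge0.
Qed.

(** Interpolation between minor norms of sizes [p] and [q]. *)
Definition chi x y p q (M : 'M[R]_d) : R := minor_norm p M `^ x * minor_norm q M `^ y.

Definition wf x y p q (w : seq S) : R := Om g w * chi x y p q (wmat a w).

Lemma chi_ge0 x y p q M : 0 <= chi x y p q M.
Proof. by rewrite mulr_ge0 ?powR_ge0. Qed.

Lemma chi_mul x y p q M M' : 0 <= x -> 0 <= y ->
  chi x y p q (M *m M') <= chi x y p q M * chi x y p q M'.
Proof.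
move=> x0 y0; rewrite /chi mulrACA -!powRM ?minor_norm_ge0 //.
by apply: ler_pM; rewrite ?powR_ge0 //; apply: ler_powRl => //;
  rewrite ?minor_norm_ge0 //; exact: minor_normM.
Qed.

Lemma chi_gt0 x y p q M : 0 < x -> 0 < y ->
  0 < chi x y p q M -> 0 < minor_norm p M /\ 0 < minor_norm q M.
Proof.
move=> x0 y0 c0; split; rewrite lt_def minor_norm_ge0 andbT;
  apply: contraTneq c0; rewrite /chi => ->.
  by rewrite powR0 ?gt_eqF // mul0r ltxx.
by rewrite powR0 ?gt_eqF // mulr0 ltxx.
Qed.

Lemma wf_ge0 x y p q w : 0 <= wf x y p q w.
Proof. by rewrite mulr_ge0 ?Om_ge0 ?chi_ge0. Qed.

Lemma wf_sub x y p q u v : 0 <= x -> 0 <= y ->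
  wf x y p q (u ++ v) <= wf x y p q u * wf x y p q v.
Proof.
move=> x0 y0; rewrite /wf wmat_cat mulrACA.
apply: ler_pM; rewrite ?Om_ge0 ?chi_ge0 ?Om_sub //.
by rewrite [leRHS]mulrC; exact: chi_mul.
Qed.

(** The interpolations of [phi s] from below: by the chord between integers [p] and [q] around [s],
    by a single minor norm for integral [s], and by a power of the determinant beyond the dimension.  In
    the last two cases the exponent is split into equal halves so that all
    cases share one form with two positive exponents. *)
Definition valid x y p q s := (q <= d)%N /\
  [\/ [/\ (p < q)%N, p%:R < s, s < q%:R,
          x = (q%:R - s) / (q%:R - p%:R) & y = (s - p%:R) / (q%:R - p%:R)],
      [/\ p = q, s = q%:R, x = 2^-1 & y = 2^-1] |
      [/\ p = q, q = d, d%:R < s, x = s / d%:R / 2 & y = s / d%:R / 2]].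

Lemma valid_gt0 x y p q s : valid x y p q s -> 0 < x /\ 0 < y.
Proof.
move=> [_ [[pq ps sq -> ->]|[_ _ -> ->]|[_ _ ds -> ->]]].
- by rewrite !divr_gt0 ?subr_gt0 ?ltr_nat.
- by rewrite invr_gt0.
- by have s0 := le_lt_trans (ler0n _ d) ds; rewrite !divr_gt0 ?ltr0n.
Qed.

Lemma chi_same x p M : 0 <= x -> chi x x p p M = minor_norm p M `^ (x + x).
Proof. by move=> x0; rewrite /chi -powRDge0. Qed.

Lemma half_add (z : R) : z / 2 + z / 2 = z.
Proof. by rewrite -splitr. Qed.

Lemma valid_le_phi s : exists2 C : R, 1 <= C & forall x y p q M, valid x y p q s ->
  chi x y p q M <= C * phi s M.
Proof.
pose c : R := sv_const (R := R) (d := d).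
have c1 : 1 <= c by exact: sv_const_ge1.
have c0 : 0 <= c by apply: le_trans c1.
pose K : R := (d`! * (d ^ d * (d ^ d)) * d`!)%:R.
exists (c + K `^ (s / d%:R)) => [|x y p q M v].
  by apply: le_trans c1 _; rewrite lerDl powR_ge0.
have [x0 y0] := valid_gt0 v.
have phi0 := phi_ge0 s M.
rewrite mulrDl; case: v => qd [[pq ps sq xE yE]|[pE sE xE yE]|[pE qE ds xE yE]].
- apply: (@le_trans _ _ (c * phi s M)); last by rewrite lerDl mulr_ge0 ?powR_ge0.
  apply: le_trans (ler_wpM2l c0 (chord_le_phi M pq qd ps sq)); rewrite -xE -yE.
  have xy1 : x + y = 1.
    rewrite xE yE -mulrDl; have -> : q%:R - s + (s - p%:R) = q%:R - p%:R by ring.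
    by rewrite divff // subr_eq0 gt_eqF // ltr_nat.
  rewrite -[X in X * _](powRr1 c0) -xy1 (powRDge0 c (ltW x0) (ltW y0)) mulrACA.
  rewrite -(powRM x c0 (prod_sv_ge0 _ _)) -(powRM y c0 (prod_sv_ge0 _ _)).
  by apply: ler_pM; rewrite ?powR_ge0 //; apply: ler_powRl;
    rewrite ?minor_norm_ge0 ?minor_norm_le_sv ?ltW.
- apply: (@le_trans _ _ (c * phi s M)); last by rewrite lerDl mulr_ge0 ?powR_ge0.
  rewrite pE sE xE yE chi_same ?invr_ge0 // -[2^-1]mul1r half_add powRr1 ?minor_norm_ge0 //.
  by rewrite phi_nat //; exact: minor_norm_le_sv.
- apply: (@le_trans _ _ (K `^ (s / d%:R) * phi s M)); last by rewrite lerDr mulr_ge0.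
  have x00 : 0 <= s / d%:R / 2 by rewrite -xE ltW.
  rewrite pE xE yE chi_same // half_add qE phi_gt_dim // -powRM ?ler0n //.
  have s2 : 0 <= s / d%:R by rewrite -(half_add (s / d%:R)) addr_ge0.
  by apply: ler_powRl; rewrite ?minor_norm_ge0 ?minor_norm_le_det.
Qed.

(** On the unit segment that contains [s] the interpolation is an equality for
    products of singular values. *)
Lemma valid_exists s : 0 <= s -> exists x y p q, valid x y p q s /\
  exists2 C : R, 1 <= C & forall M, phi s M <= C * chi x y p q M.
Proof.
move=> s0; pose c : R := sv_const (R := R) (d := d).
have c1 : 1 <= c by exact: sv_const_ge1.
have c0 : 0 <= c by apply: le_trans c1.
have nat_case k : (k <= d)%N -> s = k%:R -> exists x y p q, valid x y p q s /\
  exists2 C : R, 1 <= C & forall M, phi s M <= C * chi x y p q M.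
  move=> kd sE; exists 2^-1, 2^-1, k, k; split; first by split=> //; apply: Or32.
  exists c => // M; rewrite chi_same ?invr_ge0 // -[2^-1]mul1r half_add powRr1 ?minor_norm_ge0 //.
  by rewrite sE phi_nat //; exact: sv_le_minor_norm.
have [ds|sd] := ltP d%:R s.
  exists (s / d%:R / 2), (s / d%:R / 2), d, d; split; first by split=> //; apply: Or33.
  have s2 : 0 <= s / d%:R by rewrite divr_ge0.
  exists 1 => // M; rewrite chi_same ?divr_ge0 // half_add mul1r phi_gt_dim //.
  by apply: ler_powRl => //; exact: det_le_minor_norm.
have [m [md]] := segment_exists d0 s0 sd.
rewrite le_eqVlt => /orP [/eqP E _|ms]; first by apply: (nat_case m); rewrite // ltnW.
rewrite le_eqVlt => /orP [/eqP E|sm]; first exact: (nat_case m.+1).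
exists (m.+1%:R - s), (s - m%:R), m, m.+1; split.
  have E : m.+1%:R - m%:R = 1 :> R by rewrite -natr1; ring.
  by split=> //; apply: Or31; rewrite E !divr1.
exists c => // M; rewrite (phi_interp M md (ltW ms) (ltW sm)).
have x0 : 0 <= m.+1%:R - s by rewrite subr_ge0 ltW.
have y0 : 0 <= s - m%:R by rewrite subr_ge0 ltW.
have E1 : (1 : R) = (m.+1%:R - s) + (s - m%:R) by rewrite -natr1; ring.
rewrite -[X in _ <= X * _](powRr1 c0) [X in c `^ X]E1.
rewrite (powRDge0 c x0 y0) mulrACA /chi -!(powRM _ c0 (minor_norm_ge0 _ _)).
by apply: ler_pM; rewrite ?powR_ge0 //; apply: ler_powRl;
  rewrite ?prod_sv_ge0 ?sv_le_minor_norm.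
Qed.

End WordSums.

(** * Matrices without a spectral gap *)

(** A concave sequence sampled at an end point ([le]), at its inner and outer
    neighbours ([l1], [l2]) and at the far end point ([lf]) of an interval of
    length [T]; the interpolation point is at distance [tau] from the near end
    point, and [L] is the height of the chord there.  Absence of a gap means
    that the sequence is almost affine at the end point. *)
Section ChordDeviation.
Context {R : realType}.
Variables (T tau lf le l1 l2 dl ga : R).
Hypothesis T1 : 1 <= T.
Hypothesis tau0 : 0 < tau.
Hypothesis tauT : tau < T.
Hypothesis dl0 : 0 <= dl.
Hypothesis ga0 : 0 <= ga.
Let T0 : 0 < T. Proof. exact: lt_le_trans T1. Qed.
Let L := (lf * tau + le * (T - tau)) / T.
Let dev := l1 - (le + (lf - le) / T).
Let Tt : 0 < T - tau. Proof. by rewrite subr_gt0. Qed.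
(** Lower bound for the height gained at the interpolation point per unit of
    height at the inner neighbour. *)
Definition dev_rate := Num.min tau ((T - tau) / T).

Lemma dev_rate_gt0 : 0 < dev_rate.
Proof. by rewrite lt_min tau0 divr_gt0. Qed.

(** If the inner neighbour is close to the chord and there is no gap, the outer
    neighbour is close to the extrapolated chord, so the longer chord is not
    much lower. *)
Lemma chord_extrapolate : dev <= dl -> 2 * le - ga <= l1 + l2 ->
  L <= (lf * (tau + 1) + l2 * (T - tau)) / (T + 1) + (dl + ga).
Proof.
move=> dv gp; have T10 : 0 < T + 1 by rewrite addr_gt0.
pose l2' := le - (lf - le) / T - (dl + ga).
have l2l : l2' <= l2.
  move: dv gp; rewrite /l2' /dev; set z := (lf - le) / T; lra.
apply: (@le_trans _ _ ((lf * (tau + 1) + l2' * (T - tau)) / (T + 1) + (dl + ga))); last first.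
  by rewrite lerD2r ler_pM2r ?invr_gt0 // lerD2l ler_pM2r.
have -> : (lf * (tau + 1) + l2' * (T - tau)) / (T + 1) =
    L - (dl + ga) * ((T - tau) / (T + 1)).
  by rewrite /l2' /L; field; rewrite !gt_eqF.
rewrite -addrA lerDl addrC subr_ge0 ler_piMr ?addr_ge0 // ler_pdivrMr // mul1r.
move: tau0; lra.
Qed.

Let rate_le c : tau <= c \/ (T - tau) / T <= c -> dl <= dev -> L + dev_rate * dl <= L + c * dev.
Proof.
move=> Hc dd; rewrite lerD2l; apply: ler_pM => //; first exact/ltW/dev_rate_gt0.
by rewrite /dev_rate ge_min; case: Hc => ->; rewrite ?orbT.
Qed.

Lemma chord_inner_far : dl <= dev -> 1 < tau ->
  L + dev_rate * dl <= (lf * (tau - 1) + l1 * (T - tau)) / (T - 1).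
Proof.
move=> dd t1; have Tm : 0 < T - 1 by move: tauT t1; lra.
apply: le_trans (rate_le (c := (T - tau) / (T - 1)) _ dd) _.
  right; apply: ler_wpM2l; first exact: ltW.
  by rewrite lef_pV2 ?posrE // gerBl.
by rewrite le_eqVlt; apply/orP; left; apply/eqP; rewrite /L /dev; field; rewrite !gt_eqF.
Qed.

Lemma chord_inner_at : dl <= dev -> tau = 1 -> L + dev_rate * dl <= l1.
Proof.
move=> dd t1; apply: le_trans (rate_le (c := 1) _ dd) _; first by left; rewrite t1.
by rewrite le_eqVlt; apply/orP; left; apply/eqP; rewrite /L /dev t1; field; rewrite gt_eqF.
Qed.

Lemma chord_inner_near : dl <= dev ->
  L + dev_rate * dl <= le * (1 - tau) + l1 * tau.
Proof.
move=> dd; apply: le_trans (rate_le (c := tau) _ dd) _; first by left.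
by rewrite le_eqVlt; apply/orP; left; apply/eqP; rewrite /L /dev; field; rewrite gt_eqF.
Qed.

End ChordDeviation.

Section SpectralGap.
Context {R : realType} {S : finType} {F : seq (seq S)} {d : nat}.
Hypothesis d0 : (0 < d)%N.
Implicit Types (M : 'M[R]_d).

(** There is no minor norm of size [k - 1] for [k = 0]; that norm is constant,
    so the gap term is taken to be 0. *)
Definition gapG (k : nat) M : R :=
  if k is k'.+1 then minor_norm k' M * minor_norm k'.+2 M else 0.

Lemma gapG_ge0 k M : 0 <= gapG k M.
Proof. by case: k => // k; rewrite mulr_ge0 ?minor_norm_ge0. Qed.

Lemma gapGM k M N : gapG k (M *m N) <= gapG k M * gapG k N.
Proof.
case: k => [|k]; first by rewrite mul0r.
rewrite /gapG mulrACA; apply: ler_pM; rewrite ?minor_norm_ge0 //; exact: minor_normM.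
Qed.

Lemma ln_chi x y p q M : 0 < minor_norm p M -> 0 < minor_norm q M ->
  ln (chi x y p q M) = x * ln (minor_norm p M) + y * ln (minor_norm q M).
Proof. by move=> p0 q0; rewrite /chi lnM ?posrE ?powR_gt0 // !ln_powR. Qed.

Lemma chi_pos x y p q M : 0 < minor_norm p M -> 0 < minor_norm q M ->
  0 < chi x y p q M.
Proof. by move=> p0 q0; rewrite mulr_gt0 ?powR_gt0. Qed.

(** A matrix without a gap at [k] either is controlled by the longer pair
    [(p', q')] or gains exponentially against [phi]; [dl] is the trade-off
    between the two terms. *)
Definition controlled k s x y p q x' y' p' q' (C ka : R) := forall (M : 'M[R]_d) (dl ga : R),
  0 <= dl -> 0 <= ga -> 0 < chi x y p q M ->
  expR (- ga) * minor_norm k M ^+ 2 < gapG k M ->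
  chi x y p q M <= expR (dl + ga) * chi x' y' p' q' M + C * (expR (- (ka * dl)) * phi s M).

Lemma ln_nongap k ga M : 0 < minor_norm k.+1 M ->
  expR (- ga) * minor_norm k.+1 M ^+ 2 < gapG k.+1 M ->
  [/\ 0 < minor_norm k M, 0 < minor_norm k.+2 M &
  2 * ln (minor_norm k.+1 M) - ga <= ln (minor_norm k M) + ln (minor_norm k.+2 M)].
Proof.
move=> N0 H.
have E0 : 0 < expR (- ga) * minor_norm k.+1 M ^+ 2 by rewrite mulr_gt0 ?expR_gt0 ?exprn_gt0.
have G0 : 0 < minor_norm k M * minor_norm k.+2 M by apply: lt_trans H.
have k0 : 0 < minor_norm k M.
  by rewrite lt_def minor_norm_ge0 andbT; apply: contraTneq G0 => ->; rewrite mul0r ltxx.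
have k2 : 0 < minor_norm k.+2 M by rewrite pmulr_rgt0 in G0.
split=> //; rewrite -lnM ?posrE //.
have -> : 2 * ln (minor_norm k.+1 M) - ga = ln (expR (- ga) * minor_norm k.+1 M ^+ 2).
  by rewrite lnM ?posrE ?expR_gt0 ?exprn_gt0 // expRK lnXn // mulr2n; ring.
by rewrite ler_ln ?posrE // ltW.
Qed.

Lemma le_ln_chi (u v c : R) : 0 < u -> 0 < v -> ln u <= ln v + c -> u <= expR c * v.
Proof.
by move=> u0 v0 H; rewrite -[u]lnK // -[v]lnK // -expRD ler_expR addrC.
Qed.

(** Compares the deviation from the chord at the inner neighbour with [dl]. *)
Lemma control_step s x y p q x' y' p' q' C ka (M : 'M[R]_d) (dl ga dev : R) :
  (forall x y p q M, valid (d := d) x y p q s -> chi x y p q M <= C * phi s M) ->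
  0 <= C ->
  0 < minor_norm p M -> 0 < minor_norm q M ->
  0 < minor_norm p' M -> 0 < minor_norm q' M ->
  (dev <= dl -> ln (chi x y p q M) <= ln (chi x' y' p' q' M) + (dl + ga)) ->
  (dl <= dev -> exists x1 y1 p1 q1, [/\ valid (d := d) x1 y1 p1 q1 s,
     0 < minor_norm p1 M, 0 < minor_norm q1 M &
     ln (chi x y p q M) + ka * dl <= ln (chi x1 y1 p1 q1 M)]) ->
  chi x y p q M <= expR (dl + ga) * chi x' y' p' q' M + C * (expR (- (ka * dl)) * phi s M).
Proof.
move=> HC C0 p0 q0 p0' q0' H1 H2; case: (leP dev dl) => h.
  apply: (@le_trans _ _ (expR (dl + ga) * chi x' y' p' q' M)).
    by apply: le_ln_chi (H1 h); exact: chi_pos.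
  by rewrite lerDl !mulr_ge0 ?expR_ge0 ?phi_ge0.
have [x1 [y1 [p1 [q1 [v p10 q10 H]]]]] := H2 (ltW h).
apply: (@le_trans _ _ (expR (- (ka * dl)) * chi x1 y1 p1 q1 M)).
  by apply: le_ln_chi; rewrite ?chi_pos // lerBrDr.
apply: (@le_trans _ _ (C * (expR (- (ka * dl)) * phi s M))).
  by rewrite [leRHS]mulrCA; apply: ler_wpM2l; [exact: expR_ge0|exact: HC].
by rewrite lerDr mulr_ge0 ?expR_ge0 ?chi_ge0.
Qed.

Lemma dist_ge1 p q : (p < q)%N -> 1 <= q%:R - p%:R :> R.
Proof. by move=> pq; rewrite lerBrDr -(natrD _ 1) ler_nat. Qed.

Lemma combE (u v al be T : R) : al / T * u + be / T * v = (u * al + v * be) / T.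
Proof. by ring. Qed.

Lemma combEC (u v al be T : R) : al / T * u + be / T * v = (v * be + u * al) / T.
Proof. by ring. Qed.

(** The deviation of the inner neighbour [q - 1] from the chord decides: a small
    one yields the pair [(p, q + 1)] by extrapolation; a large one raises the
    interpolation through [q - 1], which is still below [phi].  That
    interpolation uses [(p, q - 1)], [(q - 1, q - 1)] or [(q - 1, q)] according to the position of
    [s]. *)
Lemma control_right s x y p q : (q < d)%N -> valid (d := d) x y p q s -> (p < q)%N ->
  exists x' y' C ka, [/\ valid (d := d) x' y' p q.+1 s, 1 <= C, 0 < ka &
    controlled q s x y p q x' y' p q.+1 C ka].
Proof.
move=> qd v pq; have [C C1 HC] := valid_le_phi d0 s; have [x0 y0] := valid_gt0 d0 v.
have C0 : 0 <= C by apply: le_trans C1.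
case: v => _ [[_ ps sq xE yE]|[E]|[E]]; last 2 first.
- by rewrite E ltnn in pq.
- by rewrite E ltnn in pq.
case: q => [//|q] in qd pq sq xE yE *.
set T := q.+1%:R - p%:R : R; pose tau := q.+1%:R - s.
have T1 : 1 <= T by exact: dist_ge1.
have tau0 : 0 < tau by rewrite subr_gt0.
have tauT : tau < T by rewrite /tau /T ltrD2l ltrN2.
have Es : s - p%:R = T - tau by rewrite /T /tau; ring.
have Eq2 : q.+2%:R = q.+1%:R + 1 :> R by rewrite natr1.
exists ((tau + 1) / (T + 1)), ((T - tau) / (T + 1)), C, (dev_rate T tau); split => //.
- split; first exact: qd.
  apply: Or31; split; [exact: ltn_trans pq (ltnSn _)|exact: ps| | |]; rewrite Eq2.
  + by apply: lt_trans sq _; rewrite ltrDl.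
  + by rewrite /tau /T; congr (_ / _); ring.
  + by rewrite Es /T; congr (_ / _); ring.
- exact: dev_rate_gt0.
move=> M dl ga dl0 ga0 c0 ng.
have [p0 q0] := chi_gt0 x0 y0 c0.
have [r0 q2 Hl] := ln_nongap q0 ng.
apply: (control_step (dev := ln (minor_norm q M) -
   (ln (minor_norm q.+1 M) + (ln (minor_norm p M) - ln (minor_norm q.+1 M)) / T)) HC) => //.
- move=> dv; have := chord_extrapolate T1 tau0 tauT dl0 ga0 dv Hl.
  rewrite !ln_chi // xE yE Es -/T -/tau => H; apply: le_trans (le_trans H _).
    by rewrite combE.
  by rewrite lerD2r combE.
- move=> dv.
  have LE : ln (chi x y p q.+1 M) = (ln (minor_norm p M) * tau + ln (minor_norm q.+1 M) * (T - tau)) / T.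
    by rewrite ln_chi // xE yE Es -/T -/tau combE.
  rewrite LE.
  have Eq : q.+1%:R = q%:R + 1 :> R by rewrite natr1.
  have [t1|t1|t1] := ltgtP tau 1.
  + exists tau, (1 - tau), q, q.+1; split => //.
      split; first exact: ltnW.
      apply: Or31; rewrite /tau Eq; have -> : q%:R + 1 - q%:R = 1 :> R by ring.
      rewrite !divr1; split => //.
      - by move: t1; rewrite /tau Eq; lra.
      - by rewrite -Eq.
      - by ring.
    apply: le_trans (chord_inner_near T1 tau0 tauT dl0 dv) _.
    by rewrite ln_chi // addrC ![_ * ln _]mulrC.
  + have pq' : (p < q)%N.
      rewrite -(ltr_nat R); move: t1 ps; rewrite /tau Eq; lra.
    exists ((tau - 1) / (T - 1)), ((T - tau) / (T - 1)), p, q; split => //.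
      split; first by apply: ltnW; apply: ltnW.
      apply: Or31; split => //; first by move: t1; rewrite /tau Eq; lra.
        by rewrite /tau /T Eq; congr (_ / _); ring.
      by rewrite Es /T Eq; congr (_ / _); ring.
    apply: le_trans (chord_inner_far T1 tau0 tauT dl0 dv t1) _.
    by rewrite ln_chi // combE.
  + exists 2^-1, 2^-1, q, q; split => //.
      split; first by apply: ltnW; apply: ltnW.
      apply: Or32; split => //; move: t1; rewrite /tau Eq; lra.
    apply: le_trans (chord_inner_at T1 tau0 tauT dl0 dv t1) _.
    by rewrite ln_chi //; lra.
Qed.

(** Mirror image of [control_right]. *)
Lemma control_left s x y p q : (0 < p)%N -> valid (d := d) x y p q s -> (p < q)%N ->
  exists x' y' C ka, [/\ valid (d := d) x' y' p.-1 q s, 1 <= C, 0 < ka &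
    controlled p s x y p q x' y' p.-1 q C ka].
Proof.
move=> p0 v pq; have [C C1 HC] := valid_le_phi d0 s; have [x0 y0] := valid_gt0 d0 v.
have C0 : 0 <= C by apply: le_trans C1.
case: v => qd [[_ ps sq xE yE]|[E]|[E]]; last 2 first.
- by rewrite E ltnn in pq.
- by rewrite E ltnn in pq.
case: p => [//|p] in p0 pq ps xE yE *; rewrite [p.+1.-1]/=.
set T := q%:R - p.+1%:R : R; pose tau := s - p.+1%:R.
have T1 : 1 <= T by exact: dist_ge1.
have tau0 : 0 < tau by rewrite subr_gt0.
have tauT : tau < T by rewrite /tau /T ltrD2r.
have Es : q%:R - s = T - tau by rewrite /T /tau; ring.
have Ep : p.+1%:R = p%:R + 1 :> R by rewrite natr1.
exists ((T - tau) / (T + 1)), ((tau + 1) / (T + 1)), C, (dev_rate T tau); split => //.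
- split; first exact: qd.
  apply: Or31; split; [exact: ltn_trans (ltnSn p) pq| |exact: sq| |].
  + by apply: lt_trans ps; rewrite Ep ltrDl.
  + by rewrite Es /T Ep; congr (_ / _); ring.
  + by rewrite /tau /T Ep; congr (_ / _); ring.
- exact: dev_rate_gt0.
move=> M dl ga dl0 ga0 c0 ng.
have [N0 q0] := chi_gt0 x0 y0 c0.
have [r0 p2 Hl] := ln_nongap N0 ng.
rewrite [leRHS]addrC in Hl.
apply: (control_step (dev := ln (minor_norm p.+2 M) -
   (ln (minor_norm p.+1 M) + (ln (minor_norm q M) - ln (minor_norm p.+1 M)) / T)) HC) => //.
- move=> dv; have := chord_extrapolate T1 tau0 tauT dl0 ga0 dv Hl.
  rewrite !ln_chi // xE yE Es -/T -/tau => H; apply: le_trans (le_trans H _).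
    by rewrite combEC.
  by rewrite lerD2r combEC.
- move=> dv.
  have LE : ln (chi x y p.+1 q M) = (ln (minor_norm q M) * tau + ln (minor_norm p.+1 M) * (T - tau)) / T.
    by rewrite ln_chi // xE yE Es -/T -/tau combEC.
  rewrite LE.
  have Ep2 : p.+2%:R = p%:R + 1 + 1 :> R by rewrite -!natr1.
  have [t1|t1|t1] := ltgtP tau 1.
  + exists (1 - tau), tau, p.+1, p.+2; split => //.
      split; first exact: leq_trans pq qd.
      apply: Or31; rewrite Ep2 Ep; have -> : p%:R + 1 + 1 - (p%:R + 1) = 1 :> R by ring.
      rewrite !divr1; split => //; first by rewrite -Ep.
      - by move: t1; rewrite /tau Ep; lra.
      - by rewrite /tau Ep; ring.
      - by rewrite /tau Ep; ring.
    apply: le_trans (chord_inner_near T1 tau0 tauT dl0 dv) _.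
    by rewrite ln_chi // ![_ * ln _]mulrC.
  + have pq' : (p.+2 < q)%N.
      rewrite -(ltr_nat R) Ep2; move: t1 sq; rewrite /tau Ep; lra.
    exists ((T - tau) / (T - 1)), ((tau - 1) / (T - 1)), p.+2, q; split => //.
      split => //.
      apply: Or31; split => //; first by move: t1; rewrite Ep2 /tau Ep; lra.
        by rewrite Es /T Ep2 Ep; congr (_ / _); ring.
      by rewrite /tau /T Ep2 Ep; congr (_ / _); ring.
    apply: le_trans (chord_inner_far T1 tau0 tauT dl0 dv t1) _.
    by rewrite ln_chi // combEC.
  + exists 2^-1, 2^-1, p.+2, p.+2; split => //.
      split; first exact: leq_trans pq qd.
      apply: Or32; split => //; move: t1; rewrite Ep2 /tau Ep; lra.
    apply: le_trans (chord_inner_at T1 tau0 tauT dl0 dv t1) _.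
    by rewrite ln_chi //; lra.
Qed.

(** Without a gap at [p = s] the norm of size [p] is at most the geometric mean of its
    neighbours, up to the gap bound. *)
Lemma control_diag s x y p : (0 < p)%N -> (p < d)%N -> valid (d := d) x y p p s ->
  exists x' y' C ka, [/\ valid (d := d) x' y' p.-1 p.+1 s, 1 <= C, 0 < ka &
    controlled p s x y p p x' y' p.-1 p.+1 C ka].
Proof.
move=> p0 pd [_ [[pq]|[_ sE xE yE]|[_ E]]]; first by rewrite ltnn in pq.
- case: p => [//|p] in p0 pd sE *; rewrite [p.+1.-1]/=.
  have x20 : 0 < 2^-1 :> R by rewrite invr_gt0.
  exists 2^-1, 2^-1, 1, 1; split => //.
    have e1 : p.+1%:R = p%:R + 1 :> R by rewrite natr1.
    have e2 : p.+2%:R = p%:R + 2 :> R by rewrite -natrD addn2.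
    have e3 : p%:R + 2 - p%:R = 2 :> R by ring.
    split; first exact: pd.
    apply: Or31; rewrite sE e2 e3 e1; split.
    - exact: ltn_trans (ltnSn p) (ltnSn _).
    - by rewrite ltrDl.
    - by rewrite ltrD2l ltr1n.
    - by rewrite -[LHS]mul1r; congr (_ / _); ring.
    - by rewrite -[LHS]mul1r; congr (_ / _); ring.
  move=> M dl ga dl0 ga0 c0 ng; rewrite xE yE in c0 *.
  have [N0 _] := chi_gt0 x20 x20 c0.
  have [r0 p2 Hl] := ln_nongap N0 ng.
  apply: (@le_trans _ _ (expR (dl + ga) * chi 2^-1 2^-1 p p.+2 M)); last first.
    by rewrite lerDl !mulr_ge0 ?expR_ge0 ?phi_ge0.
  by apply: le_ln_chi; rewrite ?chi_pos // !ln_chi //; lra.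
by rewrite E ltnn in pd.
Qed.

Lemma gapG_dim M : gapG d M = 0.
Proof.
have -> : gapG d M = gapG d.-1.+1 M by rewrite prednK.
by rewrite /gapG (minor_norm_gt_dim M (k := d.-1.+2)) ?mulr0 // prednK.
Qed.

Lemma control_exists s x y p q k : valid (d := d) x y p q s -> k = p \/ k = q ->
  (forall M, gapG k M = 0) \/ exists x' y' p' q' C ka,
  [/\ valid (d := d) x' y' p' q' s, (q - p < q' - p')%N, 1 <= C, 0 < ka &
   controlled k s x y p q x' y' p' q' C ka].
Proof.
move=> v kpq.
have [k0|] := posnP k; first by left=> M; rewrite k0.
have [kd|dk] := ltnP k d; last first.
  move=> _; left=> M; have -> : k = d; last exact: gapG_dim.
  apply/eqP; rewrite eqn_leq dk andbT; case: v => qd H.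
  case: kpq => -> //; case: H => [[pq]|[->]|[->]] //; by rewrite (leq_trans (ltnW pq)).
have [pq|qp] := ltnP p q.
  case: kpq kd => -> kd k0; right.
  - have [x' [y' [C [ka [v' C1 ka0 H]]]]] := control_left k0 v pq.
    exists x', y', p.-1, q, C, ka; split => //.
    by apply: ltn_sub2l; rewrite ?prednK // (leq_trans _ pq) // ltnS leq_pred.
  - have [x' [y' [C [ka [v' C1 ka0 H]]]]] := control_right kd v pq.
    by exists x', y', p, q.+1, C, ka; split => //; rewrite subSn // ltnW.
have E : p = q by case: v => _ [[pq]|[->]|[->]] //; rewrite ltnNge qp in pq.
rewrite -{}E in v kpq *; have {kpq}kp : k = p by case: kpq.
rewrite {}kp in kd * => p0; right.
have [x' [y' [C [ka [v' C1 ka0 H]]]]] := control_diag p0 kd v.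
exists x', y', p.-1, p.+1, C, ka; split => //.
by rewrite subnn subn_gt0 ltnS leq_pred.
Qed.

End SpectralGap.

(** * The dominant pair *)

Section DominantPair.
Context {R : realType} {S : finType} {F : seq (seq S)} {d : nat}.
Hypothesis d0 : (0 < d)%N.
Local Notation X := (sft F).
Variable g : X -> R.
Hypothesis hg : continuous g.
Variables (A : X -> 'M[R]_d) (a : S -> 'M[R]_d).
Hypothesis Aa : forall x, A x = a (coord x 0%N).
Variables (s P : R).
Hypothesis s0 : 0 <= s.
Hypothesis pressure_up : forall e, 0 < e -> growth_le (psum g A s) (P + e).
Hypothesis pressure_low : forall r, r < P -> ~ growth_le (psum g A s) r.

Local Notation wf := (wf g a).
Local Notation valid x y p q := (@valid R d x y p q s).

Definition wsums x y p q n := wsum n (wf x y p q).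
(** The pair grows at least at the rate [P] of the pressure. *)
Definition full x y p q := forall r, r < P -> ~ growth_le (wsums x y p q) r.

Lemma wsums_up x y p q e : valid x y p q -> 0 < e -> growth_le (wsums x y p q) (P + e).
Proof.
move=> v e0; have [K K0 HK] := pressure_up e0; have [C C1 HC] := valid_le_phi d0 s.
have C0 : 0 < C by apply: lt_le_trans C1.
exists (C * K) => [|n]; first exact: mulr_gt0.
apply: (@le_trans _ _ (C * psum g A s n)); last by rewrite -mulrA ler_pM2l.
rewrite (psum_word hg Aa) -wsumZ; apply: ler_wsum => w _.
by rewrite /wf [leRHS]mulrCA; apply: ler_wpM2l; [exact: Om_ge0|exact: HC].
Qed.

Lemma full_exists : exists x y p q, valid x y p q /\ full x y p q.
Proof.
have [x [y [p [q [v [C C1 HC]]]]]] := valid_exists d0 s0.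
exists x, y, p, q; split=> // r rP [K K0 HK]; apply: (pressure_low rP).
have C0 : 0 < C by apply: lt_le_trans C1.
exists (C * K) => [|n]; first exact: mulr_gt0.
apply: (@le_trans _ _ (C * wsums x y p q n)); last by rewrite -mulrA ler_pM2l.
rewrite (psum_word hg Aa) -wsumZ; apply: ler_wsum => w _.
by rewrite /wf [leRHS]mulrCA; apply: ler_wpM2l; [exact: Om_ge0|exact: HC].
Qed.

(** Pairs live in [[0, d]], so a full pair of maximal length exists. *)
Lemma dominant_pair : exists x y p q, [/\ valid x y p q, full x y p q &
  forall x' y' p' q', valid x' y' p' q' -> (q - p < q' - p')%N ->
    exists2 r, r < P & growth_le (wsums x' y' p' q') r].
Proof.
have [x [y [p [q [v f]]]]] := full_exists.
have [m] := ubnP (d - (q - p))%N; elim: m => // m IH in x y p q v f *.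
move=> dm; have [H|H] := pselect (exists x' y' p' q',
    [/\ valid x' y' p' q', (q - p < q' - p')%N & full x' y' p' q']).
  have [x' [y' [p' [q' [v' l f']]]]] := H; apply: (IH x' y' p' q' v' f').
  have q'd : (q' - p' <= d)%N by apply: leq_trans (leq_subr _ _) _; case: v'.
  apply: leq_trans (_ : (d - (q - p) <= m)%N); last by rewrite -ltnS.
  by apply: ltn_sub2l => //; apply: leq_trans q'd.
exists x, y, p, q; split => // x' y' p' q' v' l.
apply: contrapT => H'; apply: H; exists x', y', p', q'; split => // r rP G.
by apply: H'; exists r.
Qed.

(** Choose the trade-off [dl] of [controlled] proportional to the length: the
    longer pair grows at a rate [r < P], and the second term gains [ka * dl]. *)
Lemma nongap_mass x y p q k :
  valid x y p q ->
  (forall x' y' p' q', valid x' y' p' q' -> (q - p < q' - p')%N ->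
    exists2 r, r < P & growth_le (wsums x' y' p' q') r) ->
  k = p \/ k = q ->
  exists2 ga1, 0 < ga1 & exists2 K, 0 < K & forall ga b, 0 <= ga -> ga <= ga1 ->
    wsum b (fun w => if `[< 0 < wf x y p q w /\
       expR (- (ga * b%:R)) * minor_norm k (wmat a w) ^+ 2 < gapG k (wmat a w) >]
       then wf x y p q w else 0) <= K * expR ((P - ga1) * b%:R).
Proof.
move=> v mx kpq; have [G0|] := control_exists d0 v kpq.
  exists 1 => //; exists 1 => // ga b _ _.
  rewrite (@eq_wsum _ _ b _ (fun w => 0 * 0)); last first.
    move=> w _; rewrite mulr0; case: asboolP => // -[_]; rewrite G0 ltNge.
    by rewrite mulr_ge0 ?expR_ge0 ?sqr_ge0.
  by rewrite wsumZ mul0r mul1r expR_ge0.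
move=> [x' [y' [p' [q' [C [ka [v' l C1 ka0 ctl]]]]]]].
have [r rP [K1 K10 HK1]] := mx _ _ _ _ v' l.
have C0 : 0 < C by apply: lt_le_trans C1.
pose de := (P - r) / 4; have de0 : 0 < de by rewrite divr_gt0 // subr_gt0.
have e0 : 0 < ka * de / 2 by rewrite divr_gt0 // mulr_gt0.
have [K2 K20 HK2] := pressure_up e0.
exists (Num.min de (ka * de / 2)); first by rewrite lt_min de0.
set ga1 := Num.min _ _.
have ga1d : ga1 <= de by rewrite ge_min lexx.
have ga1k : ga1 <= ka * de / 2 by rewrite ge_min lexx orbT.
exists (K1 + C * K2) => [|ga b gg gg1]; first by rewrite addr_gt0 ?mulr_gt0.
have b0 : 0 <= b%:R :> R by [].
apply: (@le_trans _ _ (wsum b (fun w => expR (de * b%:R + ga * b%:R) * wf x' y' p' q' w +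
   C * expR (- (ka * (de * b%:R))) * (Om g w * phi s (wmat a w))))).
  apply: ler_wsum => w _; case: asboolP => [[w0 ng]|_]; last first.
    apply: addr_ge0; first by apply: mulr_ge0; [exact: expR_ge0|exact: wf_ge0].
    by rewrite !mulr_ge0 ?expR_ge0 ?Om_ge0 ?phi_ge0 ?(ltW C0).
  have O0 : 0 < Om g w.
    by rewrite lt_def Om_ge0 andbT; apply: contraTneq w0; rewrite /wf => ->; rewrite mul0r ltxx.
  have c0 : 0 < chi x y p q (wmat a w) by move: w0; rewrite /wf pmulr_rgt0.
  have H := ctl (wmat a w) (de * b%:R) (ga * b%:R) (mulr_ge0 (ltW de0) b0) (mulr_ge0 gg b0) c0 ng.
  rewrite /wf; apply: le_trans (ler_wpM2l (ltW O0) H) _.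
  rewrite mulrDr; set u := expR _; set z := expR _; set c := chi _ _ _ _ _; set f := phi _ _.
  by rewrite mulrCA [X in _ + X <= _]mulrCA (mulrCA (Om g w) z f) (mulrA C z).
rewrite wsumD !wsumZ -(psum_word hg Aa) (mulrDl K1); apply: lerD.
  apply: (@le_trans _ _ (expR (de * b%:R + ga * b%:R) * (K1 * expR (r * b%:R)))).
    by apply: ler_wpM2l; [exact: expR_ge0|exact: HK1].
  rewrite mulrCA -expRD ler_pM2l // ler_expR -!mulrDl ler_wpM2r //.
  have : P - r = 4 * de by rewrite /de; field.
  lra.
apply: (@le_trans _ _ (C * expR (- (ka * (de * b%:R))) * (K2 * expR ((P + ka * de / 2) * b%:R)))).
  by apply: ler_wpM2l; [rewrite mulr_ge0 ?expR_ge0 // ltW|exact: HK2].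
rewrite mulrACA -expRD ler_pM2l ?mulr_gt0 // ler_expR mulrA -mulNr -mulrDl ler_wpM2r //.
lra.
Qed.

Lemma wsums_sub x y p q n m : 0 <= x -> 0 <= y ->
  wsums x y p q (n + m) <= 1 * (wsums x y p q n * wsums x y p q m).
Proof.
move=> x0 y0; rewrite mul1r; apply: wsum_submul => [w|u v]; first exact: wf_ge0.
exact: wf_sub.
Qed.

(** Exact submultiplicativity turns the growth rate into a lower bound without
    a constant, also at length 0. *)
Lemma wsums_low x y p q : 0 <= x -> 0 <= y -> full x y p q ->
  forall n, expR (P * n%:R) <= wsums x y p q n.
Proof.
move=> x0 y0 fl.
have W0 n : 0 <= wsums x y p q n by apply: wsum_ge0 => w _; exact: wf_ge0.
have pos n : (0 < n)%N -> expR (P * n%:R) <= wsums x y p q n.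
  move=> n0; have n0R : 0 < n%:R :> R by rewrite ltr0n.
  have H r : r < P -> expR (r * n%:R) <= wsums x y p q n.
    move=> rP; have [G|/(_ n n0)] := growth_dichotomy W0 (lexx 1)
      (fun n m => wsums_sub p q n m x0 y0) r; last by rewrite mul1r.
    by case: (fl r rP).
  have w0 : 0 < wsums x y p q n.
    by apply: lt_le_trans (H (P - 1) _); rewrite ?expR_gt0 // ltrBlDr ltrDl.
  rewrite -[leRHS]lnK // ler_expR -ler_pdivlMr //.
  apply/ler_addgt0Pr => e e0; rewrite -lerBlDr ler_pdivlMr //.
  rewrite -ler_expR lnK //; apply: H; by rewrite ltrBlDr ltrDl.
case=> [|n]; last exact: pos.
rewrite mulr0 expR0.
have w1 : 0 < wsums x y p q 1 by apply: lt_le_trans (pos 1%N _); rewrite ?expR_gt0.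
have := wsums_sub p q 0 1 x0 y0; rewrite add0n mul1r.
by rewrite -{1}[wsums x y p q 1]mul1r ler_pM2r.
Qed.

End DominantPair.

(** * Loops in the products of a locally constant cocycle *)

Lemma four_le n1 n2 n3 n4 : let b := (n1 + n2 + n3 + n4).+1 in
  [/\ (n1 <= b)%N, (n2 <= b)%N, (n3 <= b)%N & (n4 <= b)%N].
Proof. by split; lia. Qed.

Section Gap.
Context {R : realType} {d : nat}.
Hypothesis d0 : (0 < d)%N.

Lemma gap_const k : (k <= d)%N -> exists2 C : R, 1 <= C & forall X Y Z : 'M[R]_d,
  minor_norm k (X *m Y) * minor_norm k (Y *m Z) <=
  C * (minor_norm k (X *m Y *m Z) * minor_norm k Y +
       minor_norm k X * minor_norm k Z * gapG k Y).
Proof.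
case: k => [_|k kd]; last by have [C C1 HC] := @minor_norm_gap R d k kd; exists C.
exists 1 => // X Y Z; rewrite !minor_norm0 /gapG !mulr0 addr0 !mulr1; exact: lexx.
Qed.

Lemma gapG_le k (M : 'M[R]_d) : gapG k M <= sv_const (R := R) (d := d) ^+ 4 * minor_norm k M ^+ 2.
Proof.
case: k => [|k]; last exact: minor_norm_logconcave.
have c1 : 1 <= sv_const (R := R) (d := d) by exact: sv_const_ge1.
by rewrite mulr_ge0 ?sqr_ge0 // exprn_ge0 // (le_trans _ c1).
Qed.

End Gap.

Lemma unblock1 (S : finType) b (c : b.-tuple S) : unblock [:: c] = c.
Proof. by rewrite /unblock /= cats0. Qed.

Section Loops.
Context {R : realType} {S : finType} {F : seq (seq S)} {d : nat}.
Hypothesis d0 : (0 < d)%N.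
Local Notation X := (sft F).
Variable g : X -> R.
Hypothesis hg : continuous g.
Variables (A : X -> 'M[R]_d) (a : S -> 'M[R]_d).
Hypothesis Aa : forall x, A x = a (coord x 0%N).
Variables (s P : R).
Hypothesis s0 : 0 <= s.
Hypothesis pressure_up : forall e, 0 < e -> growth_le (psum g A s) (P + e).
Hypothesis pressure_low : forall r, r < P -> ~ growth_le (psum g A s) r.
Local Notation valid x y p q := (@valid R d x y p q s).

(** Both ends of the pair are treated alike through a boolean index. *)
Definition endpoint (p q : nat) (i : bool) := if i then q else p.
Definition blockf x y p q {b} (W : seq (b.-tuple S)) : R := wf g a x y p q (unblock W).
Definition blockN p q {b} i (W : seq (b.-tuple S)) : R :=
  minor_norm (endpoint p q i) (wmat a (unblock W)).
Definition blockG p q {b} i (W : seq (b.-tuple S)) : R :=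
  gapG (endpoint p q i) (wmat a (unblock W)).

Lemma wf_gt0 x y p q w : 0 < x -> 0 < y -> 0 < wf g a x y p q w ->
  [/\ 0 < Om g w, 0 < minor_norm p (wmat a w) & 0 < minor_norm q (wmat a w)].
Proof.
move=> x0 y0 w0.
have O0 : 0 < Om g w.
  by rewrite lt_def Om_ge0 andbT; apply: contraTneq w0; rewrite /wf => ->; rewrite mul0r ltxx.
have c0 : 0 < chi x y p q (wmat a w) by move: w0; rewrite /wf pmulr_rgt0.
by have [] := chi_gt0 x0 y0 c0.
Qed.

Lemma ln_wf x y p q w : 0 < Om g w -> 0 < minor_norm p (wmat a w) ->
  0 < minor_norm q (wmat a w) ->
  ln (wf g a x y p q w) =
  ln (Om g w) + (x * ln (minor_norm p (wmat a w)) + y * ln (minor_norm q (wmat a w))).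
Proof. by move=> O0 p0 q0; rewrite /wf lnM ?posrE ?chi_pos // ln_chi. Qed.

Lemma deficit_le (m o dp dq x y : R) : 0 < m -> m <= x -> m <= y ->
  0 <= o -> 0 <= dp -> 0 <= dq ->
  dp <= m^-1 * (o + (x * dp + y * dq)) /\ dq <= m^-1 * (o + (x * dp + y * dq)).
Proof.
move=> m0 mx my o0 dp0 dq0; rewrite !ler_pdivlMl //.
have h1 := ler_wpM2r dp0 mx; have h2 := ler_wpM2r dq0 my.
have h3 : 0 <= m * dp by rewrite mulr_ge0 // ltW.
have h4 : 0 <= m * dq by rewrite mulr_ge0 // ltW.
by split; lra.
Qed.

(** [f] is a product of three submultiplicative factors, so its loss dominates
    the loss of each factor, weighted by its exponent. *)
Lemma junction_deficit x y p q i u v : 0 < x -> 0 < y -> 0 < wf g a x y p q (u ++ v) ->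
  minor_norm (endpoint p q i) (wmat a u) * minor_norm (endpoint p q i) (wmat a v) <=
  expR ((Num.min x y)^-1 * (ln (wf g a x y p q u) + ln (wf g a x y p q v)
        - ln (wf g a x y p q (u ++ v)))) * minor_norm (endpoint p q i) (wmat a (u ++ v)).
Proof.
move=> x0 y0 fuv; have [x0' y0'] := (ltW x0, ltW y0).
have f0 := wf_ge0 g a x y p q.
have fM u' v' : wf g a x y p q (u' ++ v') <= wf g a x y p q u' * wf g a x y p q v' by exact: wf_sub.
have fu : 0 < wf g a x y p q u by exact: f_gt0_catl fuv.
have fv : 0 < wf g a x y p q v by exact: f_gt0_catr fuv.
have [Ou pu qu] := wf_gt0 x0 y0 fu; have [Ov pv qv] := wf_gt0 x0 y0 fv.
have [om0 p0 q0] := wf_gt0 x0 y0 fuv.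
rewrite (ln_wf x y Ou pu qu) (ln_wf x y Ov pv qv) (ln_wf x y om0 p0 q0).
have m0 : 0 < Num.min x y by rewrite lt_min x0.
have om : 0 <= ln (Om g u) + ln (Om g v) - ln (Om g (u ++ v)).
  by rewrite subr_ge0 -lnM ?posrE // ler_ln ?posrE ?mulr_gt0 // Om_sub.
have dk k : 0 < minor_norm k (wmat a u) -> 0 < minor_norm k (wmat a v) ->
    0 < minor_norm k (wmat a (u ++ v)) ->
    0 <= ln (minor_norm k (wmat a u)) + ln (minor_norm k (wmat a v))
       - ln (minor_norm k (wmat a (u ++ v))).
  move=> ku kv kuv; rewrite subr_ge0 -lnM ?posrE // ler_ln ?posrE ?mulr_gt0 //.
  by rewrite wmat_cat mulrC; exact: minor_normM.
have mx : Num.min x y <= x by rewrite ge_min lexx.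
have my : Num.min x y <= y by rewrite ge_min lexx orbT.
move: (deficit_le m0 mx my om (dk p pu pv p0) (dk q qu qv q0)) => [].
set Lo := ln (Om g u); set Lo' := ln (Om g v); set Lo2 := ln (Om g _).
set Lp := ln (minor_norm p (wmat a u)); set Lp' := ln (minor_norm p (wmat a v)).
set Lq := ln (minor_norm q (wmat a u)); set Lq' := ln (minor_norm q (wmat a v)).
set Lp2 := ln (minor_norm p _); set Lq2 := ln (minor_norm q _).
have -> : Lo + (x * Lp + y * Lq) + (Lo' + (x * Lp' + y * Lq')) - (Lo2 + (x * Lp2 + y * Lq2)) =
   Lo + Lo' - Lo2 + (x * (Lp + Lp' - Lp2) + y * (Lq + Lq' - Lq2)) by ring.
set D := _^-1 * _ => dp dq.
by case: i => /=; apply: le_ln_chi; rewrite ?mulr_gt0 // lnM ?posrE // -lerBlDl.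
Qed.

(** Blocks of a large length [b] serve as letters for [loop_extraction]: for
    [b] large, the exponential factors beat all constants, and the letters
    without a gap [ga * b] are negligible by [nongap_mass].  The bound [bmin]
    will exceed the length of the forbidden words. *)
Lemma loops_exist bmin : exists x y p q, valid x y p q /\ exists b (C h : R),
  [/\ (bmin <= b)%N, (0 < b)%N, 1 <= C, 0 < h & 4 * C ^+ 2 <= expR h] /\
  (forall i (M1 M2 M3 : 'M[R]_d), let k := endpoint p q i in
    minor_norm k (M1 *m M2) * minor_norm k (M2 *m M3) <=
    C * (minor_norm k (M1 *m M2 *m M3) * minor_norm k M2 +
       minor_norm k M1 * minor_norm k M3 * gapG k M2)) /\
  forall eps n1, 0 < eps -> exists (k : b.-tuple S) n, [/\ (n1 <= n)%N, (0 < n)%N &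
    (expR (P * b%:R) * expR (- eps)) ^+ n <=
    loop_sum (blockf x y p q) (blockN p q) (blockG p q) C h k n].
Proof.
have [x [y [p [q [v fl mx]]]]] := dominant_pair d0 hg Aa s0 pressure_low.
exists x, y, p, q; split=> //.
have [x0 y0] := valid_gt0 d0 v; have [x0' y0'] := (ltW x0, ltW y0).
have pq : (p <= q)%N.
  by case: (v) => _ [[pq _ _ _ _]|[-> _ _ _]|[-> _ _ _ _]] //; exact: ltnW.
have qd : (q <= d)%N by case: v.
have [Cp Cp1 HCp] := @gap_const R d p (leq_trans pq qd).
have [Cq Cq1 HCq] := @gap_const R d q qd.
pose C := Cp + Cq.
have Cp0 : 0 <= Cp by apply: le_trans Cp1.
have Cq0 : 0 <= Cq by apply: le_trans Cq1.
have C1 : 1 <= C by rewrite /C; apply: le_trans Cp1 _; rewrite lerDl.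
have gapC i (M1 M2 M3 : 'M[R]_d) : let k := endpoint p q i in
    minor_norm k (M1 *m M2) * minor_norm k (M2 *m M3) <=
    C * (minor_norm k (M1 *m M2 *m M3) * minor_norm k M2 +
       minor_norm k M1 * minor_norm k M3 * gapG k M2).
  have t0 k : 0 <= minor_norm k (M1 *m M2 *m M3) * minor_norm k M2 +
       minor_norm k M1 * minor_norm k M3 * gapG k M2.
    by rewrite addr_ge0 // !mulr_ge0 ?minor_norm_ge0 ?gapG_ge0.
  by case: i => /=; rewrite /C mulrDl;
    [apply: le_trans (HCq _ _ _) _; rewrite lerDr mulr_ge0
    |apply: le_trans (HCp _ _ _) _; rewrite lerDl mulr_ge0].
have [gp gp0 [Kp Kp0 HKp]] := nongap_mass d0 hg Aa pressure_up v mx (or_introl (erefl p)).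
have [gq gq0 [Kq Kq0 HKq]] := nongap_mass d0 hg Aa pressure_up v mx (or_intror (erefl q)).
pose m := Num.min x y; have m0 : 0 < m by rewrite lt_min x0.
pose g1 := Num.min gp gq; have g10 : 0 < g1 by rewrite lt_min gp0.
(* [ga * m <= g1 / 2]: half of the gain of [nongap_mass] pays for the factor of a
   letter without a gap in [letter_mass] *)
pose ga := g1 / (2 * (m + 1)).
have m1 : 0 < 2 * (m + 1) by rewrite mulr_gt0 // addr_gt0.
have ga0 : 0 < ga by rewrite divr_gt0.
have gam : ga * m <= g1 / 2.
  rewrite /ga mulrAC ler_pdivrMr // (_ : g1 / 2 * (2 * (m + 1)) = g1 * (m + 1)); last by field.
  by rewrite ler_pM2l // lerDl.
have ga1 : ga <= g1 by rewrite /ga ler_pdivrMr // ler_peMr ?(ltW g10) //; lra.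
have et0 : 0 < ga * m / 512 := divr_gt0 (mulr_gt0 ga0 m0) (ltr0n _ 512).
have [K3 K30 HK3] := wsums_up d0 hg Aa pressure_up v et0.
pose K := K3 + (Kp + Kq); have K0 : 0 < K by rewrite !addr_gt0.
have c1 : 1 <= sv_const (R := R) (d := d) by exact: sv_const_ge1.
have [b [bb b0 Hb1 [Hb2 Hb3]]] : exists b, [/\ (bmin <= b)%N, (0 < b)%N,
    4 * C ^+ 2 <= expR (ga / 32 * b%:R) &
    sv_const (R := R) (d := d) ^+ 4 <= expR (ga * b%:R) /\
    2 * K <= expR (ga * m / 512 * b%:R)].
  have g32 : 0 < ga / 32 by rewrite divr_gt0.
  have [b1 _ H1] := near_absorb (4 * C ^+ 2) g32.
  have [b2 _ H2] := near_absorb (sv_const (R := R) (d := d) ^+ 4) ga0.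
  have [b3 _ H3] := near_absorb (2 * K) et0.
  have [l0 l1 l2 l3] := four_le bmin b1 b2 b3.
  exists (bmin + b1 + b2 + b3).+1; split; [exact: l0|by []|exact: H1|].
  by split; [exact: H2|exact: H3].
pose h := ga * b%:R / 32.
have bR : 0 < b%:R :> R by rewrite ltr0n.
have h0 : 0 < h by rewrite divr_gt0 // mulr_gt0.
have h32 : 32 * h = ga * b%:R by rewrite /h; field.
have Ch : 4 * C ^+ 2 <= expR h by rewrite /h mulrAC.
exists b, C, h; do 2!split => //.
move=> eps n1 eps0.
pose ngk k (w : seq S) := expR (- (ga * b%:R)) * minor_norm k (wmat a w) ^+ 2 < gapG k (wmat a w).
pose ng (c : b.-tuple S) := ngk p c || ngk q c.
have ngE i c : ~~ ng c -> ~~ ngk (endpoint p q i) c.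
  by rewrite negb_or => /andP [n1' n2']; case: i.
have ka0 : 0 < m^-1 by rewrite invr_gt0.
have rho0 : 0 < expR (P * b%:R) by exact: expR_gt0.
apply: (@loop_extraction R (b.-tuple S) (blockf x y p q) (blockN p q) (blockG p q) ng C h m^-1
  (expR (P * b%:R)) C1 h0 ka0 Ch) => //.
- by move=> w; exact: wf_ge0.
- by move=> u w; rewrite /blockf unblock_cat; exact: wf_sub.
- move=> i w; rewrite /blockf => /(wf_gt0 x0 y0) [_ ? ?].
  by rewrite /blockN; case: i.
- by move=> i w; exact: gapG_ge0.
- by move=> i u w; rewrite /blockG unblock_cat wmat_cat [leRHS]mulrC; exact: gapGM.
- by move=> i u w; rewrite /blockf /blockN unblock_cat; exact: junction_deficit.
- move=> i u w z; rewrite /blockN /blockG !unblock_cat !wmat_cat.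
  rewrite mulrC [in leRHS](mulrC (minor_norm _ (wmat a (unblock u)))).
  exact: gapC.
- move=> i c _ /(ngE i); rewrite /blockN /blockG !unblock1 -leNgt /ngk h32; exact.
- move=> i c _; rewrite /blockN /blockG !unblock1 h32.
  apply: le_trans (gapG_le d0 _ _) _; apply: ler_wpM2r; [exact: sqr_ge0|exact: Hb2].
- move=> L; rewrite wsum_unblock -expRM_natr -mulrA -natrM mulnC.
  exact: (wsums_low hg x0' y0' fl (L * b)).
- move=> e e0; have eb : 0 < e / b%:R by rewrite divr_gt0.
  have [K' K'0 HK'] := wsums_up d0 hg Aa pressure_up v eb.
  exists K' => // n; rewrite wsum_unblock; apply: le_trans (HK' _) _.
  rewrite -expRD -expRM_natr ler_pM2l // ler_expR natrM mulrCA mulrA.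
  rewrite le_eqVlt; apply/orP; left; apply/eqP; field; exact: lt0r_neq0.
- rewrite invrK h32.
  have wb : wsum b (fun w => wf g a x y p q w) <= K3 * expR ((P + ga * m / 512) * b%:R) by exact: HK3.
  set fng := fun k w => if `[< 0 < wf g a x y p q w /\ ngk k w >] then wf g a x y p q w else 0.
  have ngp : wsum b (fng p) <= Kp * expR ((P - gp) * b%:R).
    by apply: HKp; [exact: ltW|apply: le_trans ga1 _; rewrite ge_min lexx].
  have ngq : wsum b (fng q) <= Kq * expR ((P - gq) * b%:R).
    by apply: HKq; [exact: ltW|apply: le_trans ga1 _; rewrite ge_min lexx orbT].
  have fng0 k w : 0 <= fng k w by rewrite /fng; case: ifP => // _; exact: wf_ge0.
  apply: (@le_trans _ _ (\sum_(c : b.-tuple S) (wf g a x y p q c +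
       expR (ga * b%:R * m) * (fng p c + fng q c)))).
    apply: ler_sum => c _; rewrite /blockf unblock1.
    have [w0|w0] := leP (wf g a x y p q c) 0.
      have -> : wf g a x y p q c = 0 by apply/le_anti; rewrite w0 wf_ge0.
      by rewrite mul0r add0r mulr_ge0 ?expR_ge0 ?addr_ge0.
    have Ef k : 0 <= expR (ga * b%:R * m) * fng k c := mulr_ge0 (expR_ge0 _) (fng0 k c).
    rewrite /ng; have [n1'|n1'] := boolP (ngk p c); last first.
      have [n2'|n2'] := boolP (ngk q c); last first.
        by rewrite /= mulr0 expR0 mulr1 lerDl mulr_ge0 ?expR_ge0 ?addr_ge0.
      rewrite /= mulr1 mulrC; have -> : fng q c = wf g a x y p q c by rewrite /fng asboolT.
      by rewrite mulrDr addrA lerDr; apply: addr_ge0 => //; exact: ltW.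
    rewrite /= mulr1 mulrC; have -> : fng p c = wf g a x y p q c by rewrite /fng asboolT.
    by rewrite mulrDr addrCA lerDl; apply: addr_ge0 => //; exact: ltW.
  rewrite -(wsum_tuple (T := S) b (fun c => wf g a x y p q c + expR (ga * b%:R * m) * (fng p c + fng q c))).
  rewrite wsumD wsumZ wsumD.
  have E1 k gk Kk : 0 < Kk -> g1 <= gk -> wsum b (fng k) <= Kk * expR ((P - gk) * b%:R) ->
      expR (ga * b%:R * m) * wsum b (fng k) <= Kk * expR ((P + ga * m / 512) * b%:R).
    move=> Kk0 gk1 H; apply: le_trans (ler_wpM2l (expR_ge0 _) H) _.
    rewrite mulrCA -expRD ler_pM2l // ler_expR mulrAC -mulrDl ler_pM2r //.
    move: gam et0 g10 gk1; lra.
  have := E1 p gp Kp Kp0 _ ngp; have := E1 q gq Kq Kq0 _ ngq.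
  rewrite {1}/g1 {1}/g1 !ge_min !lexx orbT => /(_ isT) Hq /(_ isT) Hp.
  rewrite mulrDr; apply: (@le_trans _ _ (K * expR ((P + ga * m / 512) * b%:R))).
    rewrite /K (mulrDl K3) (mulrDl Kp); apply: lerD => //; exact: lerD.
  have -> : h / (8 * m^-1) = (ga * m / 512) * b%:R + (ga * m / 512) * b%:R.
    by rewrite /h; field; exact: lt0r_neq0.
  rewrite (mulrDl P) !expRD.
  have EP := expR_gt0 (P * b%:R); have EE := expR_gt0 (ga * m / 512 * b%:R).
  have Hf := ler_wpM2r (ltW (mulr_gt0 EP EE)) Hb3.
  set u := expR (P * b%:R) in Hf EP *; set z := expR (_ * b%:R) in Hf EE *.
  move: Hf; set uz := u * z => Hf.
  have -> : u / 2 * (z * z) = z * uz / 2 by rewrite /uz; field.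
  by rewrite ler_pdivlMr // mulrC mulrA.
Qed.

End Loops.

(** * Concatenation and stability of loops *)

Section Glue.
Context {S : finType} {F : seq (seq S)}.
Local Notation X := (sft F).

(** A forbidden word fits into a window of length [b], and every such window
    lies inside one of the points [y i]. *)
Lemma glue_points (b m : nat) (y : nat -> X) : (0 < m)%N -> (b <= m)%N ->
  (forall w, w \in F -> (size w <= b)%N) ->
  (forall i l, (l < b)%N -> coord (y i) (m + l) = coord (y i.+1) l) ->
  exists x : X, forall i, pref (iter (i * m) shift x) (m + b) = pref (y i) (m + b).
Proof.
move=> m0 bm Fb yy.
pose c (k : nat) : S := coord (y (k %/ m)%N) (k %% m)%N.
(* because of the overlap, [y i] is also read correctly [b] symbols beyond [m] *)
have cE i l : (l < m + b)%N -> c (i * m + l)%N = coord (y i) l.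
  move=> lmb; rewrite /c divnMDl // modnMDl.
  have [lm|ml] := ltnP l m; first by rewrite divn_small // modn_small // addn0.
  have E : l = (1 * m + (l - m))%N by rewrite mul1n subnKC.
  have lb : (l - m < b)%N by rewrite ltn_subLR.
  have lm : (l - m < m)%N by apply: leq_trans bm.
  rewrite E divnMDl // modnMDl divn_small // modn_small // addn0 addn1 mul1n.
  by rewrite yy.
have Fc : sft F c.
  move=> k w wF E.
  apply: (set_valP (y (k %/ m)%N) (k %% m)%N w wF); rewrite -[RHS]E.
  apply/eq_in_map => i; rewrite mem_iota add0n /= => iw.
  rewrite [in RHS](divn_eq k m) -addnA cE //.
  by apply: leq_trans (_ : _ <= m + size w)%N _; [rewrite -addnS leq_add // ltnW // ltn_mod|rewrite leq_add2l Fb].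
exists (SigSub (mem_set Fc)) => i; apply: eq_pref => l lm.
by rewrite coord_iter_shift; exact: cE.
Qed.

End Glue.

(** Avalanche principle for a chain of blocks: [N i j] is the norm of the product of
    the blocks from [i] to [j].  Controlled junctions of adjacent blocks and
    small gap terms propagate with a loss of [2 * A * C] per block. *)
Section AvalancheChain.
Context {R : realType}.
Variables (N G : nat -> nat -> R) (A C D : R).
Hypothesis A0 : 0 < A.
Hypothesis C1 : 1 <= C.
Hypothesis D0 : 0 <= D.
Hypothesis ACD : 4 * A ^+ 2 * C ^+ 2 * D <= 1.
Hypothesis N_block : forall i, 0 < N i i.+1.
Hypothesis G_ge0 : forall i j, 0 <= G i j.
Hypothesis gapE : forall i j k l, (i <= j)%N -> (j <= k)%N -> (k <= l)%N ->
  N i k * N j l <= C * (N i l * N j k + N i j * N k l * G j k).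
Hypothesis junction : forall i, N i i.+1 * N i.+1 i.+2 <= A * N i i.+2.
Hypothesis gap : forall i, G i i.+1 <= D * N i i.+1 ^+ 2.

Let E := 2 * A * C.
Let C0 : 0 < C. Proof. exact: lt_le_trans C1. Qed.
Let E0 : 0 < E. Proof. by rewrite !mulr_gt0. Qed.

Lemma avalanche_step n i : 0 < N i (i + n.+1) /\
  N i i.+1 * N i.+1 (i.+1 + n.+1) <= E * N i (i + n.+2).
Proof.
elim: n i => [|n IH] i.
  split; first by rewrite addn1.
  rewrite addn1 addn2; apply: le_trans (junction i) _.
  have N2 : 0 < N i i.+2.
    have := lt_le_trans (mulr_gt0 (N_block i) (N_block i.+1)) (junction i).
    by rewrite pmulr_rgt0.
  rewrite ler_pM2r // /E mulrAC; apply: ler_peMl; first exact: ltW.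
  by rewrite mulr_ege1 // ler1n.
have P : 0 < N i (i + n.+2).
  have [_ H] := IH i; have [H' _] := IH i.+1.
  by have := lt_le_trans (mulr_gt0 (N_block i) H') H; rewrite pmulr_rgt0.
split=> //.
have Pn j : 0 < N j (j + n.+1) by have [] := IH j.
have Pn2 : 0 < N i.+1 (i.+1 + n.+2).
  have [_ H] := IH i.+1; have [H' _] := IH i.+2.
  by have := lt_le_trans (mulr_gt0 (N_block i.+1) H') H; rewrite pmulr_rgt0.
have [_ H2] := IH i.+1.
have El : (i.+1 + n.+2 = i + n.+3)%N by rewrite addSnnS.
have El2 : (i.+2 + n.+1 = i.+1 + n.+2)%N by rewrite addSnnS.
rewrite -El.
apply: (@three_block_step R (N i i.+1) (N i.+1 i.+2) (N i.+2 (i.+1 + n.+2)) (N i i.+2)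
   (N i.+1 (i.+1 + n.+2)) (N i (i.+1 + n.+2)) (G i.+1 i.+2) A E C D) => //.
- by rewrite -El2.
- exact: ltW.
- exact: ltW.
- apply: gapE => //; rewrite -El2; exact: leq_addr.
- by rewrite -El2 in H2 *.
- have -> : A * C * E * D = 4 * A ^+ 2 * C ^+ 2 * D / 2 by rewrite /E; field.
  by rewrite ler_pdivrMr // mulVf.
Qed.

Lemma avalanche_chain n i :
  \prod_(j < n.+1) N (i + j) (i + j).+1 <= E ^+ n * N i (i + n.+1).
Proof.
elim: n i => [|n IH] i; first by rewrite big_ord1 addn0 expr0 mul1r addn1.
rewrite big_ord_recl /= addn0.
apply: (@le_trans _ _ (N i i.+1 * (E ^+ n * N i.+1 (i.+1 + n.+1)))).
  apply: ler_wpM2l; first exact: ltW.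
  have := IH i.+1; congr (_ <= _); apply: eq_bigr => j _.
  by rewrite /bump /= add1n addSnnS.
rewrite mulrCA exprSr -mulrA; apply: ler_wpM2l; first by rewrite exprn_ge0 // ltW.
by have [] := avalanche_step n i.
Qed.

End AvalancheChain.

Section Stability.
Context {R : realType} {S : finType} {F : seq (seq S)} {d : nat}.
Hypothesis d0 : (0 < d)%N.
Local Notation X := (sft F).
Variables (A : X -> 'M[R]_d) (a : S -> 'M[R]_d) (K : R).
Hypothesis Aa : forall x, A x = a (coord x 0%N).
Hypothesis K0 : 0 <= K.
Hypothesis AK : bounded_by K A.

(** The factors 2 and 8 leave room for the strict inequalities that define a
    neighbourhood. *)
Definition stable_block (D : R) (k : nat) (M0 M : 'M[R]_d) := 0 < minor_norm k M0 ->
  [/\ minor_norm k M0 <= 2 * minor_norm k M, minor_norm k M <= 2 * minor_norm k M0 &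
      gapG k M0 <= D * minor_norm k M0 ^+ 2 -> gapG k M <= 8 * D * minor_norm k M ^+ 2].

Lemma gapG_continuous k M : {for M, continuous (@gapG R d k)}.
Proof.
case: k => [|k]; first by have -> : @gapG R d 0 = (fun=> 0) by []; exact: cst_continuous.
have -> : @gapG R d k.+1 = (fun Y => minor_norm k Y * minor_norm k.+2 Y) by [].
have c1 := @minor_norm_continuous R d k M.
have c2 := @minor_norm_continuous R d k.+2 M.
exact: (@continuousM _ _ (minor_norm k) (minor_norm k.+2) M c1 c2).
Qed.

Lemma stable_near D k M0 : 0 < D -> \forall M \near M0, stable_block D k M0 M.
Proof.
move=> D0; have [N0|N0] := ltP 0 (minor_norm k M0); last first.
  by near=> M; move=> N0'; rewrite leNgt N0' in N0.
have h0 : 0 < minor_norm k M0 / 2 by rewrite divr_gt0.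
have e0 : 0 < D * minor_norm k M0 ^+ 2 by rewrite mulr_gt0 ?exprn_gt0.
have /cvgrPdist_lt /(_ _ h0) H1 := @minor_norm_continuous R d k M0.
have H2 := near_le_add (@gapG_continuous k M0) e0.
apply: filterS2 H1 H2 => M H1 H2 _.
move: H1; rewrite ltr_distl => /andP [l1 l2].
have l3 : minor_norm k M0 <= 2 * minor_norm k M by lra.
split=> //; first lra.
move=> H3; apply: le_trans H2 _.
apply: (@le_trans _ _ (2 * (D * minor_norm k M0 ^+ 2))); first lra.
have : minor_norm k M0 ^+ 2 <= (2 * minor_norm k M) ^+ 2.
  by rewrite lerXn2r ?nnegrE ?mulr_ge0 ?minor_norm_ge0.
rewrite exprMn => H4; have := ler_wpM2l (ltW D0) H4.
set u := minor_norm k M ^+ 2; set v := minor_norm k M0 ^+ 2.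
have -> : D * (2 ^+ 2 * u) = 4 * (D * u) by ring.
have -> : 8 * D * u = 8 * (D * u) by ring.
lra.
Unshelve. all: end_near. Qed.

(** Only finitely many words of length [L] occur, so one neighbourhood serves
    all of them. *)
Lemma stability D k L : 0 < D -> \forall B \near closef A, forall y,
  stable_block D k (wmat a (pref y L)) (cocycle_prod B y L).
Proof.
move=> D0.
have /choice [rr Hrr] : forall w : L.-tuple S, exists r, 0 < r /\
    forall M', minor_norm 1 (M' - wmat a w) <= r -> stable_block D k (wmat a w) M'.
  by move=> w; have [r r0 H] := nbhs_minor_norm1 (stable_near k (wmat a w) D0); exists r.
have [r [r0 _ Hr]] := finite_lower ltr01 (fun w => (Hrr w).1).
apply: filterS (close_cocycle L K0 AK r0) => B HB y.
have sy : size (pref y L) == L by rewrite size_pref.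
apply: (Hrr (Tuple sy)).2; rewrite -(cocycle_prod_word Aa).
exact: le_trans (HB y) (Hr _).
Qed.

End Stability.

(** * Avalanche for a nearby cocycle *)

(** The blocks of [B] along the orbit of [x] between the times [t i] are close to the
    matrices of the words [W i], for which the junctions and gaps are known. *)
Section WordChain.
Context {R : realType} {S : finType} {F : seq (seq S)} {d : nat}.
Local Notation X := (sft F).
Variables (a : S -> 'M[R]_d) (B : X -> 'M[R]_d) (k : nat) (x : X).
Variables (t : nat -> nat) (W : nat -> seq S) (A0 C D : R).
Local Notation y i := (iter (t i) shift x).
Local Notation N w := (minor_norm k (wmat a w)).
Hypothesis A01 : 1 <= A0.
Hypothesis C1 : 1 <= C.
Hypothesis D0 : 0 <= D.
Hypothesis ACD : 4 * (8 * A0) ^+ 2 * C ^+ 2 * (8 * D) <= 1.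
Hypothesis tS : forall i, (t i <= t i.+1)%N.
Hypothesis stable1 : forall i, stable_block D k (wmat a (W i)) (cocycle_prod B (y i) (t i.+1 - t i)).
Hypothesis stable2 : forall i,
  stable_block D k (wmat a (W i ++ W i.+1)) (cocycle_prod B (y i) (t i.+2 - t i)).
Hypothesis W_gt0 : forall i, 0 < N (W i).
Hypothesis W2_gt0 : forall i, 0 < N (W i ++ W i.+1).
Hypothesis W_junction : forall i, N (W i) * N (W i.+1) <= A0 * N (W i ++ W i.+1).
Hypothesis W_gap : forall i, gapG k (wmat a (W i)) <= D * N (W i) ^+ 2.
Hypothesis gapC : forall M1 M2 M3 : 'M[R]_d,
    minor_norm k (M1 *m M2) * minor_norm k (M2 *m M3) <=
    C * (minor_norm k (M1 *m M2 *m M3) * minor_norm k M2 +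
       minor_norm k M1 * minor_norm k M3 * gapG k M2).

Let P i j := cocycle_prod B (y i) (t j - t i).

Let t_mono i j : (i <= j)%N -> (t i <= t j)%N.
Proof. by move=> /subnK<-; elim: (j - i)%N => // n IH; apply: leq_trans IH (tS _). Qed.

Let P_cat i j l : (i <= j)%N -> (j <= l)%N -> P i l = P j l *m P i j.
Proof.
move=> ij jl; have tij := t_mono ij; have tjl := t_mono jl.
rewrite /P; have -> : (t l - t i = (t j - t i) + (t l - t j))%N by lia.
by rewrite cocycle_prod_add -iterD subnK.
Qed.

Lemma word_chain n : \prod_(i < n.+1) N (W i) <=
  2 ^+ n.+1 * (16 * A0 * C) ^+ n * minor_norm k (cocycle_prod B (y 0%N) (t n.+1 - t 0%N)).
Proof.
have A00 : 0 < A0 by apply: lt_le_trans A01.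
have C0 : 0 <= C by apply: le_trans C1.
have s1 i := stable1 (W_gt0 i); have s2 i := stable2 (W2_gt0 i).
have N0 i : 0 < minor_norm k (P i i.+1).
  by have [H _ _] := s1 i; have := lt_le_trans (W_gt0 i) H; rewrite pmulr_rgt0.
have H := @avalanche_chain R (fun i j => minor_norm k (P i j)) (fun i j => gapG k (P i j))
  (8 * A0) C (8 * D) (mulr_gt0 (ltr0n _ 8) A00) C1 (mulr_ge0 (ler0n _ 8) D0) ACD N0.
have {H} : \prod_(j < n.+1) minor_norm k (P (0 + j) (0 + j).+1) <=
   (2 * (8 * A0) * C) ^+ n * minor_norm k (P 0 (0 + n.+1)).
  apply: H => [i j|i j l m ij jl lm|i|i].
  - exact: gapG_ge0.
  - rewrite (P_cat ij (leq_trans jl lm)) (P_cat jl lm) (P_cat ij jl) mulrC.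
    by rewrite [minor_norm k (P i j) * _]mulrC; exact: gapC.
  - have [_ h1 _] := s1 i; have [_ h2 _] := s1 i.+1; have [h3 _ _] := s2 i.
    have h4 := ler_pM (ltW (N0 i)) (ltW (N0 i.+1)) h1 h2.
    apply: le_trans h4 _; have h5 := W_junction i.
    have h6 := ler_wpM2l (ltW A00) h3.
    rewrite mulrACA; move: h5 h6.
    set u := N (W i) * _; set v := N (_ ++ _); set w := minor_norm k _.
    rewrite -/(P i i.+2) => h5 h6.
    have h7 := le_trans h5 h6.
    have -> : 8 * A0 * w = 4 * (A0 * (2 * w)) by ring.
    have -> : 2 * 2 * u = 4 * u by ring.
    by rewrite ler_pM2l.
  - by have [_ _ h] := s1 i; exact: h.
rewrite (_ : 2 * (8 * A0) * C = 16 * A0 * C); last by ring.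
rewrite add0n -/(P 0 n.+1) => H.
apply: (@le_trans _ _ (2 ^+ n.+1 * \prod_(j < n.+1) minor_norm k (P (0 + j) (0 + j).+1))).
  rewrite -[X in 2 ^+ X]card_ord -prodr_const -big_split /=.
  apply: ler_prod => i _; rewrite minor_norm_ge0 add0n.
  by have [h _ _] := s1 i.
by rewrite -mulrA; apply: ler_wpM2l => //; rewrite exprn_ge0.
Qed.

End WordChain.

Section LoopConcatenation.
Context {R : realType} {S : finType} {F : seq (seq S)} {d : nat}.
Local Notation X := (sft F).
Variables (a : S -> 'M[R]_d) (B : X -> 'M[R]_d) (k : nat) (x : X).
Variables (u : seq S) (z : nat -> seq S) (l : nat) (A0 C D : R).
Hypothesis zl : forall j, size (z j) = l.
Let b := size u.
Let m := (b + l)%N.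
Local Notation N w := (minor_norm k (wmat a w)).
Hypothesis A01 : 1 <= A0.
Hypothesis C1 : 1 <= C.
Hypothesis D0 : 0 <= D.
Hypothesis ACD : 4 * (8 * A0) ^+ 2 * C ^+ 2 * (8 * D) <= 1.
Hypothesis pref_x : forall j, pref (iter (j * m) shift x) (m + b) = u ++ z j ++ u.
Hypothesis stable : forall L, L \in [:: b; l; m] -> forall y,
  stable_block D k (wmat a (pref y L)) (cocycle_prod B y L).
Hypothesis loop_gt0 : forall j, 0 < N (u ++ z j ++ u).
Hypothesis loop_junction : forall j,
  N u * N (z j) <= A0 * N (u ++ z j) /\ N (z j) * N u <= A0 * N (z j ++ u).
Hypothesis loop_gap : forall j, gapG k (wmat a u) <= D * N u ^+ 2 /\
  gapG k (wmat a (z j)) <= D * N (z j) ^+ 2.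
Hypothesis gapC : forall M1 M2 M3 : 'M[R]_d,
    minor_norm k (M1 *m M2) * minor_norm k (M2 *m M3) <=
    C * (minor_norm k (M1 *m M2 *m M3) * minor_norm k M2 +
       minor_norm k M1 * minor_norm k M3 * gapG k M2).

(* even blocks are copies of [u], odd blocks are the words [z] *)
Let t (i : nat) := (i./2 * m + odd i * b)%N.
Let W (i : nat) := if odd i then z i./2 else u.

Let N_catl v w : 0 < N (v ++ w) -> 0 < N v.
Proof.
rewrite wmat_cat => H; have := lt_le_trans H (minor_normM _ _ _).
rewrite lt_def mulf_eq0 negb_or => /andP [/andP [_ H2] _].
by rewrite lt_def H2 minor_norm_ge0.
Qed.

Let N_catr v w : 0 < N (v ++ w) -> 0 < N w.
Proof.
rewrite wmat_cat => H; have := lt_le_trans H (minor_normM _ _ _).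
rewrite lt_def mulf_eq0 negb_or => /andP [/andP [H2 _] _].
by rewrite lt_def H2 minor_norm_ge0.
Qed.

Let size_W i : (t i.+1 - t i = size (W i))%N.
Proof.
rewrite /t /W /=; case E : (odd i) => /=; rewrite ?zl uphalf_half E /m /=; lia.
Qed.

Let tS i : (t i <= t i.+1)%N.
Proof.
by rewrite /t /=; case E : (odd i) => /=; rewrite uphalf_half E /m /=; lia.
Qed.

Let t2 i : (t i.+2 - t i = m)%N.
Proof. by rewrite /t /= negbK mulSn; lia. Qed.

Let prefW i : pref (iter (t i) shift x) m = W i ++ W i.+1.
Proof.
have H := pref_x i./2.
have sz : size (u ++ z i./2) = m by rewrite size_cat zl.
rewrite /W /=; case E : (odd i) => /=; last first.
  rewrite uphalf_half E add0n /t E mul0n addn0.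
  have := congr1 (take m) H; rewrite pref_add catA take_size_cat ?size_pref //.
  by rewrite take_size_cat.
have -> : t i = (b + i./2 * m)%N by rewrite /t E mul1n addnC.
rewrite iterD; have := congr1 (drop b) H.
have -> : (m + b = b + m)%N by rewrite addnC.
by rewrite pref_add !drop_size_cat // size_pref.
Qed.

(** Each loop consists of two blocks, so the loss per block enters squared. *)
Lemma loop_chain n : \prod_(j < n.+1) (((32 * A0 * C) ^+ 2)^-1 * (N u * N (z j))) <=
  minor_norm k (cocycle_prod B x (n.+1 * m)).
Proof.
have prefW1 i : pref (iter (t i) shift x) (size (W i)) = W i.
  have := congr1 (take (size (W i))) (prefW i).
  have -> : m = (size (W i) + size (W i.+1))%N.
    by rewrite -size_W -size_W -(t2 i); have := tS i; have := tS i.+1; lia.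
  by rewrite pref_add !take_size_cat // size_pref.
have W0 i : 0 < N (W i ++ W i.+1).
  rewrite /W /=; case E : (odd i) => /=.
    by apply: (@N_catr u); exact: loop_gt0.
  by apply: (@N_catl _ u); rewrite -catA; exact: loop_gt0.
have W10 i : 0 < N (W i) by exact: N_catl (W0 i).
have H : forall n, \prod_(i < n.+1) N (W i) <= 2 ^+ n.+1 * (16 * A0 * C) ^+ n *
    minor_norm k (cocycle_prod B (iter (t 0%N) shift x) (t n.+1 - t 0%N)).
  move=> n'; apply: (@word_chain R S F d a B k x t W A0 C D) => //.
  - move=> i; rewrite size_W -{1}(prefW1 i); apply: stable.
    by rewrite /W; case: (odd i); rewrite ?zl !inE eqxx ?orbT.
  - by move=> i; rewrite t2 -(prefW i); apply: stable; rewrite !inE eqxx !orbT.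
  - move=> i; rewrite /W /=; case: (odd i) => /=; first exact: (loop_junction _).2.
    exact: (loop_junction _).1.
  - move=> i; rewrite /W; case: (odd i); first exact: (loop_gap _).2.
    exact: (loop_gap 0%N).1.
have {H} := H n.*2.+1.
have -> : t 0%N = 0%N by [].
have -> : t n.*2.+2 = (n.+1 * m)%N.
  by rewrite /t -doubleS odd_double doubleK mul0n addn0.
rewrite subn0 /= => H.
have Q : 1 <= 16 * A0 * C.
  by rewrite mulr_ege1 // mulr_ege1 // ler1n.
have {H} H : \prod_(i < n.+1.*2) N (W i) <=
    (32 * A0 * C) ^+ n.+1.*2 * minor_norm k (cocycle_prod B x (n.+1 * m)).
  apply: le_trans H _; apply: ler_wpM2r; first exact: minor_norm_ge0.
  have -> : 32 * A0 * C = 2 * (16 * A0 * C) by ring.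
  rewrite (exprMn _ 2 (16 * A0 * C)); apply: ler_wpM2l; first by rewrite exprn_ge0.
  by rewrite ler_weXn2l // doubleS.
have pE M : \prod_(i < M.*2) N (W i) = \prod_(j < M) (N u * N (z j)).
  elim: M => [|M IH]; first by rewrite !big_ord0.
  rewrite doubleS !big_ord_recr /= IH -mulrA.
  by rewrite /W /= odd_double /= uphalf_double.
have Q0 : 0 < 32 * A0 * C.
  by rewrite !mulr_gt0 // (lt_le_trans _ A01, lt_le_trans _ C1).
rewrite big_split /= prodr_const card_ord -pE exprVn -exprM mul2n.
by rewrite ler_pdivrMl // exprn_gt0.
Qed.

End LoopConcatenation.

(** * Weight of concatenated loops *)

Section Exponents.
Context {R : realType}.

Lemma powR_prod (n : nat) (u : 'I_n -> R) a : (forall i, 0 <= u i) ->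
  (\prod_i u i) `^ a = \prod_i u i `^ a.
Proof.
elim: n u => [|n IH] u u0; first by rewrite !big_ord0 powR1.
by rewrite !big_ord_recl powRM ?IH // prodr_ge0.
Qed.

(** Continuity of the power in its exponent, with the loss expressed as a
    factor that does not depend on the base. *)
Lemma powR_half (u x : R) : 0 < u -> exists2 h, 0 < h & forall x', `|x' - x| < h ->
  u `^ x / 2 <= u `^ x'.
Proof.
move=> u0; have l2 : 0 < ln 2 :> R by rewrite ln_gt0 // ltr1n.
have lu : 0 < `|ln u| + 1 by rewrite ltr_wpDl.
exists (ln 2 / (`|ln u| + 1)) => [|x' H]; first exact: divr_gt0.
rewrite -[X in _ / X](@lnK _ 2) ?posrE // -expRN /powR gt_eqF // -expRD ler_expR.
have : `|(x - x') * ln u| <= ln 2.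
  rewrite normrM distrC; apply: (@le_trans _ _ (ln 2 / (`|ln u| + 1) * (`|ln u| + 1))).
    by apply: ler_pM => //; [exact: ltW|rewrite lerDl].
  by rewrite divfK // gt_eqF.
move=> /(le_trans (ler_norm _)); rewrite mulrBl; lra.
Qed.

End Exponents.

Section LoopSums.
Context {R : realType} {S : finType}.
Variables (V : seq S -> R) (u : seq S) (ok : pred (seq S)) (th : seq S -> R) (l : nat).
Hypothesis V0 : forall w, 0 <= V w.
Hypothesis th0 : forall w, 0 <= th w.
Let b := size u.
Let m := (b + l)%N.
Hypothesis V_ge : forall n (z : nat -> seq S), (forall j, size (z j) = l /\ ok (z j)) ->
  \prod_(j < n.+1) th (z j) <= V (flatten (mkseq (fun j => u ++ z j) n.+1)).

(** Distinct sequences of loops yield distinct words, so the sum over all words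
    contains the power of the sum over loops. *)
Lemma loop_power n : wsum l (fun w => if ok w then th w else 0) ^+ n.+1 <= wsum (n.+1 * m) V.
Proof.
pose Th (w : seq S) := if (take b w == u) && ok (drop b w) then th (drop b w) else 0.
have Th0 w : 0 <= Th w by rewrite /Th; case: ifP.
have step (W : seq (m.-tuple S)) : size W = n.+1 -> \prod_(c <- W) Th c <= V (unblock W).
  case: W => // c0 W0; set W := c0 :: W0 => Wn.
  have [al|] := boolP (all (fun c : m.-tuple S => (take b c == u) && ok (drop b c)) W); last first.
    move=> /allPn [c cW nc]; have -> : \prod_(c <- W) Th c = 0.
      by apply/eqP; rewrite prodf_seq_eq0; apply/hasP; exists c => //=; rewrite /Th (negPf nc) eqxx.
    exact: V0.
  pose z j := drop b (nth c0 W j).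
  have cW j : nth c0 W j \in W.
    by have [jW|jW] := ltnP j (size W); [exact: mem_nth|rewrite nth_default // mem_head].
  have zok j : take b (nth c0 W j) = u /\ ok (z j) by have /andP [/eqP] := allP al _ (cW j).
  have H := @V_ge n z; have {}H := H (fun j => conj _ (zok j).2).
  have := H _ => {H}.
  have -> : flatten (mkseq (fun j => u ++ z j) n.+1) = unblock W.
    rewrite /unblock -Wn -[in RHS](mkseq_nth c0 W) /mkseq -map_comp; congr flatten.
    by apply: eq_map => j /=; rewrite -{1}(zok j).1 cat_take_drop.
  have -> : \prod_(c <- W) Th c = \prod_(j < n.+1) th (z j).
    rewrite (big_nth c0) Wn big_mkord; apply: eq_bigr => j _.
    by rewrite /Th (zok j).1 eqxx (zok j).2.
  apply => j; by rewrite size_drop size_tuple /m addKn.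
rewrite -(@wsum_unblock R S m); apply: le_trans (ler_wsum step).
rewrite wsum_prod; apply: lerXn2r.
- by rewrite nnegrE; apply: wsum_ge0 => w _; case: ifP.
- by rewrite nnegrE sumr_ge0.
rewrite -(wsum_tuple m Th) wsum_cat.
have H := @ler_wsum_term R S b (fun v => wsum l (fun w => Th (v ++ w))) u.
apply: le_trans (H _ (erefl _)); last by move=> v _; apply: wsum_ge0.
by apply: ler_wsum => w wl; rewrite /Th take_size_cat // drop_size_cat // eqxx.
Qed.

End LoopSums.

Section LoopValue.
Context {R : realType} {S : finType} {F : seq (seq S)} {d : nat}.
Hypothesis d0 : (0 < d)%N.
Local Notation X := (sft F).
Variable g : X -> R.
Variables (x : X) (u : seq S) (z : nat -> seq S) (l : nat) (e K : R).
Hypothesis zl : forall j, size (z j) = l.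
Let b := size u.
Let m := (b + l)%N.
Hypothesis pref_x : forall j, pref (iter (j * m) shift x) (m + b) = u ++ z j ++ u.
Hypothesis variation : forall n (y : X),
  Om g (pref y n) <= expR (e * n%:R + K) * expR (birkhoff_sum g n y).

Lemma pref_loop j : pref (iter (j * m) shift x) m = u ++ z j.
Proof.
have := congr1 (take m) (pref_x j); rewrite pref_add catA take_size_cat ?size_pref // => ->.
by rewrite take_size_cat // size_cat zl.
Qed.

Lemma pref_loops n : pref x (n * m) = flatten (mkseq (fun j => u ++ z j) n).
Proof.
elim: n => [|n IH]; first by rewrite mul0n.
by rewrite mulSnr pref_add IH pref_loop mkseqS flatten_rcons.
Qed.

(** The variation of Birkhoff sums on cylinders costs [K] once for [u] and once
    for each [z j]. *)
Lemma birkhoff_loops n :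
  \prod_(j < n) (expR (- (e * m%:R + 2 * K)) * (Om g u * Om g (z j))) <=
  expR (birkhoff_sum g (n * m) x).
Proof.
elim: n => [|n IH]; first by rewrite big_ord0 mul0n /birkhoff_sum big_ord0 expR0.
rewrite big_ord_recr mulSnr birkhoff_sum_add expRD /=.
apply: ler_pM => //.
- by apply: prodr_ge0 => j _; rewrite !mulr_ge0 ?expR_ge0 ?Om_ge0.
- by rewrite !mulr_ge0 ?expR_ge0 ?Om_ge0.
set y := iter (n * m) shift x.
have := pref_loop n; rewrite -/y /m pref_add => /eqP.
rewrite eqseq_cat ?size_pref // => /andP [/eqP pu /eqP pz].
have H1 := variation b y; have H2 := variation l (iter b shift y).
rewrite pu in H1; rewrite pz in H2.
have H := ler_pM (Om_ge0 g u) (Om_ge0 g (z n)) H1 H2.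
rewrite birkhoff_sum_add expRD.
rewrite expRN mulrC ler_pdivrMr ?expR_gt0 //; apply: le_trans H _.
have -> : expR (e * m%:R + 2 * K) = expR (e * b%:R + K) * expR (e * l%:R + K).
  by rewrite -expRD /m natrD; congr expR; ring.
set e1 := expR _; set e2 := expR _; set e3 := expR _; set e4 := expR _.
by rewrite le_eqVlt; apply/orP; left; apply/eqP; ring.
Qed.

Variables (a : S -> 'M[R]_d) (B : X -> 'M[R]_d) (p q : nat) (A0 C D : R).
Hypothesis A01 : 1 <= A0.
Hypothesis C1 : 1 <= C.
Hypothesis D0 : 0 <= D.
Hypothesis ACD : 4 * (8 * A0) ^+ 2 * C ^+ 2 * (8 * D) <= 1.
Local Notation N k w := (minor_norm k (wmat a w)).
Hypothesis stable : forall i L, L \in [:: b; l; m] -> forall y,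
  stable_block D (endpoint p q i) (wmat a (pref y L)) (cocycle_prod B y L).
Hypothesis loop_gt0 : forall i j, 0 < N (endpoint p q i) (u ++ z j ++ u).
Hypothesis loop_junction : forall i j, let k := endpoint p q i in
  N k u * N k (z j) <= A0 * N k (u ++ z j) /\ N k (z j) * N k u <= A0 * N k (z j ++ u).
Hypothesis loop_gap : forall i j, let k := endpoint p q i in
  gapG k (wmat a u) <= D * N k u ^+ 2 /\
  gapG k (wmat a (z j)) <= D * N k (z j) ^+ 2.
Hypothesis gapC : forall i (M1 M2 M3 : 'M[R]_d), let k := endpoint p q i in
    minor_norm k (M1 *m M2) * minor_norm k (M2 *m M3) <=
    C * (minor_norm k (M1 *m M2 *m M3) * minor_norm k M2 +
       minor_norm k M1 * minor_norm k M3 * gapG k M2).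
Variables (x' y' t Ct : R).
Hypothesis x'0 : 0 <= x'.
Hypothesis y'0 : 0 <= y'.
Hypothesis Ct_phi : forall M : 'M[R]_d, chi x' y' p q M <= Ct * phi t M.
Let c0 := ((32 * A0 * C) ^+ 2)^-1.

(** Contribution of one loop, with the losses of the variation and of the
    avalanche included. *)
Definition loop_weight (w : seq S) := expR (- (e * m%:R + 2 * K)) * (Om g u * Om g w) *
  ((c0 * (N p u * N p w)) `^ x' * (c0 * (N q u * N q w)) `^ y').

Lemma loop_value n : \prod_(j < n.+1) loop_weight (z j) <=
  Ct * cylval g B t (n.+1 * m) x.
Proof.
have cc k j : 0 <= c0 * (N k u * N k (z j)).
  by rewrite !mulr_ge0 ?minor_norm_ge0 // invr_ge0 sqr_ge0.
rewrite /cylval [leRHS]mulrCA.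
rewrite big_split /=; apply: ler_pM.
- by apply: prodr_ge0 => j _; rewrite !mulr_ge0 ?expR_ge0 ?Om_ge0.
- by apply: prodr_ge0 => j _; rewrite mulr_ge0 ?powR_ge0.
- exact: birkhoff_loops.
apply: le_trans (Ct_phi _); rewrite big_split /= /chi.
have H i : \prod_(j < n.+1) (c0 * (N (endpoint p q i) u * N (endpoint p q i) (z j))) <=
    minor_norm (endpoint p q i) (cocycle_prod B x (n.+1 * m)).
  apply: (@loop_chain R S F d a B (endpoint p q i) x u z l A0 C D) => //.
  exact: stable.
rewrite -!(@powR_prod R) //; apply: ler_pM; rewrite ?powR_ge0 //.
  by apply: ler_powRl => //; [apply: prodr_ge0|exact: (H false)].
by apply: ler_powRl => //; [apply: prodr_ge0|exact: (H true)].
Qed.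

End LoopValue.

(** * Lower semicontinuity *)

(** Excludes the value [+oo] of the growth rate. *)
Lemma growth_le_exists (R : realType) (u : nat -> R) (C : R) :
  (forall n, 0 <= u n) -> 1 <= C -> (forall n m, u (n + m)%N <= C * (u n * u m)) ->
  exists q, growth_le u q.
Proof.
move=> u0 C1 uM; have C0 : 0 <= C by apply: le_trans C1.
have L0 : 0 < C * u 1%N + 1 by rewrite ltr_wpDl // mulr_ge0.
exists (ln (C * u 1%N + 1)); exists (u 0%N + 1) => [|n]; first by rewrite ltr_wpDl.
rewrite expRM_natr lnK ?posrE //; elim: n => [|n IH]; first by rewrite expr0 mulr1 lerDl.
rewrite -addn1; apply: le_trans (uM n 1%N) _; rewrite addn1 exprSr [leLHS]mulrCA [leRHS]mulrA.
apply: ler_pM => //; first exact: mulr_ge0.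
by rewrite lerDl.
Qed.

(** The gap [30 h] of the loops beats the junction losses [8 h], squared, and
    all constants. *)
Lemma loop_constants (R : realType) (C h : R) : 0 < h -> 1 <= C -> 4 * C ^+ 2 <= expR h ->
  1 <= 2 * C * expR (8 * h) /\
  4 * (8 * (2 * C * expR (8 * h))) ^+ 2 * C ^+ 2 * (8 * expR (- (30 * h))) <= 1.
Proof.
move=> h0 C1 Ch; have h8 : 0 <= 8 * h by rewrite mulr_ge0 // ltW.
have e1 : 1 <= expR (8 * h) by rewrite -[leLHS]expR0 ler_expR.
split; first by rewrite !mulr_ege1 ?ler1n.
have -> : expR (- (30 * h)) = (expR h ^+ 30)^-1 by rewrite -expRM_natr expRN mulrC.
have -> : expR (8 * h) = expR h ^+ 8 by rewrite -expRM_natr mulrC.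
set z := expR h in Ch *; have z0 : 0 < z by exact: expR_gt0.
have z4 : 4 <= z.
  by apply: le_trans Ch; rewrite ler_peMr // exprn_ege1.
rewrite mulrA ler_pdivrMr ?exprn_gt0 // mul1r.
have -> : 4 * (8 * (2 * C * z ^+ 8)) ^+ 2 * C ^+ 2 * 8 = 512 * ((4 * C ^+ 2) ^+ 2 * z ^+ 16) by ring.
have H : (4 * C ^+ 2) ^+ 2 <= z ^+ 2.
  rewrite lerXn2r ?nnegrE ?(ltW z0) // mulr_ge0 ?sqr_ge0 //.
have -> : z ^+ 30 = z ^+ 12 * (z ^+ 2 * z ^+ 16) by ring.
have z0' := ltW z0.
apply: ler_pM; first exact: ler0n.
- exact: mulr_ge0 (sqr_ge0 _) (exprn_ge0 _ z0').
- apply: (@le_trans _ _ (4 ^+ 5)); first by rewrite -!natrX ler_nat.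
  apply: (@le_trans _ _ (z ^+ 5)); first by rewrite lerXn2r ?nnegrE.
  by rewrite ler_weXn2l // (le_trans _ z4) // ler1n.
- by apply: ler_wpM2r => //; rewrite exprn_ge0.
Qed.

Section LowerSemicontinuity.
Context {R : realType} {S : finType} {F : seq (seq S)} {d : nat}.
Hypothesis d0 : (0 < d)%N.
Local Notation X := (sft F).
Variable g : X -> R.
Hypothesis hg : continuous g.
Implicit Types (A B : X -> 'M[R]_d).

Lemma loops_glue (u : seq S) (z : nat -> seq S) l :
  (0 < l)%N -> (forall w, w \in F -> (size w <= size u)%N) -> (forall j, size (z j) = l) ->
  (forall j, exists y : X, pref y (size u + l + size u) = u ++ z j ++ u) ->
  exists x : X, forall j, pref (iter (j * (size u + l)) shift x) (size u + l + size u) = u ++ z j ++ u.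
Proof.
move=> l0 Fu zl /choice [y Hy].
have m0 : (0 < size u + l)%N by rewrite addn_gt0 l0 orbT.
have [i k ku|x Hx] := glue_points (y := y) m0 (leq_addr _ _) Fu; last first.
  by exists x => j; rewrite Hx Hy.
have c0 := coord (y 0%N) 0%N.
have e1 : nth c0 (pref (y i) (size u + l + size u)) (size u + l + k) = coord (y i) (size u + l + k).
  by rewrite nth_mkseq // ltn_add2l.
have e2 : nth c0 (pref (y i.+1) (size u + l + size u)) k = coord (y i.+1) k.
  by rewrite nth_mkseq // (leq_trans ku) // leq_addl.
rewrite -e1 -e2 !Hy catA nth_cat size_cat zl ltnNge leq_addr /= addKn.
by rewrite nth_cat ku.
Qed.

(** The order of choices matters: first the pair and the block length [b], then
    the variation constant and the loss per loop, which depend on [b] only;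
    then a loop length [n] so large that this loss is negligible, and last the
    neighbourhood of [A], which depends on all of them. *)
Lemma pressure_lsc A s q0 : locally_constant A -> 0 <= s -> (q0%:E < pressure g A s)%E ->
  exists x y p q, valid (d := d) x y p q s /\ exists2 h : R, 0 < h &
    \forall B \near closef A, forall t x' y', 0 <= t -> valid (d := d) x' y' p q t ->
    `|x' - x| < h -> `|y' - y| < h -> (q0%:E <= pressure g B t)%E.
Proof.
move=> lc s0; have [K K1 [AK BK]] := locally_constant_bounded lc.
have K0 : 0 <= K by apply: le_trans K1.
have [Cs Cs1 HCs] := @psum_sub R S F d d0.
have Crate B t : bounded_by K B -> 0 <= t -> forall n m,
    psum g B t (n + m) <= Cs * (psum g B t n * psum g B t m).
  by move=> HB t0; apply: (HCs g K).
have psum0 B t n : 0 <= psum g B t n by exact: psum_ge0.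
rewrite (pressureE d0 hg K0 AK s0) => q0P.
have [Q /(growth_rate_le (psum0 A s) Cs1 (Crate A s AK s0)) HQ] :=
  growth_le_exists (psum0 A s) Cs1 (Crate A s AK s0).
have [P PE] : exists P : R, growth_rate (psum g A s) = P%:E.
  by move: q0P HQ; case: growth_rate => [r _ _| |] //; exists r.
rewrite PE lte_fin in q0P.
have up e : 0 < e -> growth_le (psum g A s) (P + e).
  move=> e0; apply: (growth_rate_lt (psum0 A s) Cs1 (Crate A s AK s0)).
  by rewrite PE lte_fin ltrDl.
have low r : r < P -> ~ growth_le (psum g A s) r.
  move=> rP /(growth_rate_le (psum0 A s) Cs1 (Crate A s AK s0)).
  by rewrite PE lee_fin leNgt rP.
have [a Aa _] := locally_constant_symbols lc.
have [x [y [p [q [v [b [C [h [[bF b0 C1 h0 Ch] [gapC loopsE]]]]]]]]]] :=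
  loops_exist d0 hg Aa s0 up low (\max_(w <- F) size w).
have {}bF w : w \in F -> (size w <= b)%N.
  by move=> wF; apply: leq_trans bF; exact: leq_bigmax_seq.
exists x, y, p, q; split=> //.
have [x0 y0] := valid_gt0 d0 v.
pose ep := P - q0; have ep0 : 0 < ep by rewrite subr_gt0.
have [Kv Kv0 HKv] := Om_variation hg (divr_gt0 ep0 (ltr0n _ 8)).
have [A01 ACD] := loop_constants h0 C1 Ch.
set A0 := 2 * C * expR (8 * h) in A01 ACD; set D := expR (- (30 * h)) in ACD.
have D0 : 0 < D by exact: expR_gt0.
pose c0 := ((32 * A0 * C) ^+ 2)^-1.
have c00 : 0 < c0.
  have A00 : 0 < A0 := lt_le_trans ltr01 A01.
  have C00 : 0 < C := lt_le_trans ltr01 C1.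
  by rewrite invr_gt0 exprn_gt0 // (mulr_gt0 (mulr_gt0 (ltr0n _ 32) A00) C00).
pose f := @blockf R S F d g a x y p q b.
pose fk (k : b.-tuple S) := if 0 < f [:: k] then f [:: k] else 1.
have fk0 k : 0 < fk k by rewrite /fk; case: ifP.
have [fm [fm0 _ Hfm]] := finite_lower ltr01 fk0.
(* the part of the weight of a loop that does not depend on its length *)
pose cst := expR (- (ep / 8 * b%:R + 2 * Kv)) * (c0 `^ x * c0 `^ y / 4 * fm).
have cst0 : 0 < cst by rewrite !mulr_gt0 ?expR_gt0 ?powR_gt0.
have bR : 0 < b%:R :> R by rewrite ltr0n.
have eb0 : 0 < ep * b%:R / 2 by rewrite divr_gt0 // mulr_gt0.
(* half of the available rate [ep * b] absorbs [cst] and the first block *)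
have [n1 _ Hn1] := near_absorb (expR (q0 * b%:R) / cst) eb0.
have eps0 : 0 < ep * b%:R / 8 by rewrite divr_gt0 // mulr_gt0.
have [k [n [nn1 n0 loopS]]] := loopsE _ n1 eps0.
pose l := (n * b)%N; have l0 : (0 < l)%N by rewrite muln_gt0 n0.
pose m := (b + l)%N.
pose okz (z : seq (b.-tuple S)) :=
  loop_ok f (@blockN R S d a p q b) (@blockG R S d a p q b) C h k z.
have fsub W W' : f (W ++ W') <= f W * f W'.
  by rewrite /f /blockf unblock_cat; apply: wf_sub => //; exact: ltW.
have f0 W : 0 <= f W by exact: wf_ge0.
have okP z : okz z -> [/\ (exists y1 : X, pref y1 (size (k ++ unblock z ++ k)) = k ++ unblock z ++ k),
   (forall i, 0 < minor_norm (endpoint p q i) (wmat a (k ++ unblock z ++ k))),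
   0 < f [:: k], 0 < f z &
   forall i, let kk := endpoint p q i in let N w := minor_norm kk (wmat a w) in
   [/\ N k * N (unblock z) <= A0 * N (k ++ unblock z),
       N (unblock z) * N k <= A0 * N (unblock z ++ k),
       gapG kk (wmat a k) <= D * N k ^+ 2 &
       gapG kk (wmat a (unblock z)) <= D * N (unblock z) ^+ 2]].
  move=> /asboolP [good [fz _]].
  have E : unblock (k :: rcons z k) = k ++ unblock z ++ k.
    by rewrite -cats1 -[k :: _]/([:: k] ++ (z ++ [:: k])) !unblock_cat !unblock1.
  have fz' : 0 < wf g a x y p q (k ++ unblock z ++ k) by rewrite -E.
  have [om pz qz] := wf_gt0 x0 y0 fz'.
  split.
  - exact: Om_gt0 om.
  - by case.
  - exact: (f_gt0_catl f0 fsub (u := [:: k]) fz).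
  - have := f_gt0_catr f0 fsub (u := [:: k]) fz; rewrite -cats1.
    by move=> /(f_gt0_catl f0 fsub).
  move=> i; have [] := good i; rewrite /blockN /blockG !unblock1.
  rewrite -cats1 !unblock_cat unblock1 -[k :: z]/([:: k] ++ z) unblock_cat unblock1.
  by move=> ? ? ? ?; split.
pose wt (kk : nat) (z : seq (b.-tuple S)) :=
  c0 * (minor_norm kk (wmat a k) * minor_norm kk (wmat a (unblock z))).
have /choice [hz Hhz] : forall z : n.-tuple (b.-tuple S), exists r, 0 < r /\ forall x' y',
    `|x' - x| < r -> `|y' - y| < r -> okz z ->
    wt p z `^ x / 2 <= wt p z `^ x' /\ wt q z `^ y / 2 <= wt q z `^ y'.
  move=> z; have [ok|nok] := boolP (okz z); last by exists 1.
  have [_ _ fk1 fz1 _] := okP z ok.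
  have [_ pk qk] := wf_gt0 x0 y0 fk1; have [_ pz qz] := wf_gt0 x0 y0 fz1.
  rewrite unblock1 in pk qk.
  have [r1 r10 H1] := @powR_half R (wt p z) x (mulr_gt0 c00 (mulr_gt0 pk pz)).
  have [r2 r20 H2] := @powR_half R (wt q z) y (mulr_gt0 c00 (mulr_gt0 qk qz)).
  exists (Num.min r1 r2); split; first by rewrite lt_min r10.
  by move=> x' y' hx hy _; split; [apply: H1; apply: lt_le_trans hx _|
    apply: H2; apply: lt_le_trans hy _]; rewrite ge_min lexx ?orbT.
have [r [r0 _ Hr]] := finite_lower ltr01 (fun z => (Hhz z).1).
exists r => //.
have st L kk := stability (a := a) Aa K0 AK kk L D0.
have stb : \forall B \near closef A, forall i L, L \in [:: b; l; m] -> forall y1,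
    stable_block D (endpoint p q i) (wmat a (pref y1 L)) (cocycle_prod B y1 L).
  apply: filterS (filterI (filterI (st b p) (filterI (st l p) (st m p)))
    (filterI (st b q) (filterI (st l q) (st m q)))) => B [[h1 [h2 h3]] [h4 [h5 h6]]] i L.
  by rewrite !inE => /or3P [] /eqP-> y1; case: i.
apply: filterS2 BK stb => B HB HS t x' y' t0 v' hx hy.
have [x'0 y'0] := valid_gt0 d0 v'.
have [Ct Ct1 HCt] := valid_le_phi d0 t.
have Ct0 : 0 < Ct by apply: lt_le_trans Ct1.
have m0 : (0 < m)%N by rewrite addn_gt0 b0.
rewrite (pressureE d0 hg K0 HB t0).
apply: (growth_rate_ge (psum0 B t) Cs1 (Crate B t HB t0) (n0 := m) (c := Ct^-1)) => //.
  by rewrite invr_gt0.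
case=> [//|M] _; rewrite ler_pdivrMl //.
have su : size k = b by rewrite size_tuple.
pose V (w : seq S) := Ct * wsup (cylval g B t (size w)) (size w) w.
pose okw (w : seq S) := `[< exists z, [/\ size z = n, w = unblock z & okz z] >].
pose th := loop_weight g k l (ep / 8) Kv a p q A0 C x' y'.
have th0 w : 0 <= th w.
  by rewrite /th /loop_weight !mulr_ge0 ?expR_ge0 ?Om_ge0 ?powR_ge0.
have V0 w : 0 <= V w.
  by rewrite /V; apply: mulr_ge0; [exact: ltW|apply: wsup_ge0 => y1; exact: cylval_ge0].
have [Lc HLc] := cylval_bounded d0 hg K0 HB t0.
have V_ge n' (zz : nat -> seq S) : (forall j, size (zz j) = l /\ okw (zz j)) ->
    \prod_(j < n'.+1) th (zz j) <= V (flatten (mkseq (fun j => k ++ zz j) n'.+1)).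
  move=> Hzz; have zl j : size (zz j) = l by exact: (Hzz j).1.
  have /choice [z' Hz'] : forall j, exists z, zz j = unblock z /\ okz z.
    by move=> j; have /asboolP [z [_ ze zo]] := (Hzz j).2; exists z.
  have Fk w : w \in F -> (size w <= size k)%N by rewrite su; exact: bF.
  have [|x1 Hx1] := loops_glue l0 Fk zl.
    move=> j; have [[y1 Hy1] _ _ _ _] := okP _ (Hz' j).2.
    by exists y1; rewrite -addnA -(zl j) (Hz' j).1 -!size_cat.
  have H := @loop_value R S F d g x1 k zz l (ep / 8) Kv zl Hx1 HKv a B p q A0 C D A01 C1
    (ltW D0) ACD _ _ _ _ gapC x' y' t Ct (ltW x'0) (ltW y'0) (fun M1 => HCt _ _ _ _ M1 v') n'.
  apply: le_trans (H _ _ _ _) _ => {H}.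
  - by move=> i L; rewrite su; exact: HS.
  - by move=> i j; have [_ N0 _ _ _] := okP _ (Hz' j).2; rewrite (Hz' j).1.
  - by move=> i j; have [_ _ _ _ /(_ i) []] := okP _ (Hz' j).2; rewrite (Hz' j).1.
  - by move=> i j; have [_ _ _ _ /(_ i) []] := okP _ (Hz' j).2; rewrite (Hz' j).1.
  rewrite /V -(pref_loops zl Hx1) size_pref; apply: ler_wpM2l; first exact: ltW.
  exact: (@wsup_ge R S F (cylval g B t (n'.+1 * (size k + l))) _ (Lc _) x1 (HLc _)).
have := @loop_power R S V k okw th l V0 th0 V_ge M.
have -> : wsum (M.+1 * (size k + l)) V = Ct * psum g B t (M.+1 * m).
  rewrite su -/m /psum /cylsum -wsumZ; apply: eq_wsum => w wm; by rewrite /V wm.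
apply: le_trans.
rewrite natrM mulrCA expRM_natl.
apply: lerXn2r; rewrite ?nnegrE ?expR_ge0 //.
  by apply: wsum_ge0 => w _; case: ifP.
apply: (@le_trans _ _ (wsum n (fun z : seq (b.-tuple S) =>
   cst * expR (- (ep / 8 * l%:R)) * (if okz z then f z else 0)))); last first.
  rewrite -(@wsum_unblock R S b n (fun w => if okw w then th w else 0)).
  apply: ler_wsum => z zn; case: ifP => okzz; last by rewrite mulr0; case: ifP.
  have -> : okw (unblock z) by apply/asboolP; exists z.
  have [_ _ fk1 fz1 _] := okP z okzz.
  have szn : size z == n by rewrite zn.
  have [wp wq] := (Hhz (Tuple szn)).2 x' y' (lt_le_trans hx (Hr _)) (lt_le_trans hy (Hr _)) okzz.
  have powE kk a' : (wt kk z) `^ a' = c0 `^ a' * (minor_norm kk (wmat a k) `^ a' * minor_norm kk (wmat a (unblock z)) `^ a').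
    rewrite /wt (powRM _ (ltW c00)) ?mulr_ge0 ?minor_norm_ge0 //.
    by rewrite (powRM _ (minor_norm_ge0 _ _) (minor_norm_ge0 _ _)).
  have fmk : fm <= f [:: k] by have := Hfm k; rewrite /fk fk1.
  have {}fmk : fm <= Om g k * (minor_norm p (wmat a k) `^ x * minor_norm q (wmat a k) `^ y).
    by move: fmk; rewrite /f /blockf unblock1.
  have fE : f z = Om g (unblock z) * (minor_norm p (wmat a (unblock z)) `^ x *
     minor_norm q (wmat a (unblock z)) `^ y) by [].
  rewrite {}fE; rewrite powE in wp; rewrite powE in wq.
  rewrite /th /loop_weight.
  have -> : expR (- (ep / 8 * (size k + l)%:R + 2 * Kv)) =
     expR (- (ep / 8 * b%:R + 2 * Kv)) * expR (- (ep / 8 * l%:R)).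
    by rewrite -expRD su natrD; congr expR; ring.
  apply: le_trans (ler_wpM2l _ (ler_pM _ _ wp wq)); last 3 first.
  - by rewrite !mulr_ge0 ?expR_ge0 ?Om_ge0.
  - by rewrite divr_ge0 ?mulr_ge0 ?powR_ge0.
  - by rewrite divr_ge0 ?mulr_ge0 ?powR_ge0.
  have ok0 := Om_ge0 g k; have oz0 := Om_ge0 g (unblock z).
  rewrite /cst; move: fmk ok0 oz0.
  move: (powR_ge0 (minor_norm p (wmat a k)) x) (powR_ge0 (minor_norm q (wmat a k)) y).
  move: (powR_ge0 (minor_norm p (wmat a (unblock z))) x) (powR_ge0 (minor_norm q (wmat a (unblock z))) y).
  move: (expR_ge0 (- (ep / 8 * b%:R + 2 * Kv))) (expR_ge0 (- (ep / 8 * l%:R))).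
  move: (powR_ge0 c0 x) (powR_ge0 c0 y).
  move: (minor_norm p (wmat a (unblock z)) `^ x) (minor_norm q (wmat a (unblock z)) `^ y).
  move: (minor_norm p (wmat a k) `^ x) (minor_norm q (wmat a k) `^ y).
  move: (expR (- (ep / 8 * b%:R + 2 * Kv))) (expR (- (ep / 8 * l%:R))).
  move: (c0 `^ x) (c0 `^ y) (Om g k) (Om g (unblock z)).
  clear => c1 c2 o1 o2 e1 e2 a1 a2 b1 b2 c10 c20 e10 e20 b10 b20 a10 a20 fmk o10 o20.
  apply: (@le_trans _ _ (e1 * (c1 * c2 / 4 * (o1 * (a1 * a2))) * e2 * (o2 * (b1 * b2)))).
    apply: ler_wpM2r; first by rewrite !mulr_ge0.
    apply: ler_wpM2r => //; apply: ler_wpM2l => //; apply: ler_wpM2l => //.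
    by rewrite !mulr_ge0.
  by rewrite le_eqVlt; apply/orP; left; apply/eqP; field.
rewrite wsumZ.
have ls : (expR (P * b%:R) * expR (- (ep * b%:R / 8))) ^+ n <=
    wsum n (fun z : seq (b.-tuple S) => if okz z then f z else 0) by exact: loopS.
apply: le_trans (ler_wpM2l _ ls); last by rewrite mulr_ge0 ?expR_ge0 // ltW.
have := Hn1 n nn1; rewrite ler_pdivrMr // => H.
have -> : expR (q0 * m%:R) = expR (q0 * l%:R) * expR (q0 * b%:R).
  by rewrite -expRD /m natrD; congr expR; ring.
apply: le_trans (ler_wpM2l (expR_ge0 _) H) _.
rewrite mulrA mulrC -[leRHS]mulrA ler_pM2l //.
rewrite -!expRD -expRM_natr -expRD ler_expR /l natrM.
set nn := n%:R; have nn0 : 0 <= nn by rewrite /nn.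
have bn0 : 0 <= ep * (b%:R * nn) / 4 by rewrite divr_ge0 // mulr_ge0 ?mulr_ge0 // ltW.
rewrite -subr_ge0; apply: le_trans bn0 _; rewrite le_eqVlt; apply/orP; left; apply/eqP.
by rewrite /ep; field.
Qed.

End LowerSemicontinuity.

(** * Joint continuity *)

Section Joint.
Context {R : realType} {S : finType} {F : seq (seq S)} {d : nat}.
Hypothesis d0 : (0 < d)%N.
Local Notation X := (sft F).
Implicit Types (A B : X -> 'M[R]_d) (g : X -> R).

Lemma nbhs_closef (A : {uniform X -> 'M[R]_d}) (Q : set (X -> 'M[R]_d)) :
  closef A Q -> nbhs A Q.
Proof.
move=> [e e0 HQ]; apply/uniform_nbhs.
have dR : 0 < (d * d)%:R :> R by rewrite ltr0n muln_gt0 d0.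
have r0 : 0 < e / (d * d)%:R by rewrite divr_gt0.
exists [set xy | ball xy.1 (e / (d * d)%:R) xy.2]; split; first exact: (entourage_ball _ (PosNum r0)).
move=> B HB; apply: HQ => x; rewrite minor_norm1E.
apply: (@le_trans _ _ (\sum_(i < d) \sum_(j < d) (e / (d * d)%:R))).
  apply: ler_sum => i _; apply: ler_sum => j _; rewrite !mxE distrC.
  have [_ H] := HB x I; exact: ltW (H i j).
by rewrite !sumr_const !card_ord -mulrnA -[leLHS]mulr_natr divfK // gt_eqF.
Qed.

Lemma det_near (M : 'M[R]_d) : M \in unitmx ->
  \forall M' \near M, `|\det M| / 2 <= `|\det M'|.
Proof.
rewrite unitmxE unitfE => D0.
have dt : {for M, continuous (fun X : 'M[R]_d => `|\det X|)}.
  apply: (@continuous_comp _ _ _ (fun X : 'M[R]_d => \det X)); last exact: norm_continuous.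
  have := @minor_continuous R d d M id id; congr (continuous_at _ _).
  by apply/funext => X'; congr determinant; apply/matrixP => i j; rewrite mxE.
have h : 0 < `|\det M| / 2 by rewrite divr_gt0 ?normr_gt0.
have /cvgrPdist_lt /(_ _ h) := dt.
by apply: filterS => M'; rewrite ltr_distl => /andP [_ H]; move: H; lra.
Qed.

Lemma invertible_near A : locally_constant A -> (forall x, A x \in unitmx) ->
  exists2 e : R, 0 < e & \forall B \near closef A, forall x, e <= `|\det (B x)|.
Proof.
move=> /locally_constant_symbols [a Aa a1] Au.
have au c : a c \in unitmx by have [[x <-]|->] := a1 c; rewrite ?Au ?unitmx1.
have dp c : 0 < `|\det (a c)| / 2.
  by rewrite divr_gt0 // normr_gt0 -unitfE -unitmxE.
have [e [e0 _ He]] := finite_lower ltr01 dp.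
exists e => //.
have /choice [rr Hrr] : forall c, exists r, 0 < r /\
    forall M', minor_norm 1 (M' - a c) <= r -> `|\det (a c)| / 2 <= `|\det M'|.
  by move=> c; have [r r0 H] := nbhs_minor_norm1 (det_near (au c)); exists r.
have [r [r0 _ Hr]] := finite_lower ltr01 (fun c => (Hrr c).1).
exists r => // B HB x; apply: le_trans (He (coord x 0%N)) _.
by apply: (Hrr (coord x 0%N)).2; rewrite -Aa; exact: le_trans (HB x) (Hr _).
Qed.

(** The exponents of an interpolation move continuously with [s], except when
    [s] is an integer below [d] carried by a single minor norm. *)
Lemma valid_perturb x y p q (s : R) : valid (d := d) x y p q s ->
  (q < d)%N /\ s = q%:R \/
  exists2 h, 0 < h & forall t, s <= t -> t - s < h -> exists x' y',
    [/\ valid (d := d) x' y' p q t, `|x' - x| <= t - s & `|y' - y| <= t - s].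
Proof.
move=> [qd]; have d1 : 1 <= d%:R :> R by rewrite ler1n.
have dR : 0 < d%:R :> R by rewrite ltr0n.
have sc t : s <= t -> `|t / d%:R / 2 - s / d%:R / 2| <= t - s.
  move=> st; rewrite -!mulrBl ger0_norm ?divr_ge0 ?subr_ge0 //.
  rewrite ler_pdivrMr // ler_pdivrMr // -mulrA ler_peMr ?subr_ge0 //.
  by rewrite mulr_ege1 // ler1n.
case=> [[pq ps sq xE yE]|[pE sE xE yE]|[pE qE ds xE yE]].
- right; exists (q%:R - s) => [|t st ts]; first by rewrite subr_gt0.
  have qp1 : 1 <= q%:R - p%:R :> R by exact: dist_ge1.
  have qp : 0 < q%:R - p%:R :> R by apply: lt_le_trans qp1.
  exists ((q%:R - t) / (q%:R - p%:R)), ((t - p%:R) / (q%:R - p%:R)).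
  have bd : `|(t - s) / (q%:R - p%:R)| <= t - s.
    have ts0 : 0 <= t - s by rewrite subr_ge0.
    by rewrite ger0_norm ?ler_pdivrMr ?ler_peMr // divr_ge0 // ltW.
  split.
  + split=> //; apply: Or31; split => //; first exact: lt_le_trans st.
    by rewrite -(ltrD2r (- s)).
  + rewrite xE -mulrBl; have -> : q%:R - t - (q%:R - s) = - (t - s) by ring.
    by rewrite mulNr normrN.
  + rewrite yE -mulrBl.
    by have -> : t - p%:R - (s - p%:R) = t - s by ring.
- have [qd'|dq] := ltnP q d; first by left.
  have qE : q = d by apply/eqP; rewrite eqn_leq qd dq.
  right; exists 1 => // t st _.
  have [->|ne] := eqVneq t s.
    by exists x, y; rewrite !subrr !normr0; split=> //; split=> //; apply: Or32.
  have ts : d%:R < t by rewrite -qE -sE lt_def ne.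
  exists (t / d%:R / 2), (t / d%:R / 2).
  have E : 2^-1 = s / d%:R / 2 by rewrite sE qE divff ?mul1r // gt_eqF.
  have sc1 := sc t st; rewrite -E in sc1.
  split; [|by rewrite xE|by rewrite yE].
  by split=> //; apply: Or33.
- right; exists 1 => // t st _; exists (t / d%:R / 2), (t / d%:R / 2).
  split; [|rewrite xE; exact: sc|rewrite yE; exact: sc].
  by split=> //; apply: Or33; split => //; apply: lt_le_trans ds st.
Qed.

Lemma real_between_lower (l : \bar R) (q : R) : (q%:E < l)%E -> exists2 p, q < p & (p%:E < l)%E.
Proof.
case: l => [r| |] //; last by exists (q + 1); rewrite ?ltrDl ?ltry.
by rewrite lte_fin => rq; exists ((r + q) / 2); rewrite ?lte_fin; lra.
Qed.

Lemma small_mul (k c : R) : 0 <= k -> 0 < c -> exists2 h, 0 < h & forall t, 0 <= t -> t < h ->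
  t * k <= c.
Proof.
move=> k0 c0; have k1 : 0 < k + 1 by rewrite ltr_wpDl.
exists (c / (k + 1)) => [|t t0 th]; first exact: divr_gt0.
apply: (@le_trans _ _ (c / (k + 1) * (k + 1))); last by rewrite divfK // gt_eqF.
by apply: ler_pM => //; [exact: ltW|rewrite lerDl].
Qed.

(** To the left of [s] a small pressure at [t] would by [growth_exponent_up]
    force a small pressure at [s].  To the right the exponents are moved along
    with [t] when [valid_perturb] allows it; otherwise [A] is invertible and
    [growth_exponent_down] applies. *)
Lemma pressure_lsc_joint g A s q0 : continuous g -> locally_constant A -> 0 <= s ->
  (forall k : nat, (k < d)%N -> s <> k%:R) \/ (forall x, A x \in unitmx) ->
  (q0%:E < pressure g A s)%E -> exists2 h, 0 < h &
  \forall B \near closef A, forall t, 0 <= t -> `|t - s| < h ->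
    (q0%:E <= pressure g B t)%E.
Proof.
move=> hg lc s0 cond /real_between_lower [q1 q01 q1P].
have [K K1 [AK BK]] := locally_constant_bounded lc.
have K00 : 0 < K by apply: lt_le_trans K1.
have K0 := ltW K00.
have [C C1 HC] := @psum_sub R S F d d0.
have Crate B t : bounded_by K B -> 0 <= t -> forall n m,
    psum g B t (n + m) <= C * (psum g B t n * psum g B t m).
  by move=> HB t0; apply: (HC g K).
have psum0 B t n : 0 <= psum g B t n by exact: psum_ge0.
have contra B t c : bounded_by K B -> 0 <= t -> c < q1 ->
    (q1%:E <= pressure g B s)%E ->
    (growth_le (psum g B t) q0 -> growth_le (psum g B s) c) -> (q0%:E <= pressure g B t)%E.
  move=> HB t0 cq H1 H2; rewrite leNgt; apply/negP.
  rewrite (pressureE d0 hg K0 HB t0) => /(growth_rate_lt (psum0 B t) C1 (Crate B t HB t0)) /H2.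
  move=> /(growth_rate_le (psum0 B s) C1 (Crate B s HB s0)).
  rewrite -(pressureE d0 hg K0 HB s0) => H3.
  by have := le_trans H1 H3; rewrite lee_fin leNgt cq.
have c0 : 0 < (q1 - q0) / 2 by rewrite divr_gt0 // subr_gt0.
have [x [y [p [q [v [h h0 H]]]]]] := pressure_lsc d0 hg lc s0 q1P.
have lnK : 0 <= ln K by rewrite ln_ge0.
have [h1 h10 Hh1] := small_mul lnK c0.
have Hs : \forall B \near closef A, (q1%:E <= pressure g B s)%E.
  apply: filterS H => B /(_ s x y s0 v).
  by rewrite !subrr normr0 => /(_ h0 h0).
have left_side : \forall B \near closef A, forall t, 0 <= t -> t <= s -> s - t < h1 ->
    (q0%:E <= pressure g B t)%E.
  apply: filterS2 BK Hs => B HB HBs t t0 ts sth.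
  apply: (contra B t (q0 + (s - t) * ln K)) => //; last exact: growth_exponent_up.
  have := Hh1 (s - t); rewrite subr_ge0 => /(_ ts sth); move: q01; lra.
suff [h2 h20 right_side] : exists2 h2, 0 < h2 & \forall B \near closef A, forall t, s <= t ->
    t - s < h2 -> (q0%:E <= pressure g B t)%E.
  exists (Num.min h1 h2); first by rewrite lt_min h10.
  apply: filterS2 left_side right_side => B HL HR t t0; rewrite lt_min => /andP [th1 th2].
  have [ts|st] := leP t s.
    by apply: HL => //; rewrite distrC ger0_norm ?subr_ge0 // in th1.
  by apply: HR; rewrite ?(ltW st) //; rewrite ger0_norm ?subr_ge0 ?(ltW st) // in th2.
have [[qd sE]|[h2 h20 Hv]] := valid_perturb v; last first.
  exists (Num.min h h2); first by rewrite lt_min h0.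
  apply: filterS H => B HB t st; rewrite lt_min => /andP [th th2].
  have t0 := le_trans s0 st.
  have [x' [y' [v' hx hy]]] := Hv t st th2.
  apply: (@le_trans _ _ q1%:E); first by rewrite lee_fin ltW.
  by apply: (HB t x' y') => //; [exact: le_lt_trans hx th|exact: le_lt_trans hy th].
case: cond => [/(_ q qd) //|Au].
have [e e0 Be] := invertible_near lc Au.
have [k k0 Hk] := growth_exponent_down (F := F) d0 K00 e0.
have [h3 h30 Hh3] := small_mul k0 c0.
have sd : 0 < d%:R - s by rewrite subr_gt0 sE ltr_nat.
exists (Num.min (d%:R - s) h3); first by rewrite lt_min sd.
apply: filterS3 BK Be Hs => B HB HBe HBs t st; rewrite lt_min => /andP [td th].
have t0 := le_trans s0 st.
apply: (contra B t (q0 + (t - s) * k)) => //.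
  have := Hh3 (t - s); rewrite subr_ge0 => /(_ st th); move: q01; lra.
by apply: Hk => //; rewrite -subr_ge0; move: td; lra.
Qed.

End Joint.

Theorem theorem1p4 (R : realType) (S : finType) (F : seq (seq S))
    (g : sft F -> R) (hg : continuous g) (d : nat) (hd : (0 < d)%N) :
  (forall (s : R) (A : {uniform sft F -> 'M[R]_d}),
      0 < s -> locally_constant A ->
      {for A, continuous
        (fun B : {uniform sft F -> 'M[R]_d} => pressure g B s)})
  /\
  (forall (s : R) (A : {uniform sft F -> 'M[R]_d}),
      0 <= s -> locally_constant A ->
      (forall k : nat, (k < d)%N -> s <> k%:R) \/
      (forall x : sft F, A x \in unitmx) ->
      (fun Bt : {uniform sft F -> 'M[R]_d} * R => pressure g Bt.1 Bt.2)
        @ within [set Bt | 0 <= Bt.2] (nbhs (A, s))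
        --> pressure g A s).
Proof.
split=> [s A s0 lc|s A s0 lc cond].
- have s0' := ltW s0; apply: (@ereal_cvg_real_bounds R _ (nbhs A) (nbhs_filter A)) => q qP.
    have [x [y [p [r [v [h h0 H]]]]]] := pressure_lsc hd hg lc s0' qP.
    apply: nbhs_closef => //; apply: filterS H => B /(_ s x y s0' v).
    by rewrite !subrr normr0 => /(_ h0 h0).
  have [h h0 H] := pressure_usc hd hg lc s0' qP.
  by apply: nbhs_closef => //; apply: filterS H => B; apply; rewrite ?subrr ?normr0.
- have joint (Q : set (\bar R)) h : 0 < h ->
      (\forall B \near closef A, forall t, 0 <= t -> `|t - s| < h -> Q (pressure g B t)) ->
      \forall Bt \near within [set Bt : {uniform sft F -> 'M[R]_d} * R | 0 <= Bt.2] (nbhs (A, s)),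
        Q (pressure g Bt.1 Bt.2).
    move=> h0 H; exists ([set B | forall t, 0 <= t -> `|t - s| < h -> Q (pressure g B t)],
      [set t | `|t - s| < h]) => /=.
      split; first exact: nbhs_closef.
      by apply: filterS (nbhsx_ballx s h h0) => t; rewrite /ball /= distrC.
    by move=> [B t] /= [HB ts] t0; apply: HB.
  apply: ereal_cvg_real_bounds => q qP.
    have [h h0 H] := pressure_lsc_joint hd hg lc s0 cond qP.
    exact: (joint [set l | (q%:E <= l)%E] h h0 H).
  have [h h0 H] := pressure_usc hd hg lc s0 qP.
  exact: (joint [set l | (l <= q%:E)%E] h h0 H).
Qed.
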